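(* Let $X$ be a Dynkin diagram of $\mathrm{Ext}$ type. Then: (1) If $X\in\mathrm{Hyp}$, there are exactly two $\pi$-systems of type $A_1^{++}$ in $X$ up to $W(X)$-equivalence. In other words, $\mathfrak m(A_1^{++},X)=2$ for $X=A_n^{++}$ ($1\le n\le 7$), $D_n^{++}$ ($4\le n\le 8$), $E_n^{++}$ ($n=6,7,8$). (2) $\mathfrak m(A_1^{++},A_8^{++})=6$, and $\mathfrak m(A_1^{++},A_n^{++})=10$ for $n\ge 9$. (3) $\mathfrak m(A_1^{++},D_9^{++})=6$, and $\mathfrak m(A_1^{++},D_n^{++})=4$ for $n\ge 10$.
   Context: A generalized Cartan matrix (GCM) is an integer square matrix $A=(a_{ij})$ with $a_{ii}=2$, $a_{ij}\le 0$ for $i\ne j$, and $a_{ij}=0$ whenever $a_{ji}=0$. $\mathfrak{g}(A)$ is the associated Kac-Moody algebra over $\mathbb C$. For a symmetrizable GCM $A$ the Dynkin diagram $X=S(A)$ is identified with $A$; we write $\mathfrak g(X)$, $W(X)$ (Weyl group), $\alpha_p$ ($p$ a vertex; simple roots), etc. $X$ is simply-laced if $A$ is symmetric; then we use the bilinear form on the root lattice given by $(\alpha_i\mid\alpha_j)=a_{ij}$. A $\pi$-system in $X$ is a finite set of distinct real roots $\{\beta_1,\dots,\beta_m\}$ of $\mathfrak{g}(X)$ such that $\beta_i-\beta_j$ is not a root for all $i\neq j$. Its type is the GCM $(\langle\beta_i^\vee,\beta_j\rangle)_{i,j}$ ($\beta^\vee$ the coroot of $\beta$), taken up to simultaneous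 permutation of rows and columns. $\mathfrak m(B,X)$ denotes the number of $W(X)$-orbits of $\pi$-systems of type $B$ in $X$. A simply-laced Dynkin diagram $Z$ is of $\mathrm{Ext}$ type (an overextension) if there is a vertex $p$ of $Z$ such that $Y=Z\setminus\{p\}$ is of affine type and $(\delta_Y\mid\alpha_p)=-1$, where $\delta_Y$ is the null root of $Y$ (the positive imaginary root of $Y$ of minimal height). Up to isomorphism these are $A_n^{++}$ ($n\ge1$), $D_n^{++}$ ($n\ge4$), $E_n^{++}$ ($n=6,7,8$), where $X_n^{++}$ (with $n+2$ vertices) is obtained from the untwisted affine diagram $X_n^{(1)}$ by adding one new vertex joined by a single edge to the affine (zeroth) vertex and to no other vertex. In particular $A_1^{++}$ is the GCM $\begin{pmatrix}2&-1&0\\-1&2&-2\\0&-2&2\end{pmatrix}$. An indecomposable symmetrizable GCM is of hyperbolic type if it is not of finite or affine type and every proper principal submatrix is a direct sum of GCMs of finite or affine type. $\mathrm{Hyp}$ is the set of all symmetrizable GCMs (diagrams) of hyperbolic type of rank $\ge3$. *)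

(* Defs.v *)
From mathcomp Require Import all_boot all_order all_algebra.
From mathcomp Require Import complex.
From mathcomp Require Import boolp classical_sets functions cardinality reals.

Set Implicit Arguments.
Unset Strict Implicit.
Unset Printing Implicit Defensive.

Import Order.TTheory GRing.Theory Num.Theory.

Local Open Scope card_scope.
Local Open Scope classical_set_scope.
Local Open Scope ring_scope.

(** * Generalized Cartan matrices *)

Definition is_gcm n (A : 'M[int]_n) : Prop :=
  [/\ forall i, A i i = 2,
      forall i j, i != j -> A i j <= 0 &
      forall i j, A j i = 0 -> A i j = 0].

Definition simply_laced n (A : 'M[int]_n) : Prop := A^T = A.

Definition indecomposable n (A : 'M[int]_n) : Prop :=
  (0 < n)%N /\
  forall S : {set 'I_n}, S != finset.set0 -> S != [set: 'I_n]%SET ->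
    ~ (forall i j, i \in S -> j \notin S -> A i j = 0 /\ A j i = 0).

Definition symmetrizable (R : realType) n (A : 'M[int]_n) : Prop :=
  exists (d : 'rV[R]_n) (B : 'M[R]_n),
    [/\ forall i, d 0 i != 0, B^T = B & map_mx intr A = diag_mx d *m B].

(* Finite and affine type in the sense of the trichotomy of indecomposable
   matrices (Kac, "Infinite dimensional Lie algebras", Theorem 4.3). *)
Definition finite_type (R : realType) n (A : 'M[int]_n) : Prop :=
  let AR : 'M[R]_n := map_mx intr A in
  [/\ is_gcm A, indecomposable A, \det AR != 0,
      exists u : 'cV[R]_n,
        (forall i, 0 < u i 0) /\ (forall i, 0 < (AR *m u) i 0) &
      forall v : 'cV[R]_n, (forall i, 0 <= (AR *m v) i 0) ->
        (forall i, 0 < v i 0) \/ v = 0].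

Definition affine_type (R : realType) n (A : 'M[int]_n) : Prop :=
  let AR : 'M[R]_n := map_mx intr A in
  [/\ is_gcm A, indecomposable A, (\rank AR).+1 = n,
      exists u : 'cV[R]_n, (forall i, 0 < u i 0) /\ AR *m u = 0 &
      forall v : 'cV[R]_n, (forall i, 0 <= (AR *m v) i 0) -> AR *m v = 0].

Definition principal n (A : 'M[int]_n) (S : {set 'I_n}) : 'M[int]_#|S| :=
  mxsub enum_val enum_val A.

(* The principal submatrix on S is, up to simultaneous permutation of rows and
   columns, a direct sum of matrices of finite or affine type. *)
Definition finite_affine_sum (R : realType) n (A : 'M[int]_n)
    (S : {set 'I_n}) : Prop :=
  exists P : {set {set 'I_n}},
    [/\ finset.partition P S,
        forall T, T \in P ->
          finite_type R (principal A T) \/ affine_type R (principal A T) &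
        forall T U i j, T \in P -> U \in P -> T != U -> i \in T -> j \in U ->
          A i j = 0].

(* "Rank" is the number of vertices. *)
Definition Hyp (R : realType) n (A : 'M[int]_n) : Prop :=
  [/\ is_gcm A, indecomposable A, symmetrizable R A, (3 <= n)%N &
      [/\ ~ finite_type R A, ~ affine_type R A &
          forall S : {set 'I_n}, S != [set: 'I_n]%SET ->
            finite_affine_sum R A S]].

(** * Kac-Moody algebras *)

Record lieAlgebra (K : fieldType) := LieAlgebra {
  lie_sort :> lmodType K;
  lie_br : lie_sort -> lie_sort -> lie_sort;
  lie_brPl : forall a x y z,
    lie_br (a *: x + y) z = a *: lie_br x z + lie_br y z;
  lie_brPr : forall a x y z,
    lie_br z (a *: x + y) = a *: lie_br z x + lie_br z y;
  lie_brxx : forall x, lie_br x x = 0;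
  lie_jacobi : forall x y z,
    lie_br x (lie_br y z) + lie_br y (lie_br z x) + lie_br z (lie_br x y) = 0
}.

Definition subspace (K : fieldType) (L : lmodType K) (V : set L) : Prop :=
  V 0 /\ forall a x y, V x -> V y -> V (a *: x + y).

Definition lie_subalgebra (K : fieldType) (L : lieAlgebra K) (V : set L) :=
  subspace V /\ forall x y, V x -> V y -> V (lie_br x y).

Definition lie_ideal (K : fieldType) (L : lieAlgebra K) (V : set L) :=
  subspace V /\ forall x y, V y -> V (lie_br x y).

Definition cartan_dim (K : fieldType) n (A : 'M[int]_n) : nat :=
  (2 * n - \rank (map_mx intr A : 'M[K]_n))%N.

(* A minimal realization, with the Cartan subalgebra identified with row
   vectors: the simple coroots are the rows of [rcoroot], and the simple roots
   are the linear forms given by the columns of [rroot]. *)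
Record realization (K : fieldType) n (A : 'M[int]_n) := Realization {
  rcoroot : 'M[K]_(n, cartan_dim K A);
  rroot : 'M[K]_(cartan_dim K A, n);
  rcoroot_free : row_free rcoroot;
  rroot_free : row_free rroot^T;
  realizationE : rcoroot *m rroot = map_mx intr A
}.

(* The Kac-Moody algebra g(A): a Lie algebra generated by the Cartan subalgebra
   and Chevalley generators subject to the relations [km_hh]-[km_hf], in which
   the Cartan subalgebra embeds and every ideal meeting it trivially is zero.
   This determines g(A) up to isomorphism (Kac, Proposition 1.4). *)
Record kacMoody (K : fieldType) n (A : 'M[int]_n) := KacMoody {
  km_real : realization K A;
  km_lie :> lieAlgebra K;
  km_h : {linear 'rV[K]_(cartan_dim K A) -> km_lie};
  km_e : 'I_n -> km_lie;
  km_f : 'I_n -> km_lie;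
  km_h_inj : injective km_h;
  km_hh : forall h h', lie_br (km_h h) (km_h h') = 0;
  km_ef : forall i j, lie_br (km_e i) (km_f j) =
    if i == j then km_h (row i (rcoroot km_real)) else 0;
  km_he : forall h i,
    lie_br (km_h h) (km_e i) = (h *m rroot km_real) 0 i *: km_e i;
  km_hf : forall h i,
    lie_br (km_h h) (km_f i) = - (h *m rroot km_real) 0 i *: km_f i;
  km_gen : forall V : set km_lie, lie_subalgebra V ->
    (forall h, V (km_h h)) -> (forall i, V (km_e i)) ->
    (forall i, V (km_f i)) -> V = setT;
  km_no_ideal : forall V : set km_lie, lie_ideal V ->
    (forall h, V (km_h h) -> h = 0) -> V = [set 0]
}.

(** * Roots *)

(* Elements of the root lattice (resp. the coroot lattice) are row vectors of
   coordinates in the basis of simple roots (resp. simple coroots). *)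

Definition root_space (K : fieldType) n (A : 'M[int]_n) (g : kacMoody K A)
    (a : 'rV[int]_n) : set g :=
  [set x | forall h, lie_br (km_h g h) x =
     (\sum_j (a 0 j)%:~R * (h *m rroot (km_real g)) 0 j) *: x].
Arguments root_space [K n A] g a _.

(* As g(A) is unique up to isomorphism, quantifying over its models
   existentially or universally is the same. *)
Definition is_root (R : realType) n (A : 'M[int]_n) (a : 'rV[int]_n) : Prop :=
  a != 0 /\ exists (g : kacMoody R[i] A) (x : g), root_space g a x /\ x != 0.

Definition simple_root n (i : 'I_n) : 'rV[int]_n := delta_mx 0 i.

(* [pairing A c a] is < c , a > for c in the coroot lattice and a in the root
   lattice.  When A is symmetric it is also the bilinear form (c | a). *)
Definition pairing n (A : 'M[int]_n) (c a : 'rV[int]_n) : int :=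
  (c *m A *m a^T) 0 0.

Definition refl n (A : 'M[int]_n) (i : 'I_n) (a : 'rV[int]_n) : 'rV[int]_n :=
  a - pairing A (simple_root i) a *: simple_root i.

Definition corefl n (A : 'M[int]_n) (i : 'I_n) (c : 'rV[int]_n) : 'rV[int]_n :=
  c - pairing A c (simple_root i) *: simple_root i.

(* Elements of the Weyl group are represented by words in the simple
   reflections. *)
Definition weyl n (A : 'M[int]_n) (w : seq 'I_n) (a : 'rV[int]_n) :=
  foldr (refl A) a w.

Definition coweyl n (A : 'M[int]_n) (w : seq 'I_n) (c : 'rV[int]_n) :=
  foldr (corefl A) c w.

Definition real_root n (A : 'M[int]_n) (b : 'rV[int]_n) : Prop :=
  exists w i, b = weyl A w (simple_root i).

(* c is the coroot of the real root b: the action of w on the Cartan subalgebra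
   sends the simple coroot of i to that of the root w(alpha_i). *)
Definition is_coroot n (A : 'M[int]_n) (b c : 'rV[int]_n) : Prop :=
  exists w i, b = weyl A w (simple_root i) /\ c = coweyl A w (simple_root i).

Definition height n (a : 'rV[int]_n) : int := \sum_i a 0 i.

Definition positive_imaginary_root (R : realType) n (A : 'M[int]_n)
    (a : 'rV[int]_n) : Prop :=
  [/\ is_root R A a, ~ real_root A a & forall i, 0 <= a 0 i].

Definition null_root (R : realType) n (A : 'M[int]_n) (d : 'rV[int]_n) : Prop :=
  positive_imaginary_root R A d /\
  forall a, positive_imaginary_root R A a -> height d <= height a.

(** * Pi-systems *)

Definition pi_system (R : realType) n (A : 'M[int]_n) (S : set 'rV[int]_n) :=
  [/\ finite_set S, forall b, S b -> real_root A b &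
      forall b b', S b -> S b' -> b <> b' -> ~ is_root R A (b - b')].

(* The freedom in the enumeration b of S accounts for simultaneous
   permutations of the rows and columns of B. *)
Definition has_type n (A : 'M[int]_n) (S : set 'rV[int]_n)
    m (B : 'M[int]_m) : Prop :=
  exists b c : 'I_m -> 'rV[int]_n,
    [/\ injective b, S = range b, forall i, is_coroot A (b i) (c i) &
        forall i j, pairing A (c i) (b j) = B i j].

Definition weyl_orbit n (A : 'M[int]_n) (S : set 'rV[int]_n)
    : set (set 'rV[int]_n) :=
  [set T | exists w, T = weyl A w @` S].

Definition pi_orbits (R : realType) m (B : 'M[int]_m) n (A : 'M[int]_n)
    : set (set (set 'rV[int]_n)) :=
  weyl_orbit A @` [set S | pi_system R A S /\ has_type A S B].

(* m(B, A) = k *)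
Definition pi_mult_eq (R : realType) m (B : 'M[int]_m) n (A : 'M[int]_n)
    (k : nat) : Prop :=
  pi_orbits R B A #= `I_k.

(** * Overextensions *)

Definition remove_vertex n (A : 'M[int]_n) (p : 'I_n) : 'M[int]_n.-1 :=
  row' p (col' p A).

(* The inclusion of the root lattice of the diagram without p. *)
Definition extend n (p : 'I_n) (a : 'rV[int]_n.-1) : 'rV[int]_n :=
  \row_i oapp (a 0) 0 (unlift p i).

Definition Ext (R : realType) n (Z : 'M[int]_n) : Prop :=
  [/\ is_gcm Z, simply_laced Z &
      exists p : 'I_n, let Y := remove_vertex Z p in
        affine_type R Y /\
        exists d, null_root R Y d /\ pairing Z (extend p d) (simple_root p) = -1].

(* The symmetric matrix of a diagram on 0, ..., m - 1 given by a list of edges,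
   repeated according to multiplicity. *)
Definition edge_gcm (m : nat) (E : seq (nat * nat)) : 'M[int]_m :=
  \matrix_(i, j) if i == j then 2
    else - (count (fun e => (e == (i : nat, j : nat))
                         || (e == (j : nat, i : nat))) E)%:Z.

(* Untwisted affine diagrams on the vertices 0, ..., n, vertex 0 being the
   affine one; the others are labelled as in Bourbaki.  For n = 1 the cycle
   consists of the two edges (0, 1) and (1, 0). *)
Definition affA (n : nat) : 'M[int]_n.+1 :=
  edge_gcm n.+1 [seq (i, i.+1 %% n.+1)%N | i <- iota 0 n.+1].

Definition affD (n : nat) : 'M[int]_n.+1 :=
  edge_gcm n.+1
    ([:: (0, 2); (n.-2, n)]%N ++ [seq (i, i.+1) | i <- iota 1 n.-2]).

Definition affE6 : 'M[int]_7 :=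
  edge_gcm 7 [:: (0, 2); (1, 3); (3, 4); (2, 4); (4, 5); (5, 6)]%N.

Definition affE7 : 'M[int]_8 :=
  edge_gcm 8 [:: (0, 1); (1, 3); (3, 4); (2, 4); (4, 5); (5, 6); (6, 7)]%N.

Definition affE8 : 'M[int]_9 :=
  edge_gcm 9
    [:: (0, 8); (1, 3); (3, 4); (2, 4); (4, 5); (5, 6); (6, 7); (7, 8)]%N.

(* A new vertex, put first, joined by a single edge to the affine vertex. *)
Definition overext n (Y : 'M[int]_n.+1) : 'M[int]_n.+2 :=
  block_mx (2%:M : 'M_1) (- delta_mx 0 0) (- delta_mx 0 0) Y.

Definition App n := overext (affA n).
Definition Dpp n := overext (affD n).
Definition E6pp := overext affE6.
Definition E7pp := overext affE7.
Definition E8pp := overext affE8.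

(* Main.v *)
(** As the coroot of a real root is the root itself, a pi-system of type A_1^{++}
    amounts to three real roots b0, b1, b2 with (b0|b1) = -1, (b1|b2) = -2 and
    (b0|b2) = 0.  Then d = b1 + b2 is isotropic, and all its Weyl conjugates are of
    one sign, because the b1 + 2k d are real roots.  Up to the Weyl group and to a
    global sign, d is therefore positive and antidominant, which makes it the null
    root of an affine subdiagram Y; then b0 can be moved to a simple root alpha_p
    with (d|alpha_p) = -1, and finally b1 to the vertex q of Y adjacent to p, so that
    b2 = d - alpha_q.  Since an orbit contains at most one antidominant vector, d and
    then p (through 2d + alpha_p) are invariants of the orbit.  Hence the
    multiplicity is twice the number of pairs (d, p), that is of overextended
    subdiagrams Y + p of X.

    If X is hyperbolic, such a subdiagram must be the whole of X, and p is unique by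
    a study of the two branches that would end at two such vertices.  In A_n^{++}
    and D_n^{++} the pairs are found by solving the linear recurrences satisfied by
    the coordinates of d: besides the null root of A_n^{(1)} or D_n^{(1)}, only
    subdiagrams of type E_7^{++} and E_8^{++} occur.

    Lie theory enters twice.  The differences of a standard pi-system have
    coordinates of both signs, hence are not roots, by the triangular decomposition;
    and a positive imaginary root of an affine algebra is orthogonal to the simple
    roots, because the set of roots is stable under reflections. *)

Require Import Defs.
From mathcomp Require Import all_boot all_order all_algebra.
From mathcomp Require Import boolp classical_sets functions cardinality reals.
From mathcomp Require Import complex zify ring.

Set Implicit Arguments.
Unset Strict Implicit.
Unset Printing Implicit Defensive.

Import Order.TTheory GRing.Theory Num.Theory.

Local Open Scope ring_scope.

(** Conversely every pair (d, p) must yield a pi-system. The point is that [d - al q] is a real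
    root: the form is positive semidefinite on the support of [d], with kernel spanned by [d]. This
    is why connectedness of the support belongs to the notion of pair. The multiplicities are twice
    the following counts. In A_n^{++}: one pair from A_n^{(1)}; for n >= 8 two from E_7^{(1)}, since
    [p] can prolong either arm; for n >= 9 two from E_8^{(1)}, mirror images of each other. This
    gives 2, 6 and 10. In D_n^{++}: one pair from D_n^{(1)}; for n = 9 the tail of an E_8^{(1)} ends
    at the fork and leaves two choices of [p], for n >= 10 only one. This gives 2, 6 and 4. These
    enumerations rest on linear conditions alone: each row (al k|d) is at most 0, and is 0 wherever
    the coordinate of [d] is not. *)

Section Pairing.
Context {n : nat} (A : 'M[int]_n).
Implicit Types x y z : 'rV[int]_n.

Lemma pairingDl x y z : pairing A (x + y) z = pairing A x z + pairing A y z.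
Proof. by rewrite /pairing !mulmxDl mxE. Qed.

Lemma pairingDr x y z : pairing A z (x + y) = pairing A z x + pairing A z y.
Proof. by rewrite /pairing linearD mulmxDr mxE. Qed.

Lemma pairingZl c x y : pairing A (c *: x) y = c * pairing A x y.
Proof. by rewrite /pairing -!scalemxAl mxE. Qed.

Lemma pairingZr c x y : pairing A x (c *: y) = c * pairing A x y.
Proof. by rewrite /pairing linearZ /= -scalemxAr mxE. Qed.

Lemma pairingNl x y : pairing A (- x) y = - pairing A x y.
Proof. by rewrite -scaleN1r pairingZl mulN1r. Qed.

Lemma pairingNr x y : pairing A x (- y) = - pairing A x y.
Proof. by rewrite -scaleN1r pairingZr mulN1r. Qed.

Lemma pairingBl x y z : pairing A (x - y) z = pairing A x z - pairing A y z.
Proof. by rewrite pairingDl pairingNl. Qed.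

Lemma pairingBr x y z : pairing A z (x - y) = pairing A z x - pairing A z y.
Proof. by rewrite pairingDr pairingNr. Qed.

Lemma pairing_rr x i : pairing A x (simple_root i) = \sum_j x 0 j * A j i.
Proof.
by rewrite /pairing /simple_root trmx_delta -colE !mxE; apply: eq_bigr.
Qed.

Lemma pairing_rootl i y : pairing A (simple_root i) y = \sum_j A i j * y 0 j.
Proof.
rewrite /pairing /simple_root -rowE !mxE.
by apply: eq_bigr => j _; rewrite !mxE.
Qed.

Lemma pairing_roots i j : pairing A (simple_root i) (simple_root j) = A i j.
Proof.
rewrite pairing_rr (bigD1 i) //= mxE !eqxx mul1r big1 ?addr0 // => k ki.
by rewrite mxE eqxx (negPf ki) mul0r.
Qed.

Lemma pairing_suml x y :
  pairing A x y = \sum_i x 0 i * pairing A (simple_root i) y.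
Proof.
rewrite /pairing -mulmxA mxE; apply: eq_bigr => i _.
by rewrite /simple_root -mulmxA -rowE !mxE.
Qed.

Lemma simple_root_coord (i j : 'I_n) :
  (simple_root i : 'rV[int]_n) 0 j = (j == i)%:R.
Proof. by rewrite mxE eqxx. Qed.

Lemma refl_coord i x j :
  refl A i x 0 j = x 0 j - (j == i)%:R * pairing A (simple_root i) x.
Proof. by rewrite !mxE eqxx andTb mulrC. Qed.

Lemma reflD i x y : refl A i (x + y) = refl A i x + refl A i y.
Proof. by rewrite /refl pairingDr scalerDl opprD addrACA. Qed.

Lemma reflZ i c x : refl A i (c *: x) = c *: refl A i x.
Proof. by rewrite /refl pairingZr scalerBr scalerA. Qed.

Lemma weylD w x y : weyl A w (x + y) = weyl A w x + weyl A w y.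
Proof. by elim: w => //= i w ->; rewrite reflD. Qed.

Lemma weylZ w c x : weyl A w (c *: x) = c *: weyl A w x.
Proof. by elim: w => //= i w ->; rewrite reflZ. Qed.

Lemma weylN w x : weyl A w (- x) = - weyl A w x.
Proof. by rewrite -scaleN1r weylZ scaleN1r. Qed.

Lemma weylB w x y : weyl A w (x - y) = weyl A w x - weyl A w y.
Proof. by rewrite weylD weylN. Qed.

Lemma weyl_cat w1 w2 x : weyl A (w1 ++ w2) x = weyl A w1 (weyl A w2 x).
Proof. by rewrite /weyl foldr_cat. Qed.

Lemma weyl_rcons w i x : weyl A (rcons w i) x = weyl A w (refl A i x).
Proof. by rewrite -cats1 weyl_cat. Qed.

End Pairing.

Definition nneg n (x : 'rV[int]_n) : Prop := forall i, 0 <= x 0 i.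

Record sgcm n (A : 'M[int]_n) : Prop := Sgcm {
  sgcm_sym : forall i j, A i j = A j i;
  sgcm_diag : forall i, A i i = 2;
  sgcm_off : forall i j, i != j -> A i j <= 0
}.

(** * The Weyl group of a symmetric GCM *)

Section Weyl.
Context {n : nat} (A : 'M[int]_n) (gA : sgcm A).
Implicit Types x y z : 'rV[int]_n.
Notation ip := (pairing A).
Notation al := (@simple_root n).
Notation s := (refl A).
Notation W := (weyl A).

Lemma pairingC x y : ip x y = ip y x.
Proof.
rewrite /pairing -[in LHS](trmxK (x *m A *m y^T)) mxE !trmx_mul trmxK mulmxA.
congr ((_ *m _ *m _) 0 0).
by apply/matrixP => i j; rewrite mxE (sgcm_sym gA).
Qed.

Lemma pairing_root_self i : ip (al i) (al i) = 2.
Proof. by rewrite pairing_roots (sgcm_diag gA). Qed.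

Lemma pairing_coord x i : ip (al i) x = 2 * x 0 i + \sum_(j | j != i) A i j * x 0 j.
Proof. by rewrite pairing_rootl (bigD1 i) //= (sgcm_diag gA). Qed.

Lemma refl_simple_root i : s i (al i) = - al i.
Proof. by rewrite /refl pairing_root_self scaler_nat mulr2n opprD addNKr. Qed.

Lemma reflK i : involutive (s i).
Proof.
move=> x; rewrite {2}/refl reflD -scaleNr reflZ refl_simple_root /refl.
by rewrite scaleNr scalerN opprK subrK.
Qed.

Lemma pairing_refl i x y : ip (s i x) (s i y) = ip x y.
Proof.
rewrite /refl !(pairingBl, pairingBr, pairingZl, pairingZr) pairing_root_self.
rewrite (pairingC x (al i)).
ring.
Qed.

Lemma pairing_weyl w x y : ip (W w x) (W w y) = ip x y.
Proof. by elim: w => //= i w IH; rewrite pairing_refl. Qed.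

Lemma weyl_revK w x : W (rev w) (W w x) = x.
Proof.
elim: w x => //= i w IH x.
by rewrite rev_cons weyl_rcons reflK IH.
Qed.

Lemma weyl_Krev w x : W w (W (rev w) x) = x.
Proof. by rewrite -{1}(revK w) weyl_revK. Qed.

Lemma coweylE w x : coweyl A w x = W w x.
Proof.
elim: w => //= i w ->.
by rewrite /corefl /refl pairingC.
Qed.

Lemma real_root_weyl w b : real_root A b -> real_root A (W w b).
Proof.
by case=> w' [i ->]; exists (w ++ w'), i; rewrite weyl_cat.
Qed.

Lemma real_simple_root i : real_root A (al i).
Proof. by exists [::], i. Qed.

Lemma real_root_norm b : real_root A b -> ip b b = 2.
Proof. by case=> w [i ->]; rewrite pairing_weyl pairing_root_self. Qed.

Lemma real_rootN b : real_root A b -> real_root A (- b).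
Proof.
case=> w [i ->]; exists (rcons w i), i.
by rewrite weyl_rcons refl_simple_root weylN.
Qed.

Lemma is_corootP b c : is_coroot A b c <-> real_root A b /\ c = b.
Proof.
split=> [[w [i [-> ->]]]|[[w [i ->]] ->]].
  by split; [exists w, i|rewrite coweylE].
by exists w, i; rewrite coweylE.
Qed.

Lemma refl_fix i x : ip (al i) x = 0 -> s i x = x.
Proof. by rewrite /refl => ->; rewrite scale0r subr0. Qed.

Lemma weyl_fix (w : seq 'I_n) x : (forall i, i \in w -> ip (al i) x = 0) -> W w x = x.
Proof.
elim: w => //= i w IH h; rewrite IH => [|j jw]; last first.
  by apply: h; rewrite inE jw orbT.
by apply: refl_fix; apply: h; rewrite inE eqxx.
Qed.

(** * Real roots are positive or negative *)

Lemma nnegD x y : nneg x -> nneg y -> nneg (x + y).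
Proof. by move=> hx hy i; rewrite mxE addr_ge0. Qed.

Lemma nnegZ c x : 0 <= c -> nneg x -> nneg (c *: x).
Proof. by move=> hc hx i; rewrite mxE mulr_ge0. Qed.

Lemma nneg_simple_root i : nneg (al i).
Proof. by move=> j; rewrite simple_root_coord ler0n. Qed.

Section RankTwo.
Variables (i j : 'I_n).
Hypothesis ij : i != j.

Let m : int := - A i j.

Let si_comb (a b : int) : s i (a *: al i + b *: al j)
  = (m * b - a) *: al i + b *: al j.
Proof.
rewrite /refl pairingDr !pairingZr pairing_root_self pairing_roots /m.
rewrite addrAC -scalerBl; congr (_ *: _ + _); ring.
Qed.

Let sj_comb (a b : int) : s j (a *: al i + b *: al j)
  = a *: al i + (m * a - b) *: al j.
Proof.
rewrite /refl pairingDr !pairingZr pairing_root_self pairing_roots /m (sgcm_sym gA j i).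
rewrite -addrA -scalerBl; congr (_ + _ *: _); ring.
Qed.

Let letters (u : seq 'I_n) := all (fun t => (t == i) || (t == j)) u.

Let reduce (u : seq 'I_n) : letters u ->
  sorted (fun a b => a != b) u \/
  exists u', [/\ letters u', (size u').+2 = size u & forall x, W u x = W u' x].
Proof.
elim: u => [|a [|b u] IH]; [by left|by left|].
rewrite /letters /= => /andP[la lbu]; case: (IH lbu) => [su|[u' [lu' su' wu']]].
  have [<-|ab] := eqVneq a b; last by left.
  right; exists u; split=> //; first by case/andP: lbu.
  by move=> x /=; rewrite reflK.
right; exists (a :: u'); split=> /=; rewrite ?la ?su' //.
by move=> x; rewrite -wu'.
Qed.

(** The reflection applied last makes its own coefficient the larger one, and this keeps the next
    step nonnegative: a <= b implies m b - a >= b when m >= 2. The condition on [last] says that the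
    word is empty or that s_j acts first. *)
Let alt_comb (u : seq 'I_n) : 2 <= m -> letters u ->
  sorted (fun a b => a != b) u -> last j u == j ->
  exists a b : int, [/\ 0 <= a, 0 <= b,
    W u (al i) = a *: al i + b *: al j,
    (head i u == i -> b <= a) & (head i u != i -> a <= b)].
Proof.
move=> m2; elim: u => [|c u IH] /=.
  by move=> _ _ _; exists 1, 0; rewrite scale1r scale0r addr0 eqxx.
move=> /andP[lc lu] cu lst.
have su : sorted (fun a b => a != b) u by move: cu; apply: path_sorted.
have lstu : last j u == j by move: lst; case: (u).
have [a [b [a0 b0 -> hi hj]]] := IH lu su lstu.
case: (eqVneq c i) lc => [ci _|ci] /=.
  rewrite {}ci in cu lst *.
  rewrite si_comb; exists (m * b - a), b.
  have ab : a <= b.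
    apply: hj; move: ij; case: (u) cu lst => [|d u'] /=.
      by move=> _ /eqP <-; rewrite eqxx.
    by rewrite (eq_sym d) => /andP[].
  have := ler_wpM2r b0 m2; split=> //; lia.
move=> /eqP cj; rewrite {}cj in cu lst ci *.
rewrite sj_comb; exists a, (m * a - b).
have ba : b <= a.
  apply: hi; case: (u) cu lu => [|d u'] /=; first by rewrite eqxx.
  by move=> /andP[jd _] /andP[/orP[] // /eqP dj]; rewrite dj eqxx in jd.
by have := ler_wpM2r a0 m2; split=> //; lia.
Qed.


(** The product of s_i and s_j has order 2, 3 or infinity according as m = 0, m = 1 or m >= 2. In
    the infinite case an alternating word either ends in i, and cancels against s_i, or keeps al i
    nonnegative; in the finite cases long words are shortened by the relation. *)
Lemma alt_short (u : seq 'I_n) : all (fun t => (t == i) || (t == j)) u ->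
  (exists a b : int, [/\ 0 <= a, 0 <= b & W u (al i) = a *: al i + b *: al j])
  \/ exists2 u', (size u' < size u)%N & [/\
       all (fun t => (t == i) || (t == j)) u' &
       forall x, W u (s i x) = W u' x].
Proof.
rewrite -/(letters u) => lu; have [su|[u' [lu' su' wu']]] := reduce lu; last first.
  right; exists (rcons u' i); rewrite ?size_rcons -?su' ?ltnSn //; split.
    by rewrite /letters all_rcons eqxx.
  by move=> x; rewrite weyl_rcons wu'.
have [m2|m2] := lerP 2 m.
  have [lst|lst] := boolP (last j u == j).
    by have [a [b [a0 b0 e _ _]]] := alt_comb m2 lu su lst; left; exists a, b.
  case/lastP: u lu su lst => [|u c]; first by rewrite eqxx.
  rewrite /letters all_rcons last_rcons => /andP[/orP[/eqP ->|->] //] lu _ _.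
  right; exists u; rewrite ?size_rcons ?ltnSn //; split=> // x.
  by rewrite weyl_rcons reflK.
have m0 : 0 <= m by rewrite /m oppr_ge0 (sgcm_off gA).
have sja : s j (al i) = al i + m *: al j.
  by have := sj_comb 1 0; rewrite !(scale1r, scale0r, mulr1, addr0, subr0).
case/lastP: u lu su => [_ _|u c].
  by left; exists 1, 0; rewrite scale1r scale0r addr0.
rewrite /letters all_rcons => /andP[/orP[/eqP->|/eqP->] lu] su.
  right; exists u; rewrite ?size_rcons ?ltnSn //; split=> // x.
  by rewrite weyl_rcons reflK.
case/lastP: u lu su => [_ _|u c1].
  by left; exists 1, m; rewrite /= sja scale1r.
rewrite all_rcons => /andP[/orP[/eqP->|/eqP->] lu]; last first.
  by rewrite -!cats1 -catA => /cat_sorted2[_] /=; rewrite eqxx.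
move=> su.
have [m0'|m1] : m = 0 \/ m = 1 by lia.
  (* Here s_i and s_j commute, so i j i acts as j. *)
  right; exists (rcons u j); rewrite ?size_rcons ?ltnSn //; split.
    by rewrite all_rcons eqxx orbT.
  move=> x; rewrite !weyl_rcons; congr (W _ _).
  rewrite /refl !(pairingBr, pairingZr, pairing_root_self, pairing_roots).
  rewrite (sgcm_sym gA j i).
  have -> : A i j = 0 by rewrite -[A i j]opprK -/m m0' oppr0.
  rewrite !mulr0 !subr0.
  set a := ip _ _; set b := ip _ _.
  rewrite -!addrA -!opprD; congr (x - _); rewrite addrCA -scalerDl.
  suff -> : a + (a - a * 2) = 0 by rewrite scale0r addr0.
  ring.
have aij : A i j = -1 by rewrite -[A i j]opprK -/m m1.
case/lastP: u lu su => [_ _|u c2].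
  left; exists 0, 1; split=> //.
  rewrite /= sja m1.
  by have := si_comb 1 1; rewrite m1 !(scale1r, mulr1, subrr).
rewrite all_rcons => /andP[/orP[/eqP->|/eqP->] lu] su.
  by move: su; rewrite -!cats1 -!catA => /cat_sorted2[_] /=; rewrite eqxx ?andbF.
(* Braid relation: j i j i acts as i j. *)
right; exists (rcons (rcons u i) j); rewrite ?size_rcons ?ltnSn //; split.
  by rewrite !all_rcons !eqxx orbT.
move=> x; rewrite !weyl_rcons; congr (W _ _).
rewrite /refl !(pairingBr, pairingZr, pairing_root_self, pairing_roots).
rewrite (sgcm_sym gA j i) aij.
set a := ip _ _; set b := ip _ _.
apply/rowP => k; rewrite !mxE; ring.
Qed.

End RankTwo.

(* Humphreys, Reflection groups and Coxeter groups, Theorem 5.4. *)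
Lemma weyl_short w i :
  nneg (W w (al i)) \/
  exists2 w', (size w' < size w)%N & forall x, W w (s i x) = W w' x.
Proof.
have [k] := ubnP (size w); elim: k w i => // k IHk w i.
case/lastP: w => [|w1 j]; first by left; exact: nneg_simple_root.
rewrite size_rcons !ltnS => sw.
have [<-|ij] := eqVneq i j.
  by right; exists w1 => // x; rewrite weyl_rcons reflK.
(* Write [w = v u] with [u] a word in [s_i], [s_j] and [v] as short as
   possible; then [v] sends both simple roots to positive ones. *)
suff key v u : (size v <= size w1)%N -> (size v + size u <= (size w1).+1)%N ->
    all (fun t => (t == i) || (t == j)) u ->
    (forall x, W (rcons w1 j) x = W v (W u x)) ->
    nneg (W (rcons w1 j) (al i)) \/
    exists2 w', (size w' < (size w1).+1)%N &
      forall x, W (rcons w1 j) (s i x) = W w' x.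
  apply: (key w1 [:: j]) => //=; first by rewrite addn1.
    by rewrite eqxx orbT.
  by move=> x; rewrite weyl_rcons.
have [r] := ubnP (size v); elim: r v u => // r IHr v u.
rewrite ltnS => sv sv1 svu lu wE.
have sh t : (t == i) || (t == j) -> nneg (W v (al t)) \/
    nneg (W (rcons w1 j) (al i)) \/
    exists2 w', (size w' < (size w1).+1)%N &
      forall x, W (rcons w1 j) (s i x) = W w' x.
  move=> lt; have [|vt|[v' sv' vE]] := IHk v t.
  - exact: leq_ltn_trans sw.
  - by left.
  right; apply: (IHr v' (t :: u)) => //=.
  - exact: leq_trans sv' sv.
  - by apply: ltnW; apply: leq_trans sv' _.
  - by apply: leq_trans svu; rewrite addnS ltn_add2r.
  - by rewrite lt.
  - by move=> x; rewrite -vE reflK wE.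
have [//|vi|//] := sh i; first by rewrite eqxx.
have [//|vj|//] := sh j; first by rewrite eqxx orbT.
have [[a [b [a0 b0 uE]]]|[u' su' [lu' uE]]] := alt_short ij lu.
  by left; rewrite wE uE weylD !weylZ; apply: nnegD; apply: nnegZ.
right; exists (v ++ u').
  by rewrite size_cat; apply: leq_trans svu; rewrite ltn_add2l.
by move=> x; rewrite wE uE weyl_cat.
Qed.

Lemma nneg_anti x : nneg x -> nneg (- x) -> x = 0.
Proof.
move=> hx hNx; apply/rowP => i; apply/eqP; rewrite mxE eq_le hx andbT.
by have := hNx i; rewrite mxE oppr_ge0.
Qed.

(** Either w(al i) is positive, or w s_i has a shorter word w' and w'(al i) = -w(al i). In the
    latter case either w'(al i) is positive, or a second shortening expresses w itself by a shorter
    word. *)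
Lemma weyl_root_sign w i : nneg (W w (al i)) \/ nneg (- W w (al i)).
Proof.
have [k] := ubnP (size w); elim: k w => // k IHk w; rewrite ltnS => sw.
have [|[w' sw' wE]] := weyl_short w i; first by left.
have <- : W w' (al i) = - W w (al i) by rewrite -wE refl_simple_root weylN.
have [|[w'' sw'' w'E]] := weyl_short w' i; first by right.
have wE'' : W w (al i) = W w'' (al i).
  by rewrite -w'E -wE reflK.
have -> : W w' (al i) = - W w'' (al i) by rewrite -w'E refl_simple_root weylN opprK.
rewrite wE''; apply: IHk; apply: leq_trans sw; exact: ltn_trans sw''  sw'.
Qed.

Lemma real_root_sign b : real_root A b -> nneg b \/ nneg (- b).
Proof. by case=> w [i ->]; exact: weyl_root_sign. Qed.

Lemma real_root_nneg b i : real_root A b -> 0 < b 0 i -> nneg b.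
Proof.
move=> /real_root_sign[//|h] b0; have := h i.
by rewrite mxE oppr_ge0 leNgt b0.
Qed.

Definition antidom x := forall i, ip (al i) x <= 0.

(** Appending the letter i to w adds -(al i|x) w(al i) to w(x): a nonnegative multiple of a positive
    root, unless w s_i has a shorter word. *)
Lemma antidom_le w x : antidom x -> nneg (W w x - x).
Proof.
move=> ax; have [k] := ubnP (size w); elim: k w => // k IHk w.
case/lastP: w => [|w i]; first by rewrite subrr => _ i; rewrite mxE.
rewrite size_rcons !ltnS => sw.
have [wi|[w' sw' wE]] := weyl_short w i.
  have -> : W (rcons w i) x - x = (W w x - x) + (- ip (al i) x) *: W w (al i).
    by rewrite weyl_rcons /refl weylB weylZ scaleNr addrAC.
  apply: nnegD; first exact: IHk.
  by apply: nnegZ => //; rewrite oppr_ge0.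
rewrite weyl_rcons wE; apply: IHk; exact: leq_trans sw' (ltnW _).
Qed.

Lemma antidom_uniq w x y : antidom x -> antidom y -> W w x = y -> x = y.
Proof.
move=> ax ay e; have h1 := antidom_le w ax; have h2 := antidom_le (rev w) ay.
rewrite -{1}e weyl_revK in h2; rewrite e in h1.
by apply/eqP; rewrite -subr_eq0; apply/eqP/nneg_anti; rewrite ?opprB.
Qed.

Lemma pairing_nneg_antidom x y : nneg x -> antidom y -> ip x y <= 0.
Proof.
move=> hx hy; rewrite pairing_suml; apply: sumr_le0 => i _.
by rewrite mulr_ge0_le0.
Qed.

(** Only the i-th coordinate changes under s_i, so a positive coordinate elsewhere decides the sign
    of the real root. *)
Lemma nneg_refl b i j : real_root A b -> nneg b -> j != i -> b 0 j != 0 ->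
  nneg (s i b).
Proof.
move=> rb pb ji bj; apply: (@real_root_nneg _ j).
  exact: (@real_root_weyl [:: i]).
by rewrite refl_coord (negPf ji) mul0r subr0 lt_def bj pb.
Qed.


End Weyl.

(** * Reducing a triple of real roots to standard form *)

Section Triples.
Context {n : nat} (A : 'M[int]_n) (gA : sgcm A).
Implicit Types x y z b c d e : 'rV[int]_n.
Notation ip := (pairing A).
Notation al := (@simple_root n).
Notation s := (refl A).
Notation W := (weyl A).

Lemma heightB x y : height (x - y) = height x - height y.
Proof. by rewrite /height -sumrB; apply: eq_bigr => i _; rewrite !mxE. Qed.

Lemma heightZ (a : int) x : height (a *: x) = a * height x.
Proof. by rewrite /height mulr_sumr; apply: eq_bigr => i _; rewrite !mxE. Qed.

Lemma height_simple_root i : height (al i) = 1.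
Proof.
rewrite /height (bigD1 i) //= simple_root_coord eqxx big1 ?addr0 // => j ji.
by rewrite simple_root_coord (negPf ji).
Qed.

Lemma height_refl i x : height (s i x) = height x - ip (al i) x.
Proof. by rewrite heightB heightZ height_simple_root mulr1. Qed.

Lemma height_ge0 x : nneg x -> 0 <= height x.
Proof. by move=> h; apply: sumr_ge0 => i _; exact: h. Qed.

Lemma nneg_gt0 x i : nneg x -> x 0 i != 0 -> 0 < x 0 i.
Proof. by move=> h; rewrite lt_def h andbT. Qed.

Lemma pairing_pos_supp b : nneg b -> 0 < ip b b ->
  exists2 i, b 0 i != 0 & 0 < ip (al i) b.
Proof.
move=> pb; have [/existsP[i /andP[]]|/existsPn h] :=
  boolP [exists i, (b 0 i != 0) && (0 < ip (al i) b)]; first by exists i.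
rewrite pairing_suml ltNge => /negP[]; apply: sumr_le0 => i _.
have := h i; rewrite negb_and negbK -leNgt => /orP[/eqP ->|h'].
  by rewrite mul0r.
by rewrite mulr_ge0_le0.
Qed.

(* If [(b | al i) <= 0] on [J], then [(b | b) = 2] forces [(b | al q) >= 2], so
   that the [q]-th coordinate of [s q b] is negative. *)
Lemma conj_simple (J : pred 'I_n) q b : real_root A b -> nneg b ->
  b 0 q = 1 -> ~~ J q -> (forall i, i != q -> b 0 i != 0 -> J i) ->
  exists2 w, all J w & W w b = al q.
Proof.
move=> rb pb bq Jq; have [k] := ubnP (absz (height b)).
elim: k b rb pb bq => // k IHk b rb pb bq; rewrite ltnS => hk sJ.
have [/existsP[i /andP[Ji ib]]|/existsPn h] :=
  boolP [exists i, J i && (0 < ip (al i) b)].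
  have qi : q != i by apply: contraNneq Jq => ->.
  have pb' : nneg (s i b) by apply: (nneg_refl gA rb pb qi); rewrite bq.
  have := height_refl i b; have := height_ge0 pb; have := height_ge0 pb'.
  move=> h1 h2 h3.
  have [|||||w Jw wE] := IHk (s i b).
  - exact: (real_root_weyl [:: i]).
  - exact: pb'.
  - by rewrite refl_coord (negPf qi) mul0r subr0.
  - by lia.
  - move=> j jq; rewrite refl_coord; have [->//|ji] := eqVneq j i.
    by rewrite mul0r subr0; exact: sJ.
  - by exists (rcons w i); rewrite ?all_rcons ?Ji ?weyl_rcons.
exists [::] => //=; have h2 := real_root_norm gA rb.
have qb : 2 <= ip (al q) b.
  rewrite -h2 pairing_suml (bigD1 q) //= bq mul1r gerDl.
  apply: sumr_le0 => i iq; have [->|bi] := eqVneq (b 0 i) 0.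
    by rewrite mul0r.
  by have := h i; rewrite (sJ _ iq bi) -leNgt => hi; rewrite mulr_ge0_le0.
have /(real_root_sign gA)[/(_ q)|hN] : real_root A (s q b).
- exact: (real_root_weyl [:: q]).
- by rewrite refl_coord eqxx bq; lia.
apply/rowP => i; rewrite simple_root_coord; have [->//|iq] := eqVneq i q.
apply/eqP; rewrite eq_le pb andbT; have := hN i.
by rewrite mxE refl_coord (negPf iq) mul0r subr0 oppr_ge0.
Qed.

Lemma real_refl b : real_root A b ->
  exists w, forall x, W w x = x - ip b x *: b.
Proof.
case=> w [i ->]; exists (w ++ i :: rev w) => x.
rewrite weyl_cat /= /refl weylB weylZ (weyl_Krev gA).
by rewrite -[ip (al i) _](pairing_weyl gA w) (weyl_Krev gA).
Qed.

(* All the [b + 2 k (b + c)] are real roots; for [k] large they would have mixed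
   signs if [b + c] had. *)
Lemma root_pair_sum b c : real_root A b -> real_root A c -> ip b c = -2 ->
  nneg (b + c) \/ nneg (- (b + c)).
Proof.
move=> rb rc bc; have bb := real_root_norm gA rb; have cc := real_root_norm gA rc.
have rk (k : nat) : real_root A (b + (2 * k%:Z) *: (b + c)).
  elim: k => [|k IH]; first by rewrite mulr0 scale0r addr0.
  have [u uE] := real_refl rb; have [v vE] := real_refl rc.
  have := real_root_weyl u (real_root_weyl v IH); rewrite uE vE.
  rewrite !(pairingDr, pairingNr, pairingZr) (pairingC gA c b) bb cc bc.
  congr real_root; apply/rowP => i; rewrite !mxE intS; ring.
have [/existsP[i i0]|/existsPn h] := boolP [exists i, (b + c) 0 i < 0]; last first.
  by left => i; rewrite leNgt.
right => j; rewrite mxE oppr_ge0 leNgt; apply/negP => j0.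
set e := b + c in i0 j0 rk *; set k := (absz (b 0 i) + absz (b 0 j)).+1.
have k0 : 0 <= 2 * k%:Z by [].
have coord t : (b + (2 * k%:Z) *: e) 0 t = b 0 t + 2 * k%:Z * e 0 t.
  by rewrite !mxE.
have [h|h] := real_root_sign gA (rk k).
  have i1 : e 0 i <= -1 by lia.
  by have := ler_wpM2l k0 i1; have := h i; rewrite coord; set r := _ * e 0 i; lia.
have j1 : 1 <= e 0 j by rewrite -gtz0_ge1.
have := ler_wpM2l k0 j1; have := h j; rewrite mxE coord.
by set r := _ * e 0 j; lia.
Qed.

(** Connectedness of the support, encoded as an induction principle along edges. *)
Definition conn_supp x := forall P : pred 'I_n,
  (forall i j, x 0 i != 0 -> x 0 j != 0 -> A i j != 0 -> P i -> P j) ->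
  (exists2 i, x 0 i != 0 & P i) -> forall j, x 0 j != 0 -> P j.

Lemma pairing_neq0_adj x i : ip (al i) x != 0 -> exists2 j, x 0 j != 0 & A i j != 0.
Proof.
move=> h; have [/existsP[j /andP[]]|/existsPn h'] :=
  boolP [exists j, (x 0 j != 0) && (A i j != 0)]; first by exists j.
case/eqP: h; rewrite pairing_rootl big1 // => j _.
by have := h' j; rewrite negb_and !negbK => /orP[]/eqP->; rewrite ?mulr0 ?mul0r.
Qed.

(** Descent on the height by s_i with (al i|b) > 0. The supports of b and s_i b agree up to i, and
    since (al i|s_i b) is nonzero, i lies in the support of s_i b or is adjacent to it. *)
Lemma real_root_conn b : real_root A b -> nneg b -> conn_supp b.
Proof.
have [k] := ubnP (absz (height b)); elim: k b => // k IHk b; rewrite ltnS => hk rb pb.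
move=> P cP [j0 bj0 Pj0].
have [i bi ib] : exists2 i, b 0 i != 0 & 0 < ip (al i) b.
  by apply: pairing_pos_supp => //; rewrite (real_root_norm gA rb).
have [/existsP[j /andP[ji bj]]|/existsPn h] :=
    boolP [exists j, (j != i) && (b 0 j != 0)]; last first.
  have bz j : b 0 j != 0 -> j = i.
    by move=> bj; have := h j; rewrite bj andbT negbK => /eqP.
  by move=> j /bz ->; rewrite -(bz _ bj0).
have pc := nneg_refl gA rb pb ji bj; set c := s i b in pc.
have cE t : t != i -> c 0 t = b 0 t.
  by move=> ti; rewrite refl_coord (negPf ti) mul0r subr0.
have rc : real_root A c by apply: (real_root_weyl [:: i]).
have sub t : c 0 t != 0 -> b 0 t != 0.
  by have [->//|ti] := eqVneq t i; rewrite cE.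
have ci : ip (al i) c = - ip (al i) b.
  by rewrite /c /refl pairingBr pairingZr pairing_root_self //; ring.
have adj : exists2 t, c 0 t != 0 & A i t != 0.
  by apply: pairing_neq0_adj; rewrite ci oppr_eq0 gt_eqF.
have Pc t : c 0 t != 0 -> P t.
  apply: IHk => //.
  - have := height_refl i b; have := height_ge0 pb; have := height_ge0 pc.
    by rewrite -/c; lia.
  - by move=> u v /sub bu /sub bv; exact: cP.
  have [ji0|ji0] := eqVneq j0 i; last by exists j0; rewrite ?cE.
  have [u cu Au] := adj; exists u => //; apply: (cP j0) => //; first exact: sub.
  by rewrite ji0.
move=> t bt; have [ti|ti] := eqVneq t i; last by apply: Pc; rewrite cE.
have [u cu Au] := adj; apply: (cP u) => //; first exact: sub.
  by rewrite ti (sgcm_sym gA).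
exact: Pc.
Qed.

(** A simple reflection can turn a nonnegative vector into a nonpositive one only if it is a
    multiple c al i; isotropy then gives 2 c^2 = 0. *)
Lemma nneg_orbit b c w : real_root A b -> real_root A c -> ip b c = -2 ->
  nneg (b + c) -> nneg (W w (b + c)).
Proof.
move=> rb rc bc bcp; elim: w => //= i w IH.
have [//|h] : nneg (s i (W w (b + c))) \/ nneg (- s i (W w (b + c))).
  rewrite weylD reflD; apply: root_pair_sum.
  - exact: (real_root_weyl (i :: w)).
  - exact: (real_root_weyl (i :: w)).
  - by rewrite (pairing_refl gA) (pairing_weyl gA).
have e0 : ip (W w (b + c)) (W w (b + c)) = 0.
  rewrite (pairing_weyl gA) !(pairingDr, pairingDl) (pairingC gA c b) bc.
  by rewrite !(real_root_norm gA).
have eE : W w (b + c) = (W w (b + c) 0 i) *: al i.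
  apply/rowP => j; rewrite mxE simple_root_coord.
  have [->|ji] := eqVneq j i; first by rewrite mulr1.
  rewrite mulr0; apply/eqP; rewrite eq_le IH andbT; have := h j.
  by rewrite mxE refl_coord (negPf ji) mul0r subr0 oppr_ge0.
move: e0; rewrite eE pairingZl pairingZr pairing_root_self // => e0.
have -> : W w (b + c) 0 i = 0 by nia.
rewrite scale0r /refl pairing_rootl big1 ?scale0r ?subr0 => [j|j _].
  by rewrite mxE.
by rewrite mxE mulr0.
Qed.

(** Reflecting where the pairing is positive lowers the height, which cannot become negative as the
    whole orbit is nonnegative. *)
Lemma antidom_conj e : (forall w, nneg (W w e)) -> exists w, antidom A (W w e).
Proof.
have [k] := ubnP (absz (height e)); elim: k e => // k IHk e; rewrite ltnS => hk ne.
have [/existsP[i ie]|/existsPn h] := boolP [exists i, 0 < ip (al i) e]; last first.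
  by exists [::] => i /=; rewrite leNgt.
have [||w aw] := IHk (s i e); last by exists (rcons w i); rewrite weyl_rcons.
  have := height_refl i e; have := height_ge0 (ne [::]).
  by have := height_ge0 (ne [:: i]); move=> /= *; lia.
by move=> w; rewrite -weyl_rcons.
Qed.

(** * Overextended pairs *)

(* [d] is the null root of an affine subdiagram (its support), and [p] is a
   vertex turning that subdiagram into an overextended one. *)
Record ext_pair d p : Prop := ExtPair {
  ext_nneg : nneg d;
  ext_antidom : antidom A d;
  ext_supp : forall i, d 0 i != 0 -> ip (al i) d = 0;
  ext_p : ip (al p) d = -1;
  ext_conn : conn_supp d
}.

Lemma antidom_isotropic d : nneg d -> antidom A d -> ip d d = 0 ->
  forall i, d 0 i != 0 -> ip (al i) d = 0.
Proof.
move=> pd ad d0 i di.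
have h (j : 'I_n) : true -> 0 <= - (d 0 j * ip (al j) d).
  by move=> _; rewrite oppr_ge0 mulr_ge0_le0.
have /eqP : \sum_j - (d 0 j * ip (al j) d) = 0.
  by rewrite sumrN -pairing_suml d0 oppr0.
rewrite psumr_eq0 => [/allP/(_ i)|j _]; last exact: h.
rewrite mem_index_enum oppr_eq0 mulf_eq0 (negPf di) /= => /(_ isT).
by move/eqP.
Qed.

Lemma mulz_eqN1 (c a : int) : 0 <= c -> a <= 0 -> c * a = -1 -> c = 1 /\ a = -1.
Proof.
move=> c0 a0 ca; have c1 : 1 <= c by nia.
have a1 : a <= -1 by nia.
split; nia.
Qed.

(** By integrality, nonpositive terms adding up to -1 leave a single nonzero one, namely 1 times -1.
    This isolates [p] in the support of the conjugate of b0, and [q] in that of b1. *)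
Lemma sum_eqN1 (c a : 'I_n -> int) : (forall i, 0 <= c i) ->
  (forall i, a i <= 0) -> \sum_i c i * a i = -1 ->
  exists p, [/\ c p = 1, a p = -1 & forall i, i != p -> c i != 0 -> a i = 0].
Proof.
move=> c0 a0 sE.
have [/existsP[p]|/existsPn h] := boolP [exists p, c p * a p != 0]; last first.
  by move: sE; rewrite big1 // => i _; have := h i; rewrite negbK => /eqP.
have cap i : c i * a i <= 0 by rewrite mulr_ge0_le0.
move=> cp; have rest : \sum_(i | i != p) c i * a i <= 0 by apply: sumr_le0 => i _.
rewrite (bigD1 p) //= in sE.
have cp1 : c p * a p = -1.
  by have := cap p; move: cp rest sE; set u := c p * a p; set v := \sum_(_ | _) _; lia.
have /eqP r0 : \sum_(i | i != p) - (c i * a i) = 0.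
  by rewrite sumrN; move: sE; rewrite cp1; set v := \sum_(_ | _) _; lia.
have [cE aE] := mulz_eqN1 (c0 p) (a0 p) cp1; exists p; split=> //.
move: r0; rewrite psumr_eq0 => [/allP r0|i _]; last by rewrite oppr_ge0.
move=> i ip ci; have := r0 i; rewrite mem_index_enum ip /= oppr_eq0 mulf_eq0.
by rewrite (negPf ci) => /(_ isT)/eqP.
Qed.

Lemma sum_eq0 (c a : 'I_n -> int) : (forall i, 0 <= c i) ->
  (forall i, a i <= 0) -> \sum_i c i * a i = 0 ->
  forall i, c i != 0 -> a i = 0.
Proof.
move=> c0 a0 /eqP sE i ci; move: sE; rewrite -oppr_eq0 -sumrN.
rewrite psumr_eq0 => [/allP/(_ i)|j _]; last by rewrite oppr_ge0 mulr_ge0_le0.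
by rewrite mem_index_enum oppr_eq0 mulf_eq0 (negPf ci) => /(_ isT)/eqP.
Qed.

Lemma ext_pair_notin d p : ext_pair d p -> d 0 p = 0.
Proof.
by case=> _ _ h pE _; apply/eqP/negPn/negP => /h; rewrite pE.
Qed.

Lemma ext_pair_attach d p : ext_pair d p -> exists q,
  [/\ q != p, d 0 q = 1, A p q = -1 &
      forall i, i != p -> i != q -> d 0 i != 0 -> A p i = 0].
Proof.
move=> e; case: (e) => pd ad sd pE _; have dp := ext_pair_notin e.
rewrite pairing_rootl in pE.
(* [Num.min] replaces the diagonal entry at [p] by 0, so that every term is nonpositive; the sum is
   unaffected because [d] vanishes at [p]. *)
have [i||q [dq Apq hq]] := @sum_eqN1 (d 0) (fun i => Num.min (A p i) 0) pd.
- by rewrite ge_min lexx orbT.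
- rewrite -pE; apply: eq_bigr => i _; have [->|pi] := eqVneq i p.
    by rewrite dp mul0r mulr0.
  by rewrite mulrC min_l // (sgcm_off gA) // eq_sym.
have qp : q != p by apply/eqP => qp; move: dq; rewrite qp dp.
have mE i : i != p -> Num.min (A p i) 0 = A p i.
  by move=> ip; rewrite min_l // (sgcm_off gA) // eq_sym.
exists q; split=> //; first by rewrite -(mE q qp).
by move=> i ip iq di; rewrite -(mE i ip) hq.
Qed.

Theorem standard_triple b0 b1 b2 : real_root A b0 -> real_root A b1 ->
  real_root A b2 -> ip b0 b1 = -1 -> ip b1 b2 = -2 -> ip b0 b2 = 0 ->
  nneg (b1 + b2) ->
  exists w d p q, [/\ ext_pair d p, d 0 q = 1, A p q = -1 &
    [/\ W w b0 = al p, W w b1 = al q & W w b2 = d - al q]].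
Proof.
move=> r0 r1 r2 e01 e12 e02 pd.
have [w aw] := antidom_conj (fun w => nneg_orbit w r1 r2 e12 pd).
have nd := nneg_orbit w r1 r2 e12 pd.
have e11 := real_root_norm gA r1; have e22 := real_root_norm gA r2.
set d := W w (b1 + b2) in aw nd.
have dd : ip d d = 0.
  by rewrite (pairing_weyl gA) !(pairingDr, pairingDl) (pairingC gA b2 b1) e11 e22 e12.
have sd := antidom_isotropic nd aw dd.
have b0d : \sum_i W w b0 0 i * ip (al i) d = -1.
  by rewrite -pairing_suml (pairing_weyl gA) pairingDr e01 e02.
have rw0 := real_root_weyl w r0.
have nb0 : nneg (W w b0).
  case: (real_root_sign gA rw0) => // hN.
  have : ip (- W w b0) d <= 0 by apply: pairing_nneg_antidom.
  by rewrite pairingNl pairing_suml b0d.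
(* The vertices of the support of b0 other than [p] are orthogonal to [d], so the reflections that
   bring b0 to [al p] fix [d]. *)
have [p [c0p pE hp]] := sum_eqN1 nb0 aw b0d.
have [w1 Jw1 w1E] : exists2 w1, all (fun i => ip (al i) d == 0) w1 &
    W w1 (W w b0) = al p.
  apply: conj_simple => //; first by rewrite pE.
  by move=> i ip c0; rewrite hp.
have w1d : W w1 d = d.
  by apply: weyl_fix => i iw; apply/eqP; have /allP := Jw1; apply.
have dE : d = W (w1 ++ w) b1 + W (w1 ++ w) b2.
  by rewrite -weylD weyl_cat -/d w1d.
pose g1 := W (w1 ++ w) b1; pose g2 := W (w1 ++ w) b2.
have alE : al p = W (w1 ++ w) b0 by rewrite weyl_cat.
have rg1 : real_root A g1 by exact: real_root_weyl.
have rg2 : real_root A g2 by exact: real_root_weyl.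
have g1d : ip g1 d = 0 by rewrite dE pairingDr !(pairing_weyl gA) e11 e12.
have g2d : ip g2 d = 0.
  by rewrite dE pairingDr !(pairing_weyl gA) (pairingC gA b2 b1) e22 e12.
have pg1 : ip g1 (al p) = -1 by rewrite alE (pairing_weyl gA) (pairingC gA).
have pg2 : ip g2 (al p) = 0 by rewrite alE (pairing_weyl gA) (pairingC gA).
have g12 : ip g1 g2 = -2 by rewrite (pairing_weyl gA).
have sign_supp g : real_root A g -> ip g d = 0 ->
    forall i, g 0 i != 0 -> ip (al i) d = 0.
  move=> rg gd; case: (real_root_sign gA rg) => ng i gi.
    by apply: (sum_eq0 ng aw) gi; rewrite -pairing_suml.
  have s0 : \sum_j (- g) 0 j * ip (al j) d = 0.
    by rewrite -pairing_suml pairingNl gd oppr0.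
  by apply: (sum_eq0 ng aw s0); rewrite mxE oppr_eq0.
have gp g : real_root A g -> ip g d = 0 -> g 0 p = 0.
  move=> rg gd; apply/eqP/negPn/negP => /(sign_supp g rg gd).
  by rewrite pE.
have gsum g : real_root A g -> ip g d = 0 ->
    ip g (al p) = \sum_i g 0 i * Num.min (A i p) 0.
  move=> rg gd; rewrite pairing_rr; apply: eq_bigr => i _.
  have [->|ip] := eqVneq i p; first by rewrite gp // !mul0r.
  by rewrite min_l // (sgcm_off gA).
have a0 i : Num.min (A i p) 0 <= 0 by rewrite ge_min lexx orbT.
(* Reflections in [J] fix both [d] and [al p]; the vertex [p] itself is excluded because (al p|d) =
   -1. *)
pose J := [pred i | (ip (al i) d == 0) && (Num.min (A i p) 0 == 0)].
have J2 i : g2 0 i != 0 -> J i.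
  move=> gi; apply/andP; split; apply/eqP; first exact: (sign_supp g2).
  case: (real_root_sign gA rg2) => ng.
    by apply: (sum_eq0 ng a0) gi; rewrite -gsum.
  have s0 : \sum_j (- g2) 0 j * Num.min (A j p) 0 = 0.
    under eq_bigr do rewrite mxE mulNr.
    by rewrite sumrN -gsum // pg2 oppr0.
  by apply: (sum_eq0 ng a0 s0); rewrite mxE oppr_eq0.
have ng1 : nneg g1.
  case: (real_root_sign gA rg1) => // hN.
  suff : ip (- g1) (al p) <= 0 by rewrite pairingNl pg1.
  rewrite pairingNl gsum // -sumrN; apply: sumr_le0 => i _.
  by rewrite -mulNr; have := hN i; rewrite mxE => ?; rewrite mulr_ge0_le0.
have [q [g1q Aq hq]] : exists q, [/\ g1 0 q = 1, Num.min (A q p) 0 = -1 &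
    forall i, i != q -> g1 0 i != 0 -> Num.min (A i p) 0 = 0].
  by apply: sum_eqN1; rewrite // -gsum.
(* As [d] and [al p] stay fixed while b1 moves to [al q], the root b2 moves to [d - al q]. *)
have [w2 Jw2 w2E] : exists2 w2, all J w2 & W w2 g1 = al q.
  apply: conj_simple => //; first by rewrite /= Aq andbF.
  by move=> i iq gi; rewrite /= (sign_supp g1) // (hq i) ?eqxx.
have pq : q != p by apply/eqP => qp; move: g1q; rewrite qp gp.
have w2d : W w2 d = d.
  apply: weyl_fix => i iw; have /allP/(_ i iw)/andP[/eqP] := Jw2; by [].
have w2p : W w2 (al p) = al p.
  apply: weyl_fix => i iw; have /allP/(_ i iw)/andP[/eqP id /eqP] := Jw2.
  rewrite pairing_roots => Ai; have ip : i != p.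
    by apply/eqP => ip; move: id; rewrite ip pE.
  by move: Ai; rewrite min_l // (sgcm_off gA).
have g2E : W w2 g2 = d - al q.
  by rewrite -w2E -w2d -weylB dE; congr (W _ _); rewrite addrAC subrr add0r.
have rdq : real_root A (d - al q) by rewrite -g2E; exact: real_root_weyl.
have g2q : g2 0 q = 0.
  by apply/eqP/negPn/negP => /J2 /andP[_]; rewrite Aq.
have dq : d 0 q = 1 by rewrite dE mxE -/g1 -/g2 g1q g2q.
have Apq : A p q = -1 by rewrite (sgcm_sym gA) -Aq min_l // (sgcm_off gA).
have ndq : nneg (d - al q).
  move=> i; rewrite !mxE eqxx /=; have [->|iq] := eqVneq i q; first by rewrite dq.
  by rewrite subr0.
exists (w2 ++ w1 ++ w), d, p, q; split=> //; last first.
  split; rewrite weyl_cat.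
  - by rewrite -alE.
  - by [].
  by [].
(* The support of [d] consists of q and the support of the real root [d - al q], which is connected;
   q is attached to it because (al q|d - al q) = -2. *)
split=> // P cP [i di Pi].
have sub j : j != q -> d 0 j != 0 -> (d - al q) 0 j != 0.
  by move=> jq dj; rewrite !mxE eqxx (negPf jq) subr0.
have sub' j : (d - al q) 0 j != 0 -> d 0 j != 0.
  by rewrite !mxE eqxx /=; have [->|jq] := eqVneq j q; rewrite ?dq // subr0.
have [t dt At] : exists2 t, (d - al q) 0 t != 0 & A q t != 0.
  apply: pairing_neq0_adj; rewrite -g2E -w2E (pairing_weyl gA).
  by rewrite g12.
have Pt : P t.
  have [iq|iq] := eqVneq i q.
    by apply: (cP q t) => //; rewrite ?dq ?sub' // -?iq.
  apply: (real_root_conn rdq ndq) (dt) => [u v du dv Au|].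
    by apply: cP => //; apply: sub'.
  by exists i => //; apply: sub.
move=> j dj; have [jq|jq] := eqVneq j q.
  by rewrite jq; apply: (cP t) => //; rewrite ?dq ?sub' // (sgcm_sym gA).
apply: (real_root_conn rdq ndq) (sub j jq dj) => [u v du dv Au|].
  by apply: cP => //; apply: sub'.
by exists t.
Qed.

End Triples.

(** * Brackets and iterated adjoint maps *)

Section LieAlgebraTheory.
Context {K : fieldType} (L : lieAlgebra K).
Implicit Types x y z : L.
Local Notation "[< x , y >]" := (lie_br x y).

Lemma brDl x y z : [<x + y, z>] = [<x, z>] + [<y, z>].
Proof. by rewrite -[x]scale1r lie_brPl !scale1r. Qed.

Lemma brDr x y z : [<z, x + y>] = [<z, x>] + [<z, y>].
Proof. by rewrite -[x]scale1r lie_brPr !scale1r. Qed.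

Lemma br0l z : [<0, z>] = 0.
Proof. by apply: (addrI [<0, z>]); rewrite -brDl !addr0. Qed.

Lemma br0r z : [<z, 0>] = 0.
Proof. by apply: (addrI [<z, 0>]); rewrite -brDr !addr0. Qed.

Lemma brZl (a : K) x z : [<a *: x, z>] = a *: [<x, z>].
Proof. by rewrite -[a *: x]addr0 lie_brPl br0l !addr0. Qed.

Lemma brZr (a : K) x z : [<z, a *: x>] = a *: [<z, x>].
Proof. by rewrite -[a *: x]addr0 lie_brPr br0r !addr0. Qed.

Lemma brNr x z : [<z, - x>] = - [<z, x>].
Proof. by rewrite -scaleN1r brZr scaleN1r. Qed.

Lemma brNl x z : [<- x, z>] = - [<x, z>].
Proof. by rewrite -scaleN1r brZl scaleN1r. Qed.

Lemma brC x y : [<x, y>] = - [<y, x>].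
Proof.
apply/eqP; rewrite -addr_eq0; apply/eqP.
by have := lie_brxx (x + y); rewrite brDl !brDr !lie_brxx add0r addr0.
Qed.

Lemma br_der x y z : [<x, [<y, z>]>] = [<[<x, y>], z>] + [<y, [<x, z>]>].
Proof.
have := lie_jacobi x y z.
rewrite (brC z x) (brC z (lie_br x y)) brNr -addrA -opprD => /eqP.
by rewrite subr_eq0 addrC => /eqP.
Qed.

Definition ad_iter x k y : L := iter k (lie_br x) y.

Lemma ad_iter0 x k : ad_iter x k 0 = 0.
Proof. by elim: k => //= k ->; rewrite br0r. Qed.

Lemma ad_iterD x k y z : ad_iter x k (y + z) = ad_iter x k y + ad_iter x k z.
Proof. by elim: k => //= k ->; rewrite brDr. Qed.

Lemma ad_iterZ x k (a : K) z : ad_iter x k (a *: z) = a *: ad_iter x k z.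
Proof. by elim: k => //= k ->; rewrite brZr. Qed.

Lemma ad_iterSr x k y : ad_iter x k.+1 y = ad_iter x k [<x, y>].
Proof. by rewrite /ad_iter iterSr. Qed.

Lemma ad_iter_nil x k l y : ad_iter x k y = 0 -> (k <= l)%N -> ad_iter x l y = 0.
Proof.
move=> h /subnK <-; rewrite /ad_iter iterD -/(ad_iter x k y) h.
exact: ad_iter0.
Qed.

(** By the Leibniz rule, one application of ad x to [y, z] gives two brackets, in each of which k or
    l has dropped by one. *)
Lemma ad_iter_br x k l y z : ad_iter x k y = 0 -> ad_iter x l z = 0 ->
  ad_iter x (k + l) [<y, z>] = 0.
Proof.
have [m] := ubnP (k + l)%N; elim: m k l y z => // m IHm [|k] [|l] y z.
- by move=> _ /= -> _; rewrite br0l.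
- by move=> _ y0 _; rewrite [y]y0 br0l ad_iter0.
- by move=> _ _ z0; rewrite [z]z0 br0r ad_iter0.
rewrite ltnS => hm hy hz; rewrite addSn ad_iterSr br_der ad_iterD.
rewrite IHm //; last by rewrite -ad_iterSr.
by rewrite add0r addnS -addSn IHm // -?ad_iterSr // -addnS.
Qed.

End LieAlgebraTheory.

(** * Weights in a Kac-Moody algebra *)

Section KacMoody.
Context {K : numFieldType} {n : nat} {A : 'M[int]_n}.
Implicit Types a b : 'rV[int]_n.
Local Notation "[< x , y >]" := (lie_br x y).
Notation al := (@simple_root n).

Definition wt (g : kacMoody K A) a (h : 'rV[K]_(cartan_dim K A)) : K :=
  \sum_j (a 0 j)%:~R * (h *m rroot (km_real g)) 0 j.

Section Model.
Variable g : kacMoody K A.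
Implicit Types x y : g.
Notation e := (km_e g).
Notation f := (km_f g).
Notation H := (km_h g).
Notation rs := (@root_space K n A g).
Notation wt := (wt g).

Lemma rsE a x : rs a x <-> forall h, [<H h, x>] = wt a h *: x.
Proof. by []. Qed.

Lemma wtD a b h : wt (a + b) h = wt a h + wt b h.
Proof.
rewrite /wt -big_split /=; apply: eq_bigr => j _.
by rewrite mxE intrD mulrDl.
Qed.

Lemma wtN a h : wt (- a) h = - wt a h.
Proof.
rewrite /wt -sumrN; apply: eq_bigr => j _.
by rewrite mxE intrN mulNr.
Qed.

Lemma wt_simple_root i h : wt (al i) h = (h *m rroot (km_real g)) 0 i.
Proof.
rewrite /wt (bigD1 i) //= mxE !eqxx mul1r big1 ?addr0 // => j ji.
by rewrite mxE (negPf ji) andbF mul0r.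
Qed.

Lemma wt_coroot a i :
  wt a (row i (rcoroot (km_real g))) = (pairing A (al i) a)%:~R.
Proof.
rewrite pairing_rootl /wt -row_mul realizationE raddf_sum /=.
by apply: eq_bigr => j _; rewrite !mxE intrM mulrC.
Qed.

(** Rests on the independence of the simple roots as linear forms ([rroot_free]) and on
    characteristic 0. *)
Lemma wt_sep a b : a != b -> exists h, wt a h != wt b h.
Proof.
move=> ab; pose c : 'rV[K]_n := \row_j ((a - b) 0 j)%:~R.
have c0 : c != 0.
  apply: contraNneq ab => c0; rewrite -subr_eq0; apply/eqP/rowP => j.
  by have /eqP := congr1 (fun u : 'rV_n => u 0 j) c0; rewrite !mxE intr_eq0 => /eqP.
have /existsP[k hk] : [exists k, (c *m (rroot (km_real g))^T) 0 k != 0].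
  apply: contraNT c0; rewrite negb_exists => /forallP h.
  rewrite -(mulmx_free_eq0 _ (rroot_free (km_real g))).
  by apply/eqP/rowP => k; rewrite [RHS]mxE; apply/eqP; have := h k; rewrite negbK.
exists (delta_mx 0 k); rewrite -subr_eq0 -wtN -wtD.
apply: contraNneq hk => <-; rewrite !mxE; apply/eqP; apply: eq_bigr => j _.
by rewrite -rowE !mxE.
Qed.

Lemma rsZ a (c : K) x : rs a x -> rs a (c *: x).
Proof. by move=> hx h; rewrite brZr hx !scalerA mulrC. Qed.

Lemma rs_br a b x y : rs a x -> rs b y -> rs (a + b) [<x, y>].
Proof.
move=> /rsE hx /rsE hy; apply/rsE => h.
by rewrite br_der hx hy wtD brZl brZr scalerDl.
Qed.

Lemma rs_e i : rs (al i) (e i).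
Proof. by apply/rsE => h; rewrite km_he wt_simple_root. Qed.

Lemma rs_h h : rs 0 (H h).
Proof.
apply/rsE => h'; rewrite km_hh; symmetry.
by rewrite [X in X *: _]big1 ?scale0r // => j _; rewrite mxE mul0r.
Qed.

(** * Triangular decomposition *)

(** [C] constrains the vector together with its weight, because at weight [al i] one has to remember
    that the vector is a multiple of [e i]. *)
Definition weight_sum (C : 'rV[int]_n -> g -> Prop) x : Prop :=
  exists2 l : seq ('rV[int]_n * g),
    (forall z, z \in l -> C z.1 z.2 /\ rs z.1 z.2) & x = \sum_(z <- l) z.2.

Lemma weight_sum0 C : weight_sum C 0.
Proof. by exists [::] => //; rewrite big_nil. Qed.

Lemma weight_sum1 (C : 'rV[int]_n -> g -> Prop) a x :
  C a x -> rs a x -> weight_sum C x.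
Proof.
by exists [:: (a, x)]; rewrite ?big_seq1 // => z; rewrite inE => /eqP ->.
Qed.

Lemma weight_sumD C x y : weight_sum C x -> weight_sum C y -> weight_sum C (x + y).
Proof.
move=> [l hl ->] [l' hl' ->]; exists (l ++ l'); last by rewrite big_cat.
by move=> z; rewrite mem_cat => /orP[/hl|/hl'].
Qed.

Lemma weight_sum_map (C C' : 'rV[int]_n -> g -> Prop) (t : g -> g) :
  (forall x y, t (x + y) = t x + t y) -> t 0 = 0 ->
  (forall b y, C b y -> rs b y -> weight_sum C' (t y)) ->
  forall x, weight_sum C x -> weight_sum C' (t x).
Proof.
move=> tD t0 ht x [l hl ->]; elim: l hl => [|z l IH] hl.
  by rewrite big_nil t0; exact: weight_sum0.
rewrite big_cons tD; apply: weight_sumD.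
  by have [] := hl z (mem_head _ _); exact: ht.
by apply: IH => z' z'l; apply: hl; rewrite inE z'l orbT.
Qed.

Lemma weight_sum_sub (C C' : 'rV[int]_n -> g -> Prop) x :
  (forall b y, C b y -> C' b y) -> weight_sum C x -> weight_sum C' x.
Proof. by move=> h [l hl ->]; exists l => // z /hl[? ?]; split=> //; exact: h. Qed.

(** Independence of weight spaces: if h separates a from b, then ad h - wt b h kills the summand of
    weight b and multiplies x by a nonzero scalar. *)
Lemma weight_sum_eq0 (C : 'rV[int]_n -> g -> Prop) a x :
  rs a x -> (forall b y, C b y -> b != a) -> weight_sum C x -> x = 0.
Proof.
move=> ax hC [l hl xE].
have {hC}hl z : z \in l -> z.1 != a /\ rs z.1 z.2.
  by move=> /hl[/hC].
pose ws (c : 'rV[int]_n -> K) (l : seq ('rV[int]_n * g)) :=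
  \sum_(z <- l) c z.1 *: z.2.
(* The coefficients depend on the weight only: applying the operator changes [c] and leaves the list
   of vectors alone. *)
suff key c : x = ws c l -> x = 0.
  by apply: (key (fun=> 1)); rewrite xE; apply: eq_bigr => z _; rewrite scale1r.
clear xE; elim: l hl c x ax => [|[b y] l IH] hl c x ax; first by rewrite /ws big_nil.
rewrite /ws big_cons /= => xE.
have [/= ba /rsE by_] := hl _ (mem_head _ _).
have hl' z : z \in l -> z.1 != a /\ rs z.1 z.2.
  by move=> zl; apply: hl; rewrite inE zl orbT.
have [h hab] := wt_sep ba; move/rsE: (ax) => hx.
suff /eqP : (wt a h - wt b h) *: x = 0.
  by rewrite scaler_eq0 subr_eq0 eq_sym (negPf hab) => /eqP.
apply: (IH hl' (fun w => (wt w h - wt b h) * c w)); first exact: rsZ.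
rewrite scalerBl -hx {}xE brDr brZr by_ scalerDr !scalerA (mulrC (wt b h)).
rewrite opprD addrACA subrr add0r.
elim: l hl' {IH hl} => [|z l IH] hl'.
  by rewrite /ws !big_nil br0r scaler0 subr0.
rewrite /ws !big_cons brDr scalerDr opprD addrACA IH; last first.
  by move=> z' z'l; apply: hl'; rewrite inE z'l orbT.
have [_ /rsE hz] := hl' _ (mem_head _ _).
by rewrite brZr hz !scalerA -scalerBl mulrBl (mulrC (c _)).
Qed.

(** The elements whose bracket preserves [V] form a subalgebra, by the Jacobi identity, and it
    contains the generators. *)
Lemma ad_stable (V : set g) : subspace V ->
  (forall h y, V y -> V [<H h, y>]) -> (forall i y, V y -> V [<e i, y>]) ->
  (forall i y, V y -> V [<f i, y>]) -> forall x y, V y -> V [<x, y>].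
Proof.
move=> [V0 VD] hV eV fV.
pose N : set g := fun x => forall y, V y -> V [<x, y>].
suff NT : N = setT.
  move=> x; have Nx : N x by rewrite NT.
  exact: Nx.
apply: km_gen => //; split; first split.
- by move=> y _; rewrite br0l.
- by move=> c x x' hx hx' y Vy; rewrite lie_brPl; apply: VD; [exact: hx|exact: hx'].
move=> x x' hx hx' y Vy.
have -> : [<[<x, x'>], y>] = (-1) *: [<x', [<x, y>]>] + [<x, [<x', y>]>].
  by rewrite (br_der x) scaleN1r addrC addrK.
by apply: VD; [apply: hx'; exact: hx|apply: hx; exact: hx'].
Qed.

(** n_+ as the span of the brackets [e_i, [e_j, ...]], so that its properties follow by induction on
    the bracketing. *)
Inductive npos : g -> Prop :=
| npos0 : npos 0
| nposD x y of npos x & npos y : npos (x + y)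
| nposZ c x of npos x : npos (c *: x)
| npos_e i : npos (e i)
| npos_br i x of npos x : npos [<e i, x>].

(* The last clause keeps track of the fact that [c *: al i] is not a weight for
   [c > 1]. *)
Definition pos_vector a x := [/\ nneg a, a != 0 &
  (exists i c, a = al i /\ x = c *: e i) \/ forall i c, a <> c *: al i].

Lemma pos_vectorZ a x (c : K) : pos_vector a x -> pos_vector a (c *: x).
Proof.
case=> na a0 h; split=> //; case: h => [[i [d [-> ->]]]|]; last by right.
by left; exists i, (c * d); rewrite scalerA.
Qed.

(** A multiple of a simple root can arise only if a is already a multiple of al i; then x is a
    multiple of [e i] and the bracket vanishes. *)
Lemma pos_vector_br a x i : pos_vector a x -> rs a x ->
  weight_sum pos_vector [<e i, x>].
Proof.
move=> [na a0 h] ax; have [[j [c [aE xE]]]|am] := h.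
  have [ij|ij] := eqVneq i j.
    rewrite xE -ij brZr lie_brxx scaler0; exact: weight_sum0.
  apply: (weight_sum1 (a := al i + a)); last exact: rs_br (rs_e i) ax.
  have ai : (al i + a) 0 i = 1 by rewrite aE !mxE !eqxx (negPf ij) addr0.
  split.
  - by apply: nnegD => //; exact: nneg_simple_root.
  - by apply/eqP => ia; move: ai; rewrite ia mxE.
  - right=> k d /rowP kE; have [jk|jk] := eqVneq j k.
      have := kE i; rewrite ai mxE simple_root_coord -jk (negPf ij) mulr0.
      exact/eqP.
    have := kE j; rewrite aE !mxE !eqxx eq_sym (negPf ij) (negPf jk) mulr0.
    exact/eqP.
apply: (weight_sum1 (a := al i + a)); last exact: rs_br (rs_e i) ax.
have ai : 0 < (al i + a) 0 i by rewrite !mxE !eqxx ltr_wpDr.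
split.
- by apply: nnegD => //; exact: nneg_simple_root.
- by apply/eqP => ia; move: ai; rewrite ia mxE.
right=> k d kE; move: (ai); rewrite kE !mxE eqxx /=.
have [ik|] := eqVneq i k; last by rewrite mulr0.
by move=> _; case: (am i (d - 1)); rewrite scalerBl scale1r ik -kE -ik addrC addKr.
Qed.

Lemma npos_weight_sum x : npos x -> weight_sum pos_vector x.
Proof.
elim=> {x} [|x y _ hx _ hy|c x _ hx|i|i x _ hx].
- exact: weight_sum0.
- exact: weight_sumD.
- apply: (weight_sum_map (t := *:%R c)) hx => [y z||b y hb yb].
  + by rewrite scalerDr.
  + by rewrite scaler0.
  + by apply: weight_sum1; [exact: pos_vectorZ hb|exact: rsZ].
- apply: (weight_sum1 _ (rs_e i)); split; first exact: nneg_simple_root.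
    by apply/eqP => /rowP/(_ i); rewrite !mxE !eqxx.
  by left; exists i, 1; rewrite scale1r.
apply: (weight_sum_map (t := lie_br (e i))) hx => [y z||b y hb yb].
- by rewrite brDr.
- by rewrite br0r.
- exact: pos_vector_br hb yb.
Qed.

Lemma npos_h h x : npos x -> npos [<H h, x>].
Proof.
elim=> {x} [|x y _ hx _ hy|c x _ hx|i|i x xp hx].
- by rewrite br0r; exact: npos0.
- by rewrite brDr; exact: nposD.
- by rewrite brZr; exact: nposZ.
- by rewrite km_he; apply: nposZ; exact: npos_e.
rewrite br_der km_he brZl.
by apply: nposD; [apply: nposZ; exact: npos_br|exact: npos_br].
Qed.

Lemma npos_f i x : npos x -> exists h, exists2 y, npos y & [<f i, x>] = H h + y.
Proof.
have fe j : exists h, [<f i, e j>] = H h.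
  rewrite brC km_ef; case: eqP => _; last by exists 0; rewrite linear0 oppr0.
  by eexists (- _); rewrite linearN.
elim=> {x} [|x y _ [hx [x' px xE]] _ [hy [y' py yE]]|c x _ [hx [x' px xE]]|j
  |j x xp [hx [x' px xE]]].
- by exists 0, 0; [exact: npos0|rewrite br0r linear0 addr0].
- exists (hx + hy), (x' + y'); first exact: nposD.
  by rewrite brDr xE yE linearD addrACA.
- exists (c *: hx), (c *: x'); first exact: nposZ.
  by rewrite brZr xE linearZ scalerDr.
- by have [h hE] := fe j; exists h, 0; [exact: npos0|rewrite addr0].
have [h hE] := fe j.
exists 0, ([<H h, x>] + ([<e j, H hx>] + [<e j, x'>])); last first.
  by rewrite br_der hE xE brDr linear0 add0r.
apply: nposD; first exact: npos_h.
apply: nposD; last exact: npos_br.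
by rewrite brC km_he -scaleNr; apply: nposZ; exact: npos_e.
Qed.

End Model.

#[local] Obligation Tactic := idtac.

(* The same algebra with [e] and [f] exchanged, by which statements about
   positive root vectors transfer to negative ones. *)
Program Definition km_opp (g : kacMoody K A) : kacMoody K A :=
  @KacMoody K n A (km_real g) (km_lie g) (\- (km_h g)) (km_f g) (km_e g)
    _ _ _ _ _ _ _.
Next Obligation. by move=> g x y /oppr_inj /km_h_inj. Qed.
Next Obligation. by move=> g h h' /=; rewrite brNl brNr km_hh !oppr0. Qed.
Next Obligation.
move=> g i j /=; rewrite brC km_ef eq_sym.
by case: eqP => [->|] //; rewrite oppr0.
Qed.
Next Obligation. by move=> g h i /=; rewrite brNl km_hf scaleNr opprK. Qed.
Next Obligation. by move=> g h i /=; rewrite brNl km_he scaleNr. Qed.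
Next Obligation.
move=> g V sV hV fV eV; apply: km_gen => // h.
by rewrite -[h]opprK linearN; exact: hV.
Qed.
Next Obligation.
move=> g V iV hV; apply: km_no_ideal => // h Vh.
by apply/oppr_inj; rewrite oppr0; apply: hV => /=; rewrite linearN opprK.
Qed.

End KacMoody.

Section KacMoodyRoots.
Context {K : numFieldType} {n : nat} {A : 'M[int]_n} (gA : is_gcm A).
Implicit Types a b : 'rV[int]_n.
Local Notation "[< x , y >]" := (lie_br x y).
Notation al := (@simple_root n).

Definition pos_weight a := [/\ nneg a, a != 0 & forall i c, a = c *: al i -> c = 1].

Lemma pos_vector_weight {g : kacMoody K A} a (x : g) : pos_vector a x -> pos_weight a.
Proof.
case=> na a0 h; split=> // i c ac; case: h => [[j [d [aE _]]]|am]; last first.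
  by case: (am i c).
have /rowP/(_ j) := ac; rewrite aE !mxE !eqxx /=.
by case: (j == i); rewrite ?mulr0 ?mulr1 // => /eqP.
Qed.

Section Model.
Variable g : kacMoody K A.
Implicit Types x y : g.
Notation e := (km_e g).
Notation f := (km_f g).
Notation H := (km_h g).
Notation rs := (@root_space K n A g).
Notation pos := (@npos K n A g).
Notation neg := (@npos K n A (km_opp g)).

Lemma rs_opp a (x : g) : @root_space K n A (km_opp g) a x <-> rs (- a) x.
Proof.
split=> h h'; have := h h'.
  by rewrite [lie_br _ _]brNl => /eqP; rewrite eqr_oppLR => /eqP ->;
    rewrite -scaleNr -wtN.
by rewrite [lie_br (km_h (km_opp g) _) _]brNl => ->; rewrite -scaleNr -wtN opprK.
Qed.

Definition triangular x := exists y h z,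
  [/\ neg y, pos z & x = y + H h + z].

(** The sum of the three parts is stable under the bracket with each generator, hence with every
    element; it is therefore a subalgebra containing the generators. *)
Lemma triangular_all x : triangular x.
Proof.
pose V : set g := triangular.
have V0 : V 0.
  by exists 0, 0, 0; split; [exact: npos0|exact: npos0|rewrite linear0 !addr0].
have VD : forall x y, V x -> V y -> V (x + y).
  move=> _ _ [y [h [z [py pz ->]]]] [y' [h' [z' [py' pz' ->]]]].
  exists (y + y'), (h + h'), (z + z'); split; [exact: nposD|exact: nposD|].
  by rewrite linearD addrACA; congr (_ + _); rewrite addrACA.
have VZ : forall c x, V x -> V (c *: x).
  move=> c _ [y [h [z [py pz ->]]]].
  exists (c *: y), (c *: h), (c *: z); split; [exact: nposZ|exact: nposZ|].
  by rewrite linearZ !scalerDr.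
have Vn (y : g) : neg y -> V y.
  move=> py; exists y, 0, 0; split=> //; first exact: npos0.
  by rewrite linear0 !addr0.
have Vp y : pos y -> V y.
  move=> py; exists 0, 0, y; split=> //; first exact: npos0.
  by rewrite linear0 !add0r.
have Vh h : V (H h).
  by exists 0, h, 0; split; [exact: npos0|exact: npos0|rewrite addr0 add0r].
have sV : subspace V by split=> // c x' y hx hy; apply: (VD) => //; exact: VZ.
have aV : forall x y, V y -> V [<x, y>].
  apply: ad_stable => //.
  - move=> h _ [y [h' [z [py pz ->]]]]; rewrite !brDr km_hh addr0.
    apply: (VD); last by apply: (Vp); exact: npos_h.
    apply: (Vn); have := npos_h (- h) py.
    by rewrite [lie_br _ _]brNl linearN brNl opprK.
  - move=> i _ [y [h' [z [py pz ->]]]]; rewrite !brDr.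
    apply: (VD); last by apply: (Vp); exact: npos_br.
    apply: (VD); last first.
      by rewrite brC km_he -scaleNr; apply: (VZ); apply: (Vp); exact: npos_e.
    have [h [y' py' ->]] := npos_f (g := km_opp g) i py.
    apply: (VD); last exact: Vn.
    by have := Vh (- h); rewrite linearN.
  move=> i _ [y [h' [z [py pz ->]]]]; rewrite !brDr.
  apply: (VD); last first.
    have [h [y' py' ->]] := npos_f i pz.
    by apply: (VD); [exact: Vh|exact: Vp].
  apply: (VD); last first.
    rewrite brC km_hf scaleNr opprK; apply: (VZ); apply: (Vn).
    exact: (@npos_e K n A (km_opp g)).
  by apply: (Vn); exact: (@npos_br K n A (km_opp g)).
have VT : V = setT.
  apply: km_gen => //; first by split=> // x' y _; exact: aV.
  - by move=> i; apply: (Vp); exact: npos_e.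
  - by move=> i; apply: (Vn); exact: (@npos_e K n A (km_opp g)).
have : V x by rewrite VT.
by [].
Qed.

Lemma root_space_weight a x : rs a x -> x != 0 ->
  [\/ a = 0, pos_weight a | pos_weight (- a)].
Proof.
move=> ax x0; have [y [h [z [ny pz xE]]]] := triangular_all x.
pose C b (_ : g) := [\/ b = 0, pos_weight b | pos_weight (- b)].
apply: contrapT => aC; case/eqP: x0.
apply: (weight_sum_eq0 ax (C := C)) => [b u hb|].
  by apply/eqP => ba; apply: aC; rewrite -ba.
rewrite xE; apply: weight_sumD; first apply: weight_sumD.
- have [l hl ->] := npos_weight_sum ny.
  exists [seq (- u.1, u.2) | u <- l]; last by rewrite big_map.
  move=> _ /mapP[u ul ->] /=; have [/pos_vector_weight hu /rs_opp ru] := hl u ul.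
  by split=> //; apply: Or33; rewrite opprK.
- by apply: (weight_sum1 (a := 0)); [exact: Or31|exact: rs_h].
apply: weight_sum_sub (npos_weight_sum pz) => b u /pos_vector_weight.
exact: Or32.
Qed.

(** * Integrability *)

Inductive generated (x0 : g) : g -> Prop :=
| gen_zero : generated x0 0
| gen_base : generated x0 x0
| genD x y of generated x0 x & generated x0 y : generated x0 (x + y)
| genZ c x of generated x0 x : generated x0 (c *: x)
| gen_br i x of generated x0 x : generated x0 [<e i, x>].

(* Such an [x] generates an ideal which meets the Cartan subalgebra trivially. *)
Lemma lowest_vector_eq0 a x : rs a x -> nneg a -> a != 0 ->
  (forall k, [<f k, x>] = 0) -> x = 0.
Proof.
move=> ax na a0 fx; pose V : set g := generated x.
have hV h y : V y -> V [<H h, y>].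
  elim=> {y} [||y z _ hy _ hz|c y _ hy|i y vy hy].
  - by rewrite br0r; exact: gen_zero.
  - by move/rsE: ax => ->; apply: genZ; exact: gen_base.
  - by rewrite brDr; exact: genD.
  - by rewrite brZr; exact: genZ.
  rewrite br_der km_he brZl.
  by apply: genD; [apply: genZ; exact: gen_br|exact: gen_br].
have fV i y : V y -> V [<f i, y>].
  elim=> {y} [||y z _ hy _ hz|c y _ hy|j y vy hy].
  - by rewrite br0r; exact: gen_zero.
  - by rewrite fx; exact: gen_zero.
  - by rewrite brDr; exact: genD.
  - by rewrite brZr; exact: genZ.
  rewrite br_der (brC (f i)) km_ef brNl; apply: genD; last exact: gen_br.
  case: eqP => _; last by rewrite br0l oppr0; exact: gen_zero.
  by rewrite -scaleN1r; apply: genZ; exact: hV.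
have V0 : V = [set 0]%classic.
  apply: km_no_ideal => [|h Vh].
    have sV : subspace V.
      by split=> [|c y z vy vz]; [exact: gen_zero|apply: genD => //; exact: genZ].
    by split=> //; apply: ad_stable => // i y; exact: gen_br.
  apply: (@km_h_inj _ _ _ g); rewrite linear0.
  pose C (b : 'rV[int]_n) (_ : g) := nneg b /\ b != 0.
  (* Elements of [V] are sums of vectors of nonzero nonnegative weight, whereas [H h] has weight
     0. *)
  apply: (weight_sum_eq0 (C := C) (rs_h g h)) => [b u []//|].
  elim: Vh => [||y z _ hy _ hz|c y _ hy|j y vy hy].
  - exact: weight_sum0.
  - exact: weight_sum1 ax.
  - exact: weight_sumD.
  - apply: (weight_sum_map (t := *:%R c)) hy => [u v||b u hb ub].
    + by rewrite scalerDr.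
    + by rewrite scaler0.
    + by apply: weight_sum1; [exact: hb|exact: rsZ].
  apply: (weight_sum_map (t := lie_br (e j))) hy => [u v||b u [nb b0] ub].
  - by rewrite brDr.
  - by rewrite br0r.
  apply: (weight_sum1 _ (rs_br (rs_e g j) ub)).
  have p : nneg (al j + b) by apply: nnegD => //; exact: nneg_simple_root.
  split=> //; apply: contraNneq b0 => jb; apply/eqP/nneg_anti => //.
  by rewrite -[- b]addr0 -jb addrC addrK; exact: nneg_simple_root.
have : V x by exact: gen_base.
by rewrite V0.
Qed.

Definition hco i := row i (rcoroot (km_real g)).

Lemma hco_e i j : [<H (hco i), e j>] = (A i j)%:~R *: e j.
Proof. by rewrite km_he -row_mul realizationE !mxE. Qed.

Lemma rs_hco a x i : rs a x -> [<H (hco i), x>] = (pairing A (al i) a)%:~R *: x.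
Proof. by move=> /rsE ->; rewrite wt_coroot. Qed.

Lemma rs_ad_iter a x i k : rs a x -> rs (a + al i *+ k) (ad_iter (e i) k x).
Proof.
move=> ax; elim: k => [|k IH]; first by rewrite addr0.
by rewrite mulrS addrCA; exact: rs_br (rs_e g i) IH.
Qed.

(** The sl_2 computation on a lowest weight vector: moving f across each e subtracts the weight m +
    2 l of e^l x, and these weights add up to (k + 1)(m + k) for l = 0, ..., k. *)
Lemma sl2_lower i (m : int) x k : [<f i, x>] = 0 ->
  [<H (hco i), x>] = m%:~R *: x -> A i i = 2 ->
  [<f i, ad_iter (e i) k.+1 x>] =
    - ((k.+1%:Z * (m + k%:Z))%:~R *: ad_iter (e i) k x).
Proof.
move=> fx hx Aii.
have fe y : [<f i, [<e i, y>]>] = [<e i, [<f i, y>]>] - [<H (hco i), y>].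
  by rewrite br_der (brC (f i) (e i)) km_ef eqxx brNl addrC.
have hk l : [<H (hco i), ad_iter (e i) l x>] =
    (m + 2 * l%:Z)%:~R *: ad_iter (e i) l x.
  elim: l => [|l IH]; first by rewrite mulr0 addr0.
  rewrite br_der hco_e Aii IH brZl brZr -scalerDl -intrD; congr (_%:~R *: _).
  by rewrite intS; ring.
elim: k => [|k IH]; first by rewrite fe fx br0r add0r hx addr0 mul1r.
have -> : ad_iter (e i) k.+2 x = [<e i, ad_iter (e i) k.+1 x>] by [].
rewrite fe IH hk brNr brZr -/(ad_iter (e i) k.+1 x).
rewrite -opprD -scalerDl -intrD; congr (- (_%:~R *: _)).
by rewrite !intS; ring.
Qed.

(** Every f_k kills this vector, which is then zero by [lowest_vector_eq0]: f_i since the factor m +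
    k of the sl_2 formula vanishes at m = -N, k = N; f_j since it leaves a multiple of A j i (ad
    e_i)^N e_i; the others commute with e_i and e_j. *)
Lemma serre i j : i != j -> ad_iter (e i) (absz (A i j)).+1 (e j) = 0.
Proof.
have [Ad Ao Az] := gA; move=> ij; set N := absz (A i j).
have AN : A i j = - N%:Z by have := Ao i j ij; lia.
have fe k l : k != l -> [<f k, e l>] = 0.
  by move=> kl; rewrite brC km_ef eq_sym (negPf kl) oppr0.
have rx := rs_ad_iter i N.+1 (rs_e g j).
apply: (lowest_vector_eq0 rx).
- by move=> t; rewrite mxE mulmxnE !simple_root_coord addr_ge0 // mulrn_wge0.
- apply/eqP => /rowP/(_ j); rewrite mxE mulmxnE !simple_root_coord eqxx eq_sym.
  by rewrite (negPf ij) mul0rn addr0 mxE.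
move=> k; have [->|ki] := eqVneq k i.
  rewrite (sl2_lower (m := A i j)) ?fe ?hco_e ?Ad // AN addrC subrr mulr0.
  by rewrite scale0r oppr0.
have comm l y : [<f k, ad_iter (e i) l y>] = ad_iter (e i) l [<f k, y>].
  elim: l => //= l IH; rewrite br_der fe // br0l add0r.
  by rewrite IH.
rewrite comm; have [->|kj] := eqVneq k j; last by rewrite fe // ad_iter0.
rewrite brC km_ef eqxx -scaleN1r ad_iterZ ad_iterSr brC hco_e -scaleNr ad_iterZ.
suff -> : (- (A j i)%:~R : K) *: ad_iter (e i) N (e i) = 0 by rewrite scaler0.
(* If N = 0 then A j i = 0 as well; otherwise [e_i, e_i] = 0 occurs. *)
have [Aij|] := eqVneq N 0%N.
  have Aij0 : A i j = 0 by rewrite AN Aij.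
  by rewrite (Az j i Aij0) oppr0 scale0r.
by case: (N) => // N' _; rewrite ad_iterSr lie_brxx ad_iter0 scaler0.
Qed.

(** By [ad_iter_br] the vectors killed by some power of ad e_i form a subalgebra, and it contains
    the generators. *)
Lemma ad_e_nilpotent i x : exists N, ad_iter (e i) N x = 0.
Proof.
have [Ad Ao Az] := gA.
pose V : set g := fun x => exists N, ad_iter (e i) N x = 0.
suff VT : V = setT.
  have Vx : V x by rewrite VT.
  exact: Vx.
apply: km_gen.
- split; first split.
  + by exists 0%N.
  + move=> c y z [N hN] [M hM]; exists (N + M)%N.
    rewrite ad_iterD ad_iterZ (ad_iter_nil hN) ?leq_addr // scaler0 add0r.
    by rewrite (ad_iter_nil hM) // leq_addl.
  by move=> y z [N hN] [M hM]; exists (N + M)%N; exact: ad_iter_br.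
- move=> h; exists 2%N; rewrite /ad_iter /= (brC _ (H h)) km_he -scaleNr brZr.
  by rewrite lie_brxx scaler0.
- move=> j; have [ <-|ij] := eqVneq i j; first by exists 1%N; exact: lie_brxx.
  by exists (absz (A i j)).+1; exact: serre.
move=> j; exists 3%N; rewrite /ad_iter /= km_ef.
case: eqP => _; last by rewrite !br0r.
by rewrite (brC _ (H _)) km_he -scaleNr brZr lie_brxx scaler0.
Qed.

End Model.

(** Climb to the last nonzero y = (ad e_i)^k x, of sl_2-weight m + 2 k, then come down by (ad
    f_i)^(k + m). The result is nonzero because k + m <= m + 2 k, and its weight is a - m al i. *)
Lemma root_space_refl_pos (g : kacMoody K A) a (x : g) i :
  root_space g a x -> x != 0 -> 0 <= pairing A (al i) a ->
  exists2 y : g, root_space g (refl A i a) y & y != 0.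
Proof.
move=> ax x0 m0; set m := absz (pairing A (al i) a).
have mE : pairing A (al i) a = m%:Z by rewrite /m; lia.
have Aii : A i i = 2 by case: gA.
have ex : exists N, ad_iter (km_e g i) N x == 0.
  by have [N hN] := ad_e_nilpotent i x; exists N; apply/eqP.
case: (ex_minnP ex) => -[|k] /eqP hk kmin; first by rewrite [x]hk eqxx in x0.
set y := ad_iter (km_e g i) k x.
have y0 : y != 0 by apply/negP => /kmin; rewrite ltnn.
have ay : root_space g (a + al i *+ k) y by exact: rs_ad_iter.
have ay' : @root_space K n A (km_opp g) (- (a + al i *+ k)) y.
  by apply/rs_opp; rewrite opprK.
(* In [km_opp g] the highest vector [y] becomes a lowest one, of weight -(m + 2 k). *)
have low := @sl2_lower (km_opp g) i (- (m%:Z + 2 * k%:Z)) y _ hk _ Aii.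
have hy : lie_br (km_h (km_opp g) (hco (km_opp g) i)) y =
    (- (m%:Z + 2 * k%:Z))%:~R *: y.
  rewrite (rs_hco i ay') pairingNr pairingDr mE; congr ((- (_ + _))%:~R *: _).
  rewrite -scaler_nat pairingZr pairing_roots Aii mulrC.
  by congr (_ * _); exact: natz.
have fn j : (j <= m + 2 * k)%N -> ad_iter (km_f g i) j y != 0.
  elim: j => // j IH jm; apply/eqP => fj0.
  have := low j hy; rewrite [ad_iter _ j.+1 _]fj0 br0r.
  move/esym/eqP; rewrite oppr_eq0 scaler_eq0 intr_eq0 (negPf (IH (ltnW jm))) orbF.
  by move/eqP; nia.
exists (ad_iter (km_f g i) (k + m) y); last by apply: fn; lia.
have /rs_opp := rs_ad_iter i (k + m) ay'.
rewrite opprD opprK /refl mE -[m%:Z]natz scaler_nat mulrnDr opprD addrA addrK.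
by [].
Qed.

Lemma root_space_refl (g : kacMoody K A) a (x : g) i :
  root_space g a x -> x != 0 ->
  exists2 y : g, root_space g (refl A i a) y & y != 0.
Proof.
move=> ax x0; have [m0|m0] := lerP 0 (pairing A (al i) a).
  exact: root_space_refl_pos ax x0 m0.
have ax' : @root_space K n A (km_opp g) (- a) x by apply/rs_opp; rewrite opprK.
have [|y /rs_opp ry y0] := root_space_refl_pos ax' x0 (i := i).
  by rewrite pairingNr oppr_ge0 ltW.
exists y => //; move: ry; rewrite -[- a]scaleN1r reflZ scaleN1r opprK.
by [].
Qed.

End KacMoodyRoots.

Lemma intr_sum (R : pzRingType) (I : finType) (F : I -> int) :
  (\sum_i F i)%:~R = \sum_i (F i)%:~R :> R.
Proof. exact: (raddf_sum (intmul (1 : R))). Qed.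

(** * Roots in the simply-laced case *)

Section Roots.
Context {R : realType} {n : nat} {A : 'M[int]_n} (gA : sgcm A).
Implicit Types a b d x y : 'rV[int]_n.
Notation ip := (pairing A).
Notation al := (@simple_root n).

Lemma sgcm_gcm : is_gcm A.
Proof.
split=> [i|i j|i j ji]; first exact: sgcm_diag; first exact: sgcm_off.
by rewrite (sgcm_sym gA).
Qed.

Lemma is_root_sign a : is_root R A a -> nneg a \/ nneg (- a).
Proof.
case=> a0 [g [x [ax x0]]]; have := root_space_weight ax x0.
by case=> [aE|[na _ _]|[na _ _]]; [rewrite aE eqxx in a0|left|right].
Qed.

Lemma affine_antidom a : affine_type R A -> antidom A a ->
  forall i, ip (al i) a = 0.
Proof.
case=> _ _ _ _ h aa i; pose v : 'cV[R]_n := map_mx intr (- a)^T.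
have vE j : (map_mx intr A *m v) j 0 = (- ip (al j) a)%:~R.
  rewrite -pairingNr pairing_rootl mxE intr_sum; apply: eq_bigr => k _.
  by rewrite !mxE intrM.
have /h/matrixP/(_ i 0) : forall j, 0 <= (map_mx intr A *m v) j 0.
  by move=> j; rewrite vE ler0z oppr_ge0.
by rewrite vE mxE => /eqP; rewrite intr_eq0 oppr_eq0 => /eqP.
Qed.

(** Descent on the height. If (al i|b) > 0, then s_i b is again a root. If it is positive, it is
    lower and not orthogonal to al i, so it is real by induction; if negative, b is a multiple of al
    i, hence equal to it. If no pairing is positive, affine type gives orthogonality. *)
Lemma affine_imaginary a : affine_type R A -> positive_imaginary_root R A a ->
  forall i, ip (al i) a = 0.
Proof.
move=> affA [[a0 [g [x [ax x0]]]] nra pa].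
suff key k b (y : g) : (absz (height b) < k)%N -> nneg b -> b != 0 ->
    root_space g b y -> y != 0 -> real_root A b \/ forall i, ip (al i) b = 0.
  by have [] := key _ _ _ (leqnn _) pa a0 ax x0.
elim: k b y => // k IHk b y; rewrite ltnS => hk nb b0 rby y0.
have [/existsP[i ib]|/existsPn h] := boolP [exists i, 0 < ip (al i) b]; last first.
  by right; apply: affine_antidom => // i; rewrite leNgt.
have [z rbz z0] := root_space_refl sgcm_gcm i rby y0.
have bb : b = refl A i (refl A i b) by rewrite reflK.
case: (root_space_weight rbz z0) => [sb0|[nsb sb0 _]|[nsb _ _]].
- by case/eqP: b0; rewrite bb sb0 /refl pairing_rootl big1 ?scale0r ?subr0 // => j _;
    rewrite mxE mulr0.
- have [|rs|h] := IHk (refl A i b) z _ nsb sb0 rbz z0.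
  + have := height_refl A i b; have := height_ge0 nb; have := height_ge0 nsb.
    by lia.
  + by left; rewrite bb; exact: (real_root_weyl [:: i]).
  have := h i; rewrite {1}/refl pairingBr pairingZr pairing_root_self // => hi.
  by move: ib; lia.
have bE : b = b 0 i *: al i.
  apply/rowP => j; rewrite mxE simple_root_coord.
  have [->|ji] := eqVneq j i; first by rewrite mulr1.
  rewrite mulr0; apply/eqP; rewrite eq_le nb andbT; have := nsb j.
  by rewrite mxE refl_coord (negPf ji) mul0r subr0 oppr_ge0.
case: (root_space_weight rby y0) => [/eqP|[_ _ /(_ _ _ bE) b1]|[nNb _ _]].
- by rewrite (negPf b0).
- by left; rewrite bE b1 scale1r; exact: real_simple_root.
by case/eqP: b0; exact: nneg_anti.
Qed.

(** * Affine diagrams *)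

Section NullVector.
Variable d : 'rV[int]_n.
Hypotheses (nd : nneg d) (sd : forall i, d 0 i != 0 -> ip (al i) d = 0).

(* [0] outside the support of [d], by the convention on division by [0]. *)
Let t x i : rat := (x 0 i)%:~R / (d 0 i)%:~R.

Let supp x := forall i, x 0 i != 0 -> d 0 i != 0.

Let tK x i : supp x -> (x 0 i)%:~R = (d 0 i)%:~R * t x i.
Proof.
move=> sx; rewrite /t; have [d0|d0] := eqVneq (d 0 i) 0.
  have -> : x 0 i = 0 by apply/eqP/negPn/negP => /sx; rewrite d0 eqxx.
  by rewrite mul0r mulr0.
by rewrite mulrCA mulfV ?mulr1 // intr_eq0.
Qed.

Let term x i j : rat :=
  (A i j)%:~R * (d 0 i)%:~R * (d 0 j)%:~R * (t x i - t x j) ^+ 2.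

Let term_le0 x i j : term x i j <= 0.
Proof.
rewrite /term; have [->|ij] := eqVneq i j; first by rewrite subrr expr0n mulr0.
rewrite mulr_le0_ge0 ?sqr_ge0 // !mulr_le0_ge0 ?ler0z // ?lerz0 ?(sgcm_off gA) //.
Qed.

(** Sum-of-squares identity for a symmetric matrix with null vector [d]. When the squares are
    expanded, the terms in t_i^2 add up to multiples of d_i (al i|d) = 0, and the cross terms give
    -2 (x|x). *)
Let jacobi x : supp x -> - 2%:R * (ip x x)%:~R = \sum_i \sum_j term x i j.
Proof.
move=> sx.
have row i : \sum_j (A i j)%:~R * (d 0 i)%:~R * (d 0 j)%:~R * (t x i) ^+ 2 = 0 :> rat.
  have [d0|d0] := eqVneq (d 0 i) 0.
    by rewrite big1 // => j _; rewrite d0 mulr0 !mul0r.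
  transitivity ((ip (al i) d)%:~R * (d 0 i)%:~R * (t x i) ^+ 2).
    rewrite pairing_rootl intr_sum !mulr_suml; apply: eq_bigr => j _.
    rewrite intrM; ring.
  by rewrite sd // !mul0r.
have -> : \sum_i \sum_j term x i j =
  \sum_i \sum_j (A i j)%:~R * (d 0 i)%:~R * (d 0 j)%:~R * (t x i) ^+ 2 +
  \sum_j \sum_i (A j i)%:~R * (d 0 j)%:~R * (d 0 i)%:~R * (t x j) ^+ 2 +
  \sum_i \sum_j (- 2%:R) * ((A i j)%:~R * (x 0 i)%:~R * (x 0 j)%:~R).
  rewrite [X in _ + X + _]exchange_big -!big_split /=; apply: eq_bigr => i _.
  rewrite -!big_split /=; apply: eq_bigr => j _.
  rewrite /term (sgcm_sym gA j i) (tK i sx) (tK j sx); ring.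
rewrite [X in X + _ + _]big1 => [|i _]; last exact: row.
rewrite [X in _ + X + _]big1 => [|i _]; last exact: row.
rewrite !add0r pairing_suml intr_sum mulr_sumr; apply: eq_bigr => i _.
rewrite pairing_rootl mulr_sumr intr_sum mulr_sumr; apply: eq_bigr => j _.
rewrite !intrM; ring.
Qed.

Lemma psd_supp x : (forall i, x 0 i != 0 -> d 0 i != 0) -> 0 <= ip x x.
Proof.
move=> sx; have := jacobi sx => h.
have : \sum_i \sum_j term x i j <= 0.
  by apply: sumr_le0 => i _; apply: sumr_le0 => j _; exact: term_le0.
by rewrite -h mulNr oppr_le0 pmulr_rge0 // ler0z.
Qed.

(** All squares in the identity vanish, so x_i / d_i is constant along edges of the connected
    support. *)
Lemma null_supp x : conn_supp A d -> (forall i, x 0 i != 0 -> d 0 i != 0) ->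
  ip x x = 0 -> forall i j, d 0 i != 0 -> d 0 j != 0 ->
  x 0 i * d 0 j = x 0 j * d 0 i.
Proof.
move=> cd sx x0 i j di dj.
have term0 k l : term x k l = 0.
  have h : \sum_i \sum_j - term x i j = 0.
    under eq_bigr do rewrite sumrN.
    by rewrite sumrN -jacobi // x0 mulr0 oppr0.
  have pos k' l' : 0 <= - term x k' l' by rewrite oppr_ge0 term_le0.
  move/eqP: h; rewrite psumr_eq0 => [/allP/(_ k)|k' _]; last exact: sumr_ge0.
  rewrite mem_index_enum => /(_ isT)/=; rewrite psumr_eq0 //.
  by move=> /allP/(_ l); rewrite mem_index_enum => /(_ isT)/=; rewrite oppr_eq0 => /eqP.
have : t x j == t x i.
  apply: (cd (fun k => t x k == t x i)) => // [k l dk dl Akl /eqP <-|]; last first.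
    by exists i => //=.
  have /eqP := term0 l k; rewrite /term !mulf_eq0 !intr_eq0 (negPf dk) (negPf dl).
  by rewrite (sgcm_sym gA) (negPf Akl) /= orbb subr_eq0.
move=> /eqP tE; apply/eqP; rewrite -(eqr_int rat) !intrM (tK i sx) (tK j sx) tE.
by apply/eqP; ring.
Qed.

(** Descent over all nonnegative b of norm 2 on the support of [d] with b_q = 0; the last condition
    rules out nonzero multiples of [d], which span the kernel of the form there. *)
Lemma null_root_sub_real q : conn_supp A d -> d 0 q = 1 ->
  real_root A (d - al q).
Proof.
move=> cd dq.
have dd x : supp x -> ip d x = 0.
  move=> sx; rewrite pairingC // pairing_suml big1 // => i _.
  have [->|xi] := eqVneq (x 0 i) 0; first by rewrite mul0r.
  by rewrite sd ?mulr0 //; exact: sx.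
suff key k b : (absz (height b) < k)%N -> nneg b -> ip b b = 2 -> supp b ->
    b 0 q = 0 -> real_root A b.
  apply: (key _ _ (leqnn _)).
  - move=> i; rewrite !mxE eqxx /=; have [->|_] := eqVneq i q; first by rewrite dq.
    by rewrite subr0.
  - have sal : supp (al q).
      move=> i; rewrite simple_root_coord; have [->|_] := eqVneq i q; first by rewrite dq.
      by rewrite eqxx.
    by rewrite pairingBr !pairingBl (pairingC gA (al q) d) !dd // pairing_root_self.
  - move=> i; rewrite !mxE eqxx /=; have [->|_] := eqVneq i q; first by rewrite dq.
    by rewrite subr0.
  by rewrite !mxE !eqxx dq.
elim: k b => // k IHk b; rewrite ltnS => hk nb b2 sb bq.
have [i bi ib] : exists2 i, b 0 i != 0 & 0 < ip (al i) b.
  by apply: pairing_pos_supp; rewrite // b2.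
have iq : i != q by apply: contraNneq bi => ->; rewrite bq.
have [le_mb|lt_bm] := lerP (ip (al i) b) (b 0 i).
  have nsb : nneg (refl A i b).
    move=> j; rewrite refl_coord; have [->|_] := eqVneq j i.
      by rewrite mul1r subr_ge0.
    by rewrite mul0r subr0.
  rewrite -(reflK gA i b); apply: (real_root_weyl [:: i]); apply: IHk => //.
  - have := height_refl A i b; have := height_ge0 nb; have := height_ge0 nsb.
    by lia.
  - by rewrite pairing_refl.
  - move=> j; rewrite refl_coord; have [->|_] := eqVneq j i; first by move=> _; exact: sb.
    by rewrite mul0r subr0; exact: sb.
  by rewrite refl_coord eq_sym (negPf iq) mul0r subr0.
(* Now (al i|b) > b_i >= 1, so the norm 4 - 2 (al i|b) of [b - al i] is at most 0. Hence [b - al i]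
   is a multiple of [d] vanishing at q, that is 0. *)
have b1 : 1 <= b 0 i by rewrite -gtz0_ge1; exact: nneg_gt0.
have nc : nneg (b - al i).
  move=> j; rewrite !mxE eqxx /=; have [->|_] := eqVneq j i; first by rewrite subr_ge0.
  by rewrite subr0.
have sc : supp (b - al i).
  move=> j; rewrite !mxE eqxx /=; have [->|_] := eqVneq j i; first by move=> _; exact: sb.
  by rewrite subr0; exact: sb.
have c2 : ip (b - al i) (b - al i) = 4 - 2 * ip (al i) b.
  rewrite pairingBr !pairingBl (pairingC gA b) b2 pairing_root_self //; ring.
have := psd_supp sc; rewrite c2 => c2_ge0.
have c0 : ip (b - al i) (b - al i) = 0 by rewrite c2; lia.
have bE : b = al i.
  apply/eqP; rewrite -subr_eq0; apply/eqP/rowP => j; rewrite [RHS]mxE.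
  have [cj|cj] := eqVneq ((b - al i) 0 j) 0; first by [].
  have := null_supp cd sc c0 (sc j cj) (i := j) (j := q).
  rewrite dq => /(_ isT); rewrite mulr1 => ->.
  by rewrite !mxE eqxx eq_sym (negPf iq) bq subr0 mul0r.
by rewrite bE; exact: real_simple_root.
Qed.

End NullVector.

End Roots.

(** * Diagrams given by lists of edges *)

Lemma edge_gcm_sgcm m E : sgcm (edge_gcm m E).
Proof.
split=> [i j|i|i j ij]; rewrite !mxE ?eqxx //; last first.
  by rewrite (negPf ij) oppr_le0.
rewrite eq_sym; case: eqP => // _; congr (- (_%:Z)).
by apply: eq_count => e; rewrite orbC.
Qed.

Definition simple_edges m (E : seq (nat * nat)) :=
  all (fun e => [&& e.1 != e.2, e.1 < m & e.2 < m]%N) E.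

Lemma edge_term m (X : nat -> int) (j : 'I_m) a b :
  a != b -> (a < m)%N -> (b < m)%N ->
  \sum_(i < m | i != j)
    ((((a, b) == (j : nat, i : nat)) || ((a, b) == (i : nat, j : nat)) : nat)%:Z
     * X i) = (a == j)%:R * X b + (b == j)%:R * X a.
Proof.
move=> ab am bm.
have pick k (km : (k < m)%N) : (k == j :> nat) = false ->
    \sum_(i < m | i != j) (k == i :> nat)%:R * X i = X k.
  move=> kj; rewrite (bigD1 (Ordinal km)) /=; last by rewrite -val_eqE /= kj.
  rewrite eqxx mul1r big1 ?addr0 // => i /andP[_].
  by rewrite -val_eqE /= eq_sym => /negPf ->; rewrite mul0r.
have [aj|/negPf aj] := boolP (a == j :> nat).
  have /negPf bj : b != j by rewrite -(eqP aj) eq_sym.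
  rewrite bj mul0r addr0 mul1r -[RHS](pick _ bm bj); apply: eq_bigr => i _.
  by rewrite !xpair_eqE aj bj andbF orbF natz.
rewrite mul0r add0r; have [bj|/negPf bj] := boolP (b == j :> nat).
  rewrite mul1r -[RHS](pick _ am aj); apply: eq_bigr => i _.
  by rewrite !xpair_eqE aj bj andbT natz.
by rewrite mul0r big1 // => i _; rewrite !xpair_eqE aj bj andbF mul0r.
Qed.

Lemma edge_gcm_pairing m E (X : nat -> int) (j : 'I_m) : simple_edges m E ->
  pairing (edge_gcm m E) (simple_root j) (\row_i X i) =
  2 * X j - \sum_(e <- E) ((e.1 == j)%:R * X e.2 + (e.2 == j)%:R * X e.1).
Proof.
move=> sE; rewrite pairing_rootl (bigD1 j) //= !mxE eqxx; congr (_ + _).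
rewrite (eq_bigr (fun i : 'I_m => - ((count (fun e => (e == (j : nat, i : nat))
    || (e == (i : nat, j : nat))) E)%:Z * X i))) => [|i ij]; last first.
  by rewrite !mxE eq_sym (negPf ij) mulNr.
rewrite sumrN; congr (- _).
elim: E sE => [|[a b] E IH] /=.
  by rewrite big_nil big1 // => i _; rewrite mul0r.
case/andP=> /and3P[/= ab am bm] sE; rewrite big_cons -IH //=.
under eq_bigr do rewrite PoszD mulrDl.
rewrite big_split /=; congr (_ + _).
exact: edge_term.
Qed.

Lemma overext_edge m E :
  overext (edge_gcm m.+1 E) = edge_gcm m.+2
    ((0, 1)%N :: [seq (e.1.+1, e.2.+1) | e <- E]).
Proof.
apply/matrixP => i j; rewrite [RHS]mxE -val_eqE /= count_map !mxE.
case: splitP => [i' ->|i' ->]; rewrite !mxE; case: splitP => [j' ->|j' ->];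
  rewrite !mxE ?ord1 //.
- rewrite (eq_count (a2 := pred0)) ?count_pred0 => [|[a b]]; last first.
    by rewrite /= ?xpair_eqE ?andbF.
  rewrite addn0 !xpair_eqE /= -val_eqE /= ?andbT ?andbF ?orbF.
  by rewrite add1n eqSS natz eq_sym.
- rewrite (eq_count (a2 := pred0)) ?count_pred0 => [|[a b]]; last first.
    by rewrite /= ?xpair_eqE ?andbF.
  rewrite addn0 !xpair_eqE /= -val_eqE /= ?andbT ?andbF.
  by rewrite add1n eqSS natz eq_sym.
Qed.

Definition App_edges n :=
  (0, 1)%N :: [seq (i.+1, (i.+1 %% n.+1).+1) | i <- iota 0 n.+1].

Lemma App_edgeE n : App n = edge_gcm n.+2 (App_edges n).
Proof. by rewrite /App /affA overext_edge -map_comp. Qed.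

(** * Counting orbits by overextended pairs *)

Lemma App1E (i j : 'I_3) : App 1 i j =
  nth 0 (nth [::] [:: [:: 2; -1; 0]; [:: -1; 2; -2]; [:: 0; -2; 2]] i) j.
Proof.
by rewrite App_edgeE mxE; case: i => [[|[|[|i]]] hi] //; case: j => [[|[|[|j]]] hj].
Qed.

(** A_1^{++} has no nontrivial diagram automorphism, so a Weyl element that carries one standard
    system to another respects the order of the triples. *)
Lemma App1_rigid (i j k : 'I_3) : App 1 i j = -1 -> App 1 j k = -2 ->
  App 1 i k = 0 -> [/\ i = inord 0, j = inord 1 & k = inord 2].
Proof.
rewrite !App1E; case: i => [[|[|[|i]]] hi] //; case: j => [[|[|[|j]]] hj] //;
  case: k => [[|[|[|k]]] hk] // _ _ _.
by split; apply: val_inj; rewrite /= inordK.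
Qed.

Section Count.
Context {R : realType} {n : nat} {A : 'M[int]_n} (gA : sgcm A).
Implicit Types b d x y : 'rV[int]_n.
Implicit Types p q : 'I_n.
Notation ip := (pairing A).
Notation al := (@simple_root n).
Notation W := (weyl A).

Definition attach d p : 'I_n :=
  odflt p [pick q | [&& q != p, d 0 q == 1 & A p q == -1]].

Lemma attachP d p : ext_pair A d p ->
  [/\ attach d p != p, d 0 (attach d p) = 1 & A p (attach d p) = -1].
Proof.
move=> /(ext_pair_attach gA)[q [qp dq Apq _]]; rewrite /attach.
case: pickP => [r /and3P[rp /eqP dr /eqP Apr]//|/(_ q)].
by rewrite qp dq Apq eqxx.
Qed.

Lemma attach_uniq d p q : ext_pair A d p -> d 0 q = 1 -> A p q = -1 ->
  attach d p = q.
Proof.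
move=> e dq Apq; have [rp dr Apr] := attachP e.
have [t [tp dt Apt h]] := ext_pair_attach gA e.
have qp : q != p by apply/eqP => qp; move: Apq; rewrite qp sgcm_diag.
have eqt r : r != p -> d 0 r = 1 -> A p r = -1 -> r = t.
  move=> rp' dr' Apr'; apply/eqP/negPn/negP => rt.
  by move: Apr'; rewrite (h r) // dr'.
by rewrite (eqt q) // (eqt (attach d p)).
Qed.

(* The boolean is a global sign; the order is that of the rows of [App 1]. *)
Definition std_triple (u : bool * ('rV[int]_n * 'I_n)) (i : 'I_3) : 'rV[int]_n :=
  (-1) ^+ u.1 *:
  nth 0 [:: al u.2.2; al (attach u.2.1 u.2.2);
            u.2.1 - al (attach u.2.1 u.2.2)] i.

Definition std_system u : set 'rV[int]_n := range (std_triple u).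

Lemma sign_scale (s : bool) x : (-1) ^+ s *: x = if s then - x else x.
Proof. by case: s; rewrite ?scaleN1r ?scale1r. Qed.

Lemma std_triple_gram s d p : ext_pair A d p ->
  forall i j, ip (std_triple (s, (d, p)) i) (std_triple (s, (d, p)) j) =
              App 1 i j.
Proof.
move=> e; have [qp dq Apq] := attachP e; set q := attach d p in qp dq Apq.
have [nd ad sd pE _] := e.
have dd : ip d d = 0.
  rewrite pairing_suml big1 // => i _; have [->|/sd ->] := eqVneq (d 0 i) 0.
    by rewrite mul0r.
  by rewrite mulr0.
have dqE : ip (al q) d = 0 by apply: sd; rewrite dq.
have ndal i : ip d (al i) = ip (al i) d by rewrite pairingC.
move=> i j; rewrite /std_triple pairingZl pairingZr mulrA -expr2 sqrr_sign mul1r.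
rewrite App1E -/q; case: i => [[|[|[|i]]] hi] //; case: j => [[|[|[|j]]] hj] //=;
  rewrite ?(pairingBl, pairingBr) ?ndal ?pairing_roots ?dd ?dqE ?pE
    ?(sgcm_sym gA q p) ?(sgcm_diag gA) ?Apq //.
Qed.

Lemma std_triple_real s d p i : ext_pair A d p ->
  real_root A (std_triple (s, (d, p)) i).
Proof.
move=> e; have [qp dq Apq] := attachP e.
rewrite /std_triple sign_scale.
have h : real_root A (nth 0 [:: al p; al (attach d p); d - al (attach d p)] i).
  case: i => [[|[|[|i]]] hi] //=; try exact: real_simple_root.
  by case: e => nd ad sd pE cd; exact: null_root_sub_real.
by case: s => //; exact: real_rootN.
Qed.

Lemma not_root_mixed x i j : 0 < x 0 i -> x 0 j < 0 -> ~ is_root R A x.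
Proof.
move=> xi xj /is_root_sign[/(_ j)|/(_ i)]; first by rewrite leNgt xj.
by rewrite mxE oppr_ge0 leNgt xi.
Qed.

Lemma std_triple_diff s d p i j : ext_pair A d p -> i != j ->
  ~ is_root R A (std_triple (s, (d, p)) i - std_triple (s, (d, p)) j).
Proof.
move=> e; have [qp dq Apq] := attachP e; rewrite /std_triple -scalerBr /=.
set q := attach d p in qp dq Apq *; set B := nth _ _ => ij.
have rb : real_root A (d - al q).
  by case: e => nd ad sd pE cd; exact: null_root_sub_real.
have dp := ext_pair_notin e; have [nd _ _ _ _] := e.
have cE k : k != q -> (d - al q) 0 k = d 0 k.
  by move=> kq; rewrite !mxE eqxx (negPf kq) subr0.
have cq : (d - al q) 0 q = 0 by rewrite !mxE !eqxx dq.
(* [d - al q] is a real root, hence nonzero; this yields a vertex of the support of [d] other than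
   q, at which the third root of the triple is positive. *)
have [t tq td] : exists2 t, t != q & 0 < d 0 t.
  have [||t] := @pairing_pos_supp _ A (d - al q).
  - move=> k; have [->|kq] := eqVneq k q; first by rewrite cq.
    by rewrite cE.
  - by rewrite (real_root_norm gA rb).
  have [->|tq ct _] := eqVneq t q; first by rewrite cq.
  by exists t => //; apply: nneg_gt0 => //; rewrite -cE.
have tp : t != p by apply/eqP => tp; move: td; rewrite tp dp.
have pq : (p == q) = false by rewrite eq_sym (negPf qp).
have subE (u v : 'rV[int]_n) k : (u - v) 0 k = u 0 k - v 0 k by rewrite !mxE.
have mixed (k l : 'I_3) : (k < l)%N ->
    exists i j, 0 < (B k - B l) 0 i /\ (B k - B l) 0 j < 0.
  rewrite /B; case: k => [[|[|[|k]]] hk] //; case: l => [[|[|[|l]]] hl] //= _.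
  - by exists p, q; rewrite !mxE !eqxx /= (negPf qp) pq.
  - exists p, t; rewrite !(subE (al p)) !cE // ?pq //.
    by rewrite !simple_root_coord eqxx (negPf tp) dp subr0 sub0r oppr_lt0.
  exists q, t; rewrite !(subE (al q)) cq cE //.
  by rewrite !simple_root_coord eqxx (negPf tq) subr0 sub0r oppr_lt0.
have [v [v' [h h']]] : exists i' j', 0 < (B i - B j) 0 i' /\ (B i - B j) 0 j' < 0.
  have [ij'|ji|ij'] := ltngtP i j; first exact: mixed.
    have [v [v' [h h']]] := mixed _ _ ji; exists v', v.
    by rewrite -opprB mxE oppr_gt0 h' mxE oppr_lt0 h.
  by case/eqP: ij; apply: val_inj.
rewrite sign_scale; case: (s).
  by apply: (@not_root_mixed _ v' v); rewrite mxE ?oppr_gt0 ?oppr_lt0.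
exact: not_root_mixed h h'.
Qed.

Lemma std_triple_inj s d p : ext_pair A d p -> injective (std_triple (s, (d, p))).
Proof.
move=> e i j ij; apply/eqP/negPn/negP => nij.
have G := std_triple_gram s e.
have := G i j; rewrite -ij G !App1E.
by move: nij; case: i {ij} => [[|[|[|i]]] hi] //; case: j => [[|[|[|j]]] hj].
Qed.

Lemma std_system_pi s d p : ext_pair A d p ->
  pi_system R A (std_system (s, (d, p))) /\
  has_type A (std_system (s, (d, p))) (App 1).
Proof.
move=> e; split.
  split.
  - by apply: finite_image; exact: finite_finset.
  - by move=> _ [i _ <-]; exact: std_triple_real.
  move=> _ _ [i _ <-] [j _ <-] ij; apply: std_triple_diff => //.
  by apply/eqP => eij; apply: ij; rewrite eij.
exists (std_triple (s, (d, p))), (std_triple (s, (d, p))).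
split=> //; first exact: std_triple_inj.
- by move=> i; apply/is_corootP => //; split=> //; exact: std_triple_real.
exact: std_triple_gram.
Qed.

Lemma pi_system_std S : pi_system R A S -> has_type A S (App 1) ->
  exists w s d p, ext_pair A d p /\ S = [set W w x | x in std_system (s, (d, p))]%classic.
Proof.
move=> [_ rS _] [b [c [_ SE bc G]]].
have rb i : real_root A (b i) by apply: rS; rewrite SE; exists i.
have {}G i j : ip (b i) (b j) = App 1 i j.
  by rewrite -G; have /is_corootP[|_ ->] := bc i.
have fin (s : bool) w d p q : ext_pair A d p -> d 0 q = 1 -> A p q = -1 ->
    W w ((-1) ^+ s *: b (inord 0)) = al p -> W w ((-1) ^+ s *: b (inord 1)) = al q ->
    W w ((-1) ^+ s *: b (inord 2)) = d - al q ->
    exists w s d p, ext_pair A d p /\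
      S = [set W w x | x in std_system (s, (d, p))]%classic.
  move=> e dq Apq h0 h1 h2; exists (rev w), s, d, p; split=> //.
  have bE i : b i = W (rev w) (std_triple (s, (d, p)) i).
    rewrite /std_triple /= (attach_uniq e dq Apq).
    have <- : W w ((-1) ^+ s *: b i) = nth 0 [:: al p; al q; d - al q] i.
      have -> : i = inord i by apply: val_inj; rewrite /= inordK.
      by case: i => [[|[|[|i]]] hi]; rewrite //= inordK.
    by rewrite !weylZ scalerA -expr2 sqrr_sign scale1r (weyl_revK gA).
  rewrite SE; apply/seteqP; split=> [_ [i _ <-]|_ [_ [i _ <-] <-]].
    by exists (std_triple (s, (d, p)) i); [exists i|rewrite -bE].
  by exists i; rewrite // bE.
have e01 : ip (b (inord 0)) (b (inord 1)) = -1 by rewrite G App1E !inordK.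
have e12 : ip (b (inord 1)) (b (inord 2)) = -2 by rewrite G App1E !inordK.
have e02 : ip (b (inord 0)) (b (inord 2)) = 0 by rewrite G App1E !inordK.
have [pos|neg] := root_pair_sum gA (rb (inord 1)) (rb (inord 2)) e12.
  have [w [d [p [q [e dq Apq [h0 h1 h2]]]]]] :=
    standard_triple gA (rb _) (rb _) (rb _) e01 e12 e02 pos.
  by apply: (fin false w d p q); rewrite ?scale1r.
have rN i : real_root A (- b i) by exact: real_rootN.
have [||||w [d [p [q [e dq Apq [h0 h1 h2]]]]]] :=
  standard_triple gA (rN (inord 0)) (rN (inord 1)) (rN (inord 2)).
- by rewrite pairingNl pairingNr opprK.
- by rewrite pairingNl pairingNr opprK.
- by rewrite pairingNl pairingNr opprK.
- by rewrite -opprD.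
by apply: (fin true w d p q); rewrite ?scaleN1r.
Qed.

Lemma simple_root_inj : injective (@simple_root n).
Proof.
move=> i j /rowP/(_ i); rewrite !simple_root_coord eqxx => /esym/eqP.
by rewrite pnatr_eq1 eqb1 => /eqP.
Qed.

Lemma std_system_uniq w s d p s' d' p' : ext_pair A d p -> ext_pair A d' p' ->
  [set W w x | x in std_system (s, (d, p))]%classic = std_system (s', (d', p')) ->
  (s, (d, p)) = (s', (d', p')).
Proof.
move=> e e' SE.
have /choice[f fE] : forall i, exists j,
    std_triple (s', (d', p')) j = W w (std_triple (s, (d, p)) i).
  move=> i; have : std_system (s', (d', p')) (W w (std_triple (s, (d, p)) i)).
    by rewrite -SE; exists (std_triple (s, (d, p)) i) => //; exists i.
  by case=> j _ jE; exists j.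
have G i j : App 1 (f i) (f j) = App 1 i j.
  by rewrite -(std_triple_gram s' e') !fE (pairing_weyl gA) std_triple_gram.
have [||| f0 f1 f2] := @App1_rigid (f (inord 0)) (f (inord 1)) (f (inord 2)).
- by rewrite G App1E !inordK.
- by rewrite G App1E !inordK.
- by rewrite G App1E !inordK.
have := fE (inord 0); have := fE (inord 1); have := fE (inord 2).
rewrite f0 f1 f2 /std_triple !inordK //= !weylZ.
set q := attach d p; set q' := attach d' p' => h2 h1 h0.
have hd : (-1) ^+ s' *: d' = (-1) ^+ s *: W w d.
  have cK x y : x + (y - x) = y by rewrite addrC subrK.
  by have := congr2 +%R h1 h2; rewrite -!scalerDr -weylD !cK.
have [nd ad sd pE cd] := e; have [nd' ad' sd' pE' cd'] := e'.
have [_ dq _] := attachP e; have [_ dq' _] := attachP e'.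
(* By antidominance [W w d] lies above [d], so it is nonnegative and cannot be [- d']; the two
   global signs agree. *)
have nwd : nneg (W w d).
  by rewrite -[W w d](subrK d); apply: nnegD => //; exact: antidom_le.
have ss : s = s'.
  have contra u u' : nneg u -> nneg u' -> u' 0 q' = 1 -> - u' = u -> False.
    move=> nu nu' u'1 uE; have := nu q'; rewrite -uE mxE u'1.
    by [].
  move: hd; rewrite !sign_scale; case: (s) (s') => -[] //.
    by move=> hd; case: (contra _ _ nwd nd' dq'); rewrite -[W w d]opprK -hd.
  by move=> hd; case: (contra _ _ nwd nd' dq').
rewrite -ss in h0 h1 h2 hd *.
have sI (u v : 'rV[int]_n) : (-1) ^+ s *: u = (-1) ^+ s *: v -> u = v.
  by rewrite !sign_scale; case: (s) => // /oppr_inj.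
have dE : d = d' by apply: (antidom_uniq gA) (esym (sI _ _ hd)).
(* [2 d + al p] is antidominant, and determines [p] once [d] is known. *)
have anti (c : 'rV[int]_n) (r : 'I_n) : ext_pair A c r -> antidom A (2 *: c + al r).
  case=> nc ac _ rE _ i; rewrite pairingDr pairingZr pairing_roots.
  (* The factor 2 in front of [c] is what makes the pairing with [al r] equal to 2 (-1) + 2 = 0. *)
  have [->|ir] := eqVneq i r; first by rewrite rE (sgcm_diag gA).
  by have := sgcm_off gA ir; have := ac i; lia.
have : 2 *: d + al p = 2 *: d' + al p'.
  apply: (antidom_uniq gA (w := w)) (anti _ _ e) (anti _ _ e') _.
  by rewrite weylD weylZ -(sI _ _ hd) -(sI _ _ h0).
by rewrite -dE => /addrI/simple_root_inj <-.
Qed.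

Lemma weyl_orbit_image w (S : set 'rV[int]_n) :
  weyl_orbit A [set W w x | x in S]%classic = weyl_orbit A S.
Proof.
apply/seteqP; split=> _ [v ->].
  exists (v ++ w); rewrite image_comp; apply: eq_imagel => x _ /=.
  by rewrite weyl_cat.
exists (v ++ rev w); rewrite image_comp; apply: eq_imagel => x _ /=.
by rewrite weyl_cat (weyl_revK gA).
Qed.

Theorem pi_mult_ext_pairs (L : seq ('rV[int]_n * 'I_n)) : uniq L ->
  (forall d p, ext_pair A d p <-> (d, p) \in L) ->
  pi_mult_eq R (App 1) A (2 * size L).
Proof.
move=> uL hL; pose LL := [seq (s, u) | s <- [:: true; false], u <- L].
have sLL : size LL = (2 * size L)%N by rewrite size_allpairs.
have uLL : uniq LL by apply: allpairs_uniq => // -[a b] [c d].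
have LLP s d p : ((s, (d, p)) \in LL) <-> ext_pair A d p.
  rewrite hL; split=> [/allpairsP[[s' u] /= [_ uL' [_ ->]]]|dL] //.
  by apply/allpairsP; exists (s, (d, p)); split=> //; case: (s).
pose F i := nth set0 [seq weyl_orbit A (std_system u) | u <- LL] i.
have FE i : (i < size LL)%N ->
    exists s d p, [/\ ext_pair A d p, F i = weyl_orbit A (std_system (s, (d, p))) &
      index (s, (d, p)) LL = i].
  move=> iL; have x0 : bool * ('rV[int]_n * 'I_n) by case: (LL) iL.
  have := mem_nth x0 iL; have := index_uniq x0 iL uLL.
  rewrite /F (nth_map x0) //; case: (nth x0 LL i) => s [d p] hi /LLP e.
  by exists s, d, p.
have orb S : weyl_orbit A S S by exists [::]; rewrite image_id.
have -> : pi_mult_eq R (App 1) A (2 * size L) =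
    (pi_orbits R (App 1) A #= `I_(2 * size L))%card by [].
have -> : pi_orbits R (App 1) A = [set F i | i in `I_(2 * size L)]%classic.
  rewrite -sLL; apply/seteqP; split=> [_ [S [piS tS] <-]|_ [i iL <-]].
    have [w [s [d [p [/[dup] e /LLP dL SE]]]]] := pi_system_std piS tS.
    have iL : (index (s, (d, p)) LL < size LL)%N by rewrite index_mem.
    exists (index (s, (d, p)) LL) => //.
    rewrite /F (nth_map (s, (d, p))) // nth_index //.
    by rewrite SE weyl_orbit_image.
  have [s [d [p [e -> _]]]] := FE i iL.
  by exists (std_system (s, (d, p))) => //; exact: std_system_pi.
apply: inj_card_eq => i j; rewrite !inE -sLL => iL jL Fij.
have [s [d [p [e Fi <-]]]] := FE i iL; have [s' [d' [p' [e' Fj <-]]]] := FE j jL.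
have := orb (std_system (s', (d', p'))); rewrite -Fj -Fij Fi => -[w wE].
by rewrite (std_system_uniq e e' (esym wE)).
Qed.

End Count.

(** * Overextended diagrams of hyperbolic type *)

Section Hyperbolic.
Context {n : nat} {A : 'M[int]_n} (gA : sgcm A).
Implicit Types x : 'rV[int]_n.
Notation ip := (pairing A).
Notation al := (@simple_root n).

(** Edge multiplicity; the value 0 on the diagonal turns the equations of a null vector into sums
    over neighbours. *)
Definition mult i j : int := if j == i then 0 else - A i j.

Lemma mult_ge0 i j : 0 <= mult i j.
Proof.
rewrite /mult; case: eqVneq => // ji.
by rewrite oppr_ge0 (sgcm_off gA) // eq_sym.
Qed.

Lemma multC i j : mult i j = mult j i.
Proof. by rewrite /mult eq_sym (sgcm_sym gA). Qed.

Lemma mult_neq0 i j : (mult i j != 0) = (j != i) && (A i j != 0).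
Proof. by rewrite /mult; case: (eqVneq j i) => _; rewrite ?oppr_eq0 ?eqxx. Qed.

Lemma pairing_mult i x : ip (al i) x = 2 * x 0 i - \sum_j mult i j * x 0 j.
Proof.
rewrite pairing_coord // [in RHS](bigD1 i) //= /mult eqxx mul0r add0r -sumrN.
by congr (_ + _); apply: eq_bigr => j /negPf ->; rewrite mulNr opprK.
Qed.

Lemma sum_ge_term (P : pred 'I_n) (F : 'I_n -> int) i :
  (forall j, 0 <= F j) -> P i -> F i <= \sum_(j | P j) F j.
Proof.
by move=> F0 Pi; rewrite (bigD1 i) //= lerDl sumr_ge0.
Qed.

Definition connected_set (D : {set 'I_n}) := forall Q : {set 'I_n},
  Q \subset D -> Q != finset.set0 ->
  (forall i j, i \in Q -> j \in D -> mult i j != 0 -> j \in Q) -> Q = D.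

(** Let Q be closed in D minus i. If Q contains a neighbour e of i, then e is the only neighbour of
    i in D and Q together with i is closed in D. If not, Q is closed in D although it omits i. *)
Lemma connected_setD1 (D : {set 'I_n}) i : connected_set D -> i \in D ->
  \sum_(j in D) mult i j <= 1 -> connected_set (D :\ i).
Proof.
move=> cD iD s1 Q QD Q0 cQ.
have Qi : i \notin Q by apply/negP => /(fintype.subsetP QD); rewrite !inE eqxx.
have QD' : Q \subset D.
  by apply/fintype.subsetP => j /(fintype.subsetP QD); rewrite !inE => /andP[].
have [/existsP[e /andP[eQ ie]]|/existsPn h] :=
    boolP [exists e, (e \in Q) && (mult i e != 0)]; last first.
  suff QE : Q = D by move: Qi; rewrite QE iD.
  apply: cD => // j k jQ kD jk.
  have ki : k != i.
    by apply: contraNneq (h j) => ki; rewrite jQ /= multC -ki.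
  by apply: (cQ j) => //; rewrite !inE ki.
suff -> : D = i |: Q by rewrite setU1K.
symmetry; apply: cD.
- by rewrite finset.subUset finset.sub1set iD.
- by apply/set0Pn; exists i; rewrite !inE eqxx.
move=> j k; rewrite !inE => /orP[/eqP ->|jQ] kD jk.
  have [->|ke] := eqVneq k e; first by rewrite eQ orbT.
  have eD := fintype.subsetP QD' _ eQ.
  move: s1; rewrite (bigD1 e) //= (bigD1 k) /=; last by rewrite kD.
  have : 0 <= \sum_(l in D | (l != e) && (l != k)) mult i l.
    by apply: sumr_ge0 => *; exact: mult_ge0.
  under eq_bigl do rewrite -andbA.
  have := mult_ge0 i e; have := mult_ge0 i k.
  move: ie jk => ie ik h1 h2 h3 h4; exfalso; move: h3 h4.
  by set s := (\sum_(l in D | (l != e) && (l != k)) mult i l); lia.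
have [//|ki] := eqVneq k i.
by apply/orP; right; apply: (cQ j) => //; rewrite !inE ki.
Qed.

Section TwoVertices.

Record full_pair u p : Prop := FullPair {
  full_ext :> ext_pair A u p;
  full_supp : forall i, i != p -> 0 < u 0 i
}.

Lemma full_0 u p : full_pair u p -> u 0 p = 0.
Proof. by move=> /full_ext/ext_pair_notin. Qed.

Lemma full_pairing u p i : full_pair u p -> ip (al i) u = - (i == p)%:R.
Proof.
move=> f; have [->|ip] := eqVneq i p; first by case: f => -[].
by case: f => -[_ _ sd _ _] /(_ i ip) ui; rewrite oppr0 sd // gt_eqF.
Qed.

Lemma full_sum u p i : full_pair u p ->
  \sum_j mult i j * u 0 j = 2 * u 0 i + (i == p)%:R.
Proof.
move=> f; have := full_pairing i f; rewrite pairing_mult.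
set s := bigop _ _ _; set t := _%:R; lia.
Qed.

Lemma full_leaf u p : full_pair u p -> exists q,
  [/\ q != p, u 0 q = 1, mult p q = 1 & forall i, i != q -> mult p i = 0].
Proof.
move=> f; have [q [qp uq Apq h]] := ext_pair_attach gA f.
exists q; split=> //; first by rewrite /mult (negPf qp) Apq.
move=> i iq; rewrite /mult; case: eqVneq => // ip.
by rewrite h ?oppr0 // gt_eqF // (full_supp f).
Qed.

Lemma full_connected u p : full_pair u p -> connected_set (~: [set p]).
Proof.
move=> f Q QD /set0Pn[i iQ] cQ; apply/setP => j.
have uE k : (u 0 k != 0) = (k != p).
  have [->|kp] := eqVneq k p; first by rewrite (full_0 f) eqxx.
  by rewrite gt_eqF // (full_supp f).
apply/idP/idP => [/(fintype.subsetP QD)//|]; rewrite !inE -uE.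
apply: (ext_conn f) => [k l uk ul Akl kQ|]; last first.
  by exists i => //; rewrite uE; have := fintype.subsetP QD _ iQ; rewrite !inE.
have [<-//|lk] := eqVneq k l; apply: (cQ k) => //; first by rewrite !inE -uE.
by rewrite mult_neq0 eq_sym lk.
Qed.

Variables (u v : 'rV[int]_n) (p p' : 'I_n).
Hypotheses (fu : full_pair u p) (fv : full_pair v p') (pp' : p != p').

(** The pairing (u|v) equals both -v_p and -u_{p'}. *)
Lemma full_mark : u 0 p' = v 0 p /\ 0 < v 0 p.
Proof.
split; last exact: (full_supp fv).
have h w r x : full_pair w r -> ip x w = - x 0 r.
  move=> f; rewrite pairing_suml (bigD1 r) //= (full_pairing _ f) eqxx mulrN mulr1.
  by rewrite big1 ?addr0 // => i ir; rewrite (full_pairing _ f) (negPf ir) oppr0 mulr0.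
have := h u p v fu; rewrite pairingC // (h v p' u fv).
by move/oppr_inj.
Qed.

(* Along the branch starting at [p], the coordinates of [u] are 0, 1, 2, ...
   and those of [v] are a, 2 a, 3 a, ... where [a = v 0 p]. *)
Definition chain_edge (k : nat) c b :=
  [/\ mult b c = 1, u 0 c = k%:Z, v 0 c = (k%:Z + 1) * v 0 p,
      u 0 b = k%:Z + 1 & v 0 b = (k%:Z + 2) * v 0 p].

Lemma chain_start : exists b, chain_edge 0 p b /\ u 0 b = 1.
Proof.
have [q [qp uq mq mq']] := full_leaf fu; exists q; split=> //.
have := full_sum p fv; rewrite (negPf pp') addr0 (bigD1 q) //= mq mul1r.
rewrite big1 ?addr0 => [vq|i iq]; last by rewrite mq' // mul0r.
split; rewrite ?add0r ?mul1r ?vq //; first by rewrite multC.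
exact: full_0 fu.
Qed.

Lemma chain_sums k c b : chain_edge k c b ->
  \sum_(j | j != c) mult b j * u 0 j = k%:Z + 2 /\
  \sum_(j | j != c) mult b j * v 0 j = (k%:Z + 3) * v 0 p.
Proof.
case=> mbc uc vc ub vb; have [_ a0] := full_mark.
have bp : b != p by apply/eqP => bp; move: ub; rewrite bp (full_0 fu); lia.
have bp' : b != p'.
  by apply/eqP => bp'; move: vb; rewrite bp' (full_0 fv); nia.
have := full_sum b fu; have := full_sum b fv.
rewrite (negPf bp) (negPf bp') !(bigD1 c (P := xpredT)) //= mbc uc vc ub vb !mul1r.
set s := bigop _ _ _; set t := bigop _ _ _ => h1 h2.
split; first by move: h2; lia.
move: h1; set a := v 0 p; lia.
Qed.

Lemma chain_next k c b : chain_edge k c b -> \sum_(j | j != c) mult b j < 2 ->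
  exists e, chain_edge k.+1 b e.
Proof.
move=> ch; have [su sv] := chain_sums ch; case: (ch) => mbc uc vc ub vb m2.
have [/existsP[e /andP[ec me]]|/existsPn h] :=
    boolP [exists e, (e != c) && (mult b e != 0)]; last first.
  move: su; rewrite big1 => [|j jc]; first by lia.
  by have := h j; rewrite jc negbK => /eqP ->; rewrite mul0r.
have me0 := mult_ge0 b e.
have rest : \sum_(j | (j != c) && (j != e)) mult b j = 0 /\ mult b e = 1.
  move: m2; rewrite (bigD1 e) //=.
  have : 0 <= \sum_(j | (j != c) && (j != e)) mult b j.
    by apply: sumr_ge0 => *; exact: mult_ge0.
  by move: me me0; set s := bigop _ _ _; lia.
case: rest => /eqP; rewrite psumr_eq0 => [/allP rest me1|*]; last exact: mult_ge0.
have rest0 (x : 'rV[int]_n) :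
    \sum_(j | (j != c) && (j != e)) mult b j * x 0 j = 0.
  rewrite big1 // => j jce; have := rest j (mem_index_enum _).
  by rewrite jce => /eqP ->; rewrite mul0r.
move: su; rewrite (bigD1 e) //= rest0 addr0 me1 mul1r => ue.
move: sv; rewrite (bigD1 e) //= rest0 addr0 me1 mul1r => ve.
by exists e; split; rewrite ?(multC e) ?ub ?vb ?ue ?ve //; try congr (_ * _); lia.
Qed.

(** The coordinate of u grows by 1 at each step of the chain and is bounded by the height of u. *)
Lemma chain_end : exists k c b, chain_edge k c b /\
  2 <= \sum_(j | j != c) mult b j.
Proof.
have [b0 [ch0 _]] := chain_start.
suff key N k c b : (height u < k%:Z + N%:Z) -> chain_edge k c b ->
    exists k c b, chain_edge k c b /\ 2 <= \sum_(j | j != c) mult b j.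
  apply: (key (absz (height u)).+1 0%N p b0) => //.
  by have := height_ge0 (ext_nneg fu); lia.
elim: N k c b => [|N IH] k c b hk ch; last first.
  have [h2|h2] := lerP 2 (\sum_(j | j != c) mult b j); first by exists k, c, b.
  by have [e che] := chain_next ch h2; apply: (IH k.+1 b e) => //; lia.
case: ch => _ _ _ ub _; have : u 0 b <= height u.
  by apply: (@sum_ge_term xpredT (u 0)) => //; exact: (ext_nneg fu).
by rewrite ub; lia.
Qed.

(** The delicate case is a chain that branches at once, at the neighbour of p, as happens for
    A_n^{(1)}: then u is 1 on its whole support, which leaves no room for p'. *)
Lemma chain_branch : exists (k : nat) b,
  [/\ (2 <= k)%N, u 0 b = k%:Z, v 0 b = (k%:Z + 1) * v 0 p,
      3 <= \sum_j mult b j & mult b p = 0].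
Proof.
have [k [c [b [ch m2]]]] := chain_end.
have [su _] := chain_sums ch; case: (ch) => mbc uc vc ub vb.
have [a1 a0] := full_mark.
have m3 : 3 <= \sum_j mult b j.
  by rewrite (bigD1 c) //= mbc; move: m2; set s := bigop _ _ _; lia.
have [q [qp uq mq mq']] := full_leaf fu.
case: k ch uc vc ub vb su => [|k] ch uc vc ub vb su; last first.
  exists k.+2, b; split=> //; rewrite ?ub ?vb //; first by lia.
    by congr (_ * _); lia.
  by rewrite multC mq' //; apply/eqP => bq; move: ub; rewrite bq uq; lia.
have bp : b != p by apply/eqP => bp; move: ub; rewrite bp (full_0 fu).
have cp : c = p.
  by apply/eqP/negPn/negP => /(full_supp fu); rewrite uc.
rewrite {c}cp in mbc uc vc su m2 ch.
have u1 j : j != p -> 1 <= u 0 j by move=> jp; rewrite -gtz0_ge1 (full_supp fu).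
(* The neighbours of b other than p have total multiplicity at least 2 and weighted sum 2, so their
   coordinates are 1. *)
have [e [ep eb ue]] : exists e, [/\ e != p, mult b e != 0 & u 0 e = 1].
  have [/existsP[e /andP[ep me]]|/existsPn h] :=
      boolP [exists e, (e != p) && (mult b e != 0)]; last first.
    move: su; rewrite big1 // => j jc.
    by have := h j; rewrite jc negbK => /eqP ->; rewrite mul0r.
  exists e; split=> //; have : \sum_(j | j != p) mult b j * (u 0 j - 1) <= 0.
    under eq_bigr do rewrite mulrBr mulr1.
    by rewrite sumrB su; move: m2; set s := bigop _ _ _; lia.
  have t0 j : j != p -> 0 <= mult b j * (u 0 j - 1).
    by move=> jp; rewrite mulr_ge0 ?mult_ge0 // subr_ge0 u1.
  rewrite (bigD1 e) //= => h1.
  have : 0 <= \sum_(j | (j != p) && (j != e)) mult b j * (u 0 j - 1).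
    by apply: sumr_ge0 => j /andP[/t0].
  have := u1 e ep; have := mult_ge0 b e; have := t0 e ep; move: me h1.
  set s := bigop _ _ _; nia.
(* [P] spreads along edges: if j and its neighbour l have coordinate 1, the neighbours of j sum to
   2, which leaves 1 for any other neighbour. *)
pose P i := (u 0 i == 1) && [exists j, [&& j != p, mult i j != 0 & u 0 j == 1]].
have Pb : P b.
  by rewrite /P ub /=; apply/existsP; exists e; rewrite ep eb ue.
have PT i : u 0 i != 0 -> P i.
  apply: (ext_conn fu) => [j k uj uk Ajk /andP[/eqP uj1 /existsP[l]]|].
    move=> /and3P[lp jl /eqP ul].
    have jp : j != p by apply: contraNneq uj => ->; rewrite (full_0 fu).
    have kp : k != p by apply: contraNneq uk => ->; rewrite (full_0 fu).
    have [<-|kj] := eqVneq j k.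
      rewrite /P uj1 eqxx; apply/existsP; exists l; by rewrite lp jl ul.
    have mjk : mult j k != 0 by rewrite mult_neq0 eq_sym kj.
    apply/andP; split; last first.
      by apply/existsP; exists j; rewrite jp multC mjk uj1.
    have [->|kl] := eqVneq k l; first by rewrite ul.
    have := full_sum j fu; rewrite (negPf jp) addr0 uj1.
    rewrite (bigD1 k) //= (bigD1 l) //=; last by rewrite eq_sym.
    have : 0 <= \sum_(i | (i != k) && (i != l)) mult j i * u 0 i.
      by apply: sumr_ge0 => t _; rewrite mulr_ge0 ?mult_ge0 ?(ext_nneg fu).
    rewrite ul mulr1; have := u1 k kp; have := mult_ge0 j k; have := mult_ge0 j l.
    move: mjk jl; set s := bigop _ _ _; move=> *; apply/eqP; nia.
  by exists b => //; rewrite ub.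
(* The equation at the leaf p' reads u_{q'} = 2 u_{p'}, which is at least 2. *)
have [q' [qp' vq' mq1 mq2]] := full_leaf fv.
have := full_sum p' fu; rewrite eq_sym (negPf pp') addr0 (bigD1 q') //= mq1 mul1r.
rewrite big1 ?addr0 => [uq'|i iq]; last by rewrite mq2 // mul0r.
have uq0 : u 0 q' != 0 by rewrite uq'; lia.
by have /andP[/eqP] := PT q' uq0; rewrite uq'; lia.
Qed.

End TwoVertices.

(* A minimal connected set [D] containing the two branch vertices [b] and [b']
   supports the test vector equal to 2 on [D] and to 1 at the other neighbours
   of [b] and [b']; it is orthogonal to everything. *)
Lemma full_pair_uniq_vertex u v p p' : full_pair u p -> full_pair v p' -> p = p'.
Proof.
move=> fu fv; apply/eqP/negPn/negP => pp'.
have p'p : p' != p by rewrite eq_sym.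
have [a1 a0] := full_mark fu fv pp'.
have [k [b [k2 ub vb mb bp]]] := chain_branch fu fv pp'.
have [l [b' [l2 vb' ub' mb' b'p']]] := chain_branch fv fu p'p.
rewrite a1 in ub'; set a := v 0 p in a0 vb ub'.
(* Otherwise k = (l + 1) a and l = (k + 1) a with a >= 1. *)
have bb' : b != b'.
  apply/eqP => bb'; move: ub vb; rewrite bb' vb' ub' => h1 h2; nia.
have uE i : (u 0 i != 0) = (i != p).
  have [->|ip] := eqVneq i p; first by rewrite (full_0 fu) eqxx.
  by rewrite gt_eqF // (full_supp fu).
have vE i : (v 0 i != 0) = (i != p').
  have [->|ip] := eqVneq i p'; first by rewrite (full_0 fv) eqxx.
  by rewrite gt_eqF // (full_supp fv).
have [q [qp uq mq mq']] := full_leaf fu.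
have [r [rp vr mr mr']] := full_leaf fv.
have b'p : mult b' p = 0.
  by rewrite multC mq' //; apply/eqP => bq; move: ub'; rewrite bq uq; nia.
have bp' : mult b p' = 0.
  by rewrite multC mr' //; apply/eqP => bq; move: vb; rewrite bq vr; nia.
suff key N (D : {set 'I_n}) : (#|D| < N)%N -> connected_set D -> b \in D ->
    b' \in D -> p \notin D -> p' \notin D -> False.
  have cp := full_connected fu.
  apply: (key _ _ (leqnn _) (connected_setD1 (i := p') cp _ _)).
  - by rewrite !inE.
  - rewrite (bigD1 r) /=; last first.
      rewrite !inE; apply/eqP => rp0.
      have p'q : p' = q.
        by apply/eqP/negPn/negP => h; have := mq' p' h; rewrite multC -rp0 mr.
      have := full_sum p fv; rewrite (negPf pp') addr0.
      rewrite (bigD1 q) //= big1 => [|i iq]; last by rewrite mq' // mul0r.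
      by rewrite -{2}p'q (full_0 fv); lia.
    by rewrite mr big1 ?addr0 // => i /andP[_ ir]; rewrite mr'.
  - rewrite !inE -vE -uE vb ub.
    by apply/andP; split; apply/eqP; nia.
  - rewrite !inE -vE -uE vb' ub'.
    by apply/andP; split; apply/eqP; nia.
  - by rewrite !inE eqxx andbF.
  by rewrite !inE eqxx.
elim: N D => // N IH D; rewrite ltnS => DN cD bD b'D pD p'D.
(* Vertices other than b and b' with at most one neighbour in D are pruned. Once none is left, each
   of them has two neighbours in D, which makes [w] antidominant there. *)
have [/existsP[i /andP[iD /andP[/andP[ib ib'] i1]]]|/existsPn h] :=
    boolP [exists i, (i \in D) && ((i != b) && (i != b') &&
                     (\sum_(j in D) mult i j <= 1))].
  apply: (IH (D :\ i)).
  - by rewrite (cardsD1 i D) iD in DN; rewrite -ltnS.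
  - exact: connected_setD1.
  - by rewrite !inE eq_sym ib.
  - by rewrite !inE eq_sym ib'.
  - by rewrite !inE negb_and pD orbT.
  by rewrite !inE negb_and p'D orbT.
pose w : 'rV[int]_n := \row_i (if i \in D then 2 else
  if (mult i b != 0) || (mult i b' != 0) then 1 else 0).
have wD i : i \in D -> w 0 i = 2 by move=> iD; rewrite mxE iD.
have nw : nneg w by move=> i; rewrite mxE; case: ifP => // _; case: ifP.
have sD i : \sum_j mult i j * w 0 j >= 2 * \sum_(j in D) mult i j.
  rewrite [X in _ <= X](bigID (mem D)) /= mulr_sumr.
  rewrite [X in _ <= X + _](eq_bigr (fun j => 2 * mult i j)) => [|j jD].
  2: by rewrite wD // mulrC.
  by rewrite lerDl; apply: sumr_ge0 => j _; rewrite mulr_ge0 ?mult_ge0.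
(* With multiplicity there are at least three neighbours, of value at least 1, and one of them lies
   in D and has value 2: together at least 4 = 2 w_c. *)
have branch c : (c == b) || (c == b') -> 4 <= \sum_j mult c j * w 0 j.
  move=> cbb; have m3 : 3 <= \sum_j mult c j by case/orP: cbb => /eqP ->.
  have cD' : c \in D by case/orP: cbb => /eqP ->.
  have [e eD ce] : exists2 e, e \in D & mult c e != 0.
    have [/existsP[e /andP[]]|/existsPn h'] :=
      boolP [exists e, (e \in D) && (mult c e != 0)]; first by exists e.
    have DE : [set c] = D.
      apply: cD; first by rewrite finset.sub1set.
        by apply/set0Pn; exists c; rewrite inE.
      move=> i j; rewrite !inE => /eqP -> jD cj.
      by have := h' j; rewrite jD cj.
    by move: bD b'D; rewrite -DE !inE => /eqP bE /eqP b'E; move: bb'; rewrite bE b'E eqxx.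
  have le1 j : mult c j <= mult c j * w 0 j.
    have [->|cj] := eqVneq (mult c j) 0; first by rewrite mul0r.
    rewrite ler_peMr ?mult_ge0 // mxE; case: ifP => // _.
    by case/orP: cbb => /eqP <-; rewrite (multC j c) cj ?orbT.
  have s1 : \sum_(j | j != e) mult c j <= \sum_(j | j != e) mult c j * w 0 j.
    by apply: ler_sum.
  move: m3 s1; rewrite (bigD1 e) //= [X in _ -> _ -> is_true (_ <= X)](bigD1 e) //=.
  rewrite (wD e) //; have := mult_ge0 c e; move: ce.
  move: (\sum_(j | j != e) mult c j) (\sum_(j | j != e) mult c j * w 0 j) => x y.
  move: (mult c e) => z; clear; lia.
have aw : antidom A w.
  move=> i; rewrite pairing_mult subr_le0; have [iD|iD] := boolP (i \in D).
    rewrite wD //; have [ib|ib] := boolP ((i == b) || (i == b')); first exact: branch.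
    have := h i; rewrite iD -negb_or ib /= -ltNge => i1.
    have := sD i; move: i1.
    move: (\sum_(j in D) mult i j) (\sum_j mult i j * w 0 j) => x y; clear; lia.
  rewrite [w 0 i]mxE (negPf iD); case: ifP => [adj|_]; last first.
    by rewrite mulr0; apply: sumr_ge0 => j _; rewrite mulr_ge0 ?mult_ge0.
  have [c [cD' ic]] : exists c, c \in D /\ mult i c != 0.
    by case/orP: adj => ?; [exists b|exists b'].
  have : mult i c * w 0 c <= \sum_j mult i j * w 0 j.
    by apply: (@sum_ge_term xpredT (fun j => mult i j * w 0 j)) => // j;
      rewrite mulr_ge0 ?mult_ge0.
  rewrite wD //; have := mult_ge0 i c; move: ic.
  move: (\sum_j _) (mult i c) => x y; clear; lia.
have wp : w 0 p = 0.
  by rewrite mxE (negPf pD) !(multC p) bp b'p eqxx.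
have wp' : w 0 p' = 0.
  by rewrite mxE (negPf p'D) !(multC p') bp' b'p' eqxx.
(* (w|z) = -w_t = 0 is also the sum of the nonpositive terms z_i (al i|w). *)
have orth z t : full_pair z t -> w 0 t = 0 -> forall i, i != t -> ip (al i) w = 0.
  move=> fz wt i it; apply: (sum_eq0 (ext_nneg fz) aw); last first.
    by rewrite gt_eqF // (full_supp fz).
  rewrite -pairing_suml pairingC // pairing_suml big1 // => j _.
  rewrite (full_pairing _ fz); have [->|jt] := eqVneq j t; first by rewrite wt mul0r.
  by rewrite oppr0 mulr0.
have w0 i : ip (al i) w = 0.
  have [->|ip] := eqVneq i p; last exact: orth fu wp _ ip.
  exact: orth fv wp' _ pp'.
(* Since w is nonnegative and orthogonal to all simple roots, its zeros spread along edges: from p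
   to the whole diagram, although w_b = 2. *)
have zero i j : mult i j != 0 -> w 0 i == 0 -> w 0 j == 0.
  move=> ij /eqP wi; have /eqP := w0 i; rewrite pairing_mult wi mulr0 sub0r oppr_eq0.
  rewrite psumr_eq0 => [/allP/(_ j)|*]; last by rewrite mulr_ge0 ?mult_ge0.
  by rewrite mem_index_enum mulf_eq0 (negPf ij) => /(_ isT).
have : w 0 b == 0.
  apply: (ext_conn fu (P := fun i => w 0 i == 0)) => [i j _ _ Aij wi||].
  - have [<-//|ji] := eqVneq i j; apply: zero wi.
    by rewrite mult_neq0 eq_sym ji.
  - exists q; first by rewrite uE.
    by apply: (zero p); rewrite ?wp ?mq.
  by rewrite uE; apply/eqP => bE; move: ub; rewrite bE (full_0 fu); lia.
by rewrite wD.
Qed.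

(** Both vectors are isotropic with the same support, hence proportional by [null_supp]; the pairing
    -1 with al p fixes the factor. *)
Lemma full_pair_uniq u v p : full_pair u p -> full_pair v p -> u = v.
Proof.
move=> fu fv.
have [q [qp uq Apq _]] := ext_pair_attach gA fu.
have [nu _ su _ cu] := full_ext fu.
have u0 i : (u 0 i != 0) = (i != p).
  have [->|ip] := eqVneq i p; first by rewrite (full_0 fu) eqxx.
  by rewrite gt_eqF // (full_supp fu).
have sv i : v 0 i != 0 -> u 0 i != 0.
  by rewrite u0; apply: contraNneq => ->; rewrite (full_0 fv).
have vv : ip v v = 0.
  rewrite pairing_suml big1 // => i _; rewrite (full_pairing _ fv).
  by have [->|_] := eqVneq i p; rewrite ?(full_0 fv) ?mul0r // oppr0 mulr0.
have vE i : v 0 i = v 0 q * u 0 i.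
  have [->|ip] := eqVneq i p; first by rewrite (full_0 fu) (full_0 fv) mulr0.
  rewrite -(null_supp gA nu su cu sv vv (i := i) (j := q)) ?u0 //.
  by rewrite uq mulr1.
have vEq : v = v 0 q *: u by apply/rowP => i; rewrite mxE vE.
have := full_pairing p fv; rewrite {1}vEq pairingZr (full_pairing _ fu) eqxx mulrN mulr1.
by move/oppr_inj => vq; rewrite vEq vq scale1r.
Qed.

End Hyperbolic.

(** * From [Ext] and [Hyp] to pairs *)

Section ExtHyp.
Context {R : realType}.

Lemma simply_laced_sgcm n (A : 'M[int]_n) : is_gcm A -> simply_laced A -> sgcm A.
Proof.
case=> Ad Ao _ As; split=> // i j.
by rewrite -[in LHS]As mxE.
Qed.

(** The null root of Y has full support: the off-diagonal terms of (al i|d) = 0 cannot cancel, so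
    the zeros of d would split Y into two unlinked parts. *)
Lemma ext_full_pair n (X : 'M[int]_n) : Ext R X -> exists u p, full_pair (A := X) u p.
Proof.
case=> gX sX [p [affY [d [[dY _] dp]]]]; have sgX := simply_laced_sgcm gX sX.
(* The vertex [p] forces n to be a successor, after which [n.-1] computes in the type of [Y]. *)
case: n X p gX sX sgX d affY dY dp => [|n] X p gX sX sgX d affY dY dp.
  by case: p {affY d dY dp}.
set Y := remove_vertex X p in affY dY; rewrite /= in d Y affY dY dp.
have YE k l : Y k l = X (lift p k) (lift p l) by rewrite !mxE.
have sgY : sgcm Y.
  split=> [k l|k|k l kl]; rewrite !YE; first exact: sgcm_sym.
    exact: sgcm_diag.
  by apply: sgcm_off => //; rewrite (inj_eq lift_inj).
have dl k : extend p d 0 (lift p k) = d 0 k by rewrite mxE liftK.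
have d0 : extend p d 0 p = 0 by rewrite mxE unlift_none.
have dYE := affine_imaginary sgY affY dY.
have ipE k : pairing X (simple_root (lift p k)) (extend p d) = 0.
  rewrite -(dYE k) !pairing_rootl (bigD1_ord p) //= d0 mulr0 add0r.
  by apply: eq_bigr => l _; rewrite dl YE.
have [[dn0 _] _ nd] := dY.
have [_ [_ iY] _ _ _] := affY.
have off k l : k != l -> Y k l * d 0 l <= 0.
  by move=> kl; rewrite mulr_le0_ge0 ?nd ?(sgcm_off sgY).
have dpos k : 0 < d 0 k.
  rewrite lt_def nd andbT; apply/negP => /eqP dk.
  pose S := [set i | d 0 i == 0]%SET.
  apply: (iY S).
  - by apply/set0Pn; exists k; rewrite inE dk.
  - apply: contraNneq dn0 => ST; apply/eqP/rowP => i; rewrite mxE; apply/eqP.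
    by have := finset.in_setT i; rewrite -ST inE.
  move=> i j; rewrite !inE => /eqP di dj.
  suff Yij : Y i j = 0 by split=> //; rewrite (sgcm_sym sgY).
  have ij : i != j by apply: contraNneq dj => <-; rewrite di.
  have := dYE i; rewrite pairing_coord // di mulr0 add0r (bigD1 j) /=; last by rewrite eq_sym.
  have : \sum_(l | (l != i) && (l != j)) Y i l * d 0 l <= 0.
    by apply: sumr_le0 => l /andP[li _]; apply: off; rewrite eq_sym.
  have := off i j ij; set s := bigop _ _ _ => h1 h2 h3.
  have /eqP : Y i j * d 0 j = 0 by lia.
  by rewrite mulf_eq0 (negPf dj) orbF => /eqP.
have pE : pairing X (simple_root p) (extend p d) = -1 by rewrite pairingC.
have liftP i : i = p \/ exists k, i = lift p k.
  by case: (unliftP p i) => [k ->|->]; [right; exists k|left].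
exists (extend p d), p; split; last first.
  move=> i; case: (liftP i) => [->|[k ->] _]; first by rewrite eqxx.
  by rewrite dl.
split=> //.
- by move=> i; case: (liftP i) => [->|[k ->]]; rewrite ?d0 // dl.
- by move=> i; case: (liftP i) => [->|[k ->]]; rewrite ?pE // ipE.
- by move=> i; case: (liftP i) => [->|[k ->]]; rewrite ?ipE // d0 eqxx.
move=> P cP [i di Pi] j dj.
case: (liftP i) di Pi => [->|[k ->] _ Pk]; first by rewrite d0 eqxx.
case: (liftP j) dj => [->|[l ->] _]; first by rewrite d0 eqxx.
pose S := [set m | P (lift p m)]%SET.
have [ST|ST] := eqVneq S [set: 'I_n]%SET.
  by have := finset.in_setT l; rewrite -ST inE.
case: (iY S) => //; first by apply/set0Pn; exists k; rewrite inE.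
move=> a b; rewrite !inE => Pa Pb; suff Yab : Y a b = 0.
  by split=> //; rewrite (sgcm_sym sgY).
apply/eqP/negPn/negP => Yab; move/negP: Pb; apply.
apply: (cP (lift p a)) => //; last by rewrite -YE.
- by rewrite dl gt_eqF.
by rewrite dl gt_eqF.
Qed.

(** If v vanished at a vertex other than p, then p and the support of v would span a proper
    subdiagram. On its block containing p, the vector -v has nonnegative image, equal to 1 at p,
    while its own coordinate at p is 0; neither finite nor affine type allows this. *)
Lemma hyp_full_pair n (X : 'M[int]_n) v p : sgcm X -> Hyp R X ->
  ext_pair X v p -> full_pair (A := X) v p.
Proof.
move=> gX [_ _ _ _ [_ _ hyp]] e; split=> // i ip.
apply: nneg_gt0; first exact: ext_nneg e.
apply/negP => /eqP vi; pose S := [set j | (v 0 j != 0) || (j == p)]%SET.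
have [|P [/and3P[/eqP cP _ _] hP orthP]] := hyp S.
  by apply/eqP => /setP/(_ i); rewrite !inE vi eqxx (negPf ip).
have : p \in finset.cover P by rewrite cP inE eqxx orbT.
case/finset.bigcupP => T TP pT.
pose w : 'cV[R]_#|T| := \col_k - (v 0 (enum_val k))%:~R.
have wE k : (map_mx intr (principal X T) *m w) k 0 =
    (- pairing X (simple_root (enum_val k)) v)%:~R.
  rewrite -pairingNr pairing_rootl intr_sum mxE.
  rewrite (eq_bigr (fun l => (X (enum_val k) (enum_val l) * (- v) 0 (enum_val l))%:~R));
    last by move=> l _; rewrite !mxE intrM intrN.
  (* Terms outside [T] vanish: there v is 0 or the vertex lies in another block, orthogonal to
     [T]. *)
  rewrite (bigID (mem T)) /= [X in _ + X]big1 => [|j jT]; last first.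
    have [vj|vj] := eqVneq (v 0 j) 0; first by rewrite mxE vj oppr0 mulr0.
    have : j \in finset.cover P by rewrite cP inE vj.
    case/finset.bigcupP => U UP jU; rewrite (orthP T U) ?mul0r ?enum_valP //.
    by apply: contraNneq jT => ->.
  rewrite addr0 [RHS](reindex_onto enum_val (enum_rank_in pT)) /=; last first.
    by move=> j jT; exact: enum_rankK_in.
  by apply: eq_big => l; rewrite ?enum_valP ?enum_valK_in ?eqxx.
have w_ge0 k : 0 <= (map_mx intr (principal X T) *m w) k 0.
  by rewrite wE ler0z oppr_ge0; exact: ext_antidom e _.
pose k0 := enum_rank_in pT p; have k0E : enum_val k0 = p by exact: enum_rankK_in.
have w1 : (map_mx intr (principal X T) *m w) k0 0 = 1.
  by rewrite wE k0E (ext_p e) opprK.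
case: (hP T TP) => [[_ _ _ _ /(_ w w_ge0)]|[_ _ _ _ /(_ w w_ge0)]].
  case=> [/(_ k0)|w0]; first by rewrite mxE k0E (ext_pair_notin e) oppr0 ltxx.
  by move/eqP: w1; rewrite w0 mulmx0 mxE eq_sym oner_eq0.
by move=> w0; move/eqP: w1; rewrite w0 mxE eq_sym oner_eq0.
Qed.

Theorem pi_mult_ext_hyp n (X : 'M[int]_n) : Ext R X -> Hyp R X ->
  pi_mult_eq R (App 1) X 2.
Proof.
move=> eX hX; have [u [p f]] := ext_full_pair eX.
have gX : sgcm X by case: eX => gX sX _; exact: simply_laced_sgcm.
apply: (pi_mult_ext_pairs gX (L := [:: (u, p)])) => // d q.
rewrite inE; split=> [e|/eqP[-> ->]]; last exact: full_ext f.
have f' := hyp_full_pair gX hX e.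
have qp := full_pair_uniq_vertex gX f' f; rewrite qp in f' *.
by rewrite (full_pair_uniq gX f' f).
Qed.

End ExtHyp.

(** * Overextended pairs in diagrams given by lists of edges *)

Definition edge_row (E : seq (nat * nat)) (X : nat -> int) (j : nat) : int :=
  2 * X j - \sum_(e <- E) ((e.1 == j)%:R * X e.2 + (e.2 == j)%:R * X e.1).

(** The linear conditions of [ext_pair], for functions on [nat] to suit recurrences and [lia];
    connectedness enters in [fun_ext_pair]. *)
Record ext_fun m E (X : nat -> int) (p : nat) : Prop := ExtFun {
  ef_ge0 : forall k, (k < m)%N -> 0 <= X k;
  ef_le0 : forall k, (k < m)%N -> edge_row E X k <= 0;
  ef_supp : forall k, (k < m)%N -> X k = 0 \/ edge_row E X k = 0;
  ef_p : (p < m)%N;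
  ef_m1 : edge_row E X p = -1
}.

Definition row_of m (X : nat -> int) : 'rV[int]_m := \row_i X i.

Lemma edge_rowE m E X (j : 'I_m) : simple_edges m E ->
  pairing (edge_gcm m E) (simple_root j) (row_of m X) = edge_row E X j.
Proof. exact: edge_gcm_pairing. Qed.

Lemma ext_pair_fun m E (d : 'rV[int]_m.+1) p : simple_edges m.+1 E ->
  ext_pair (edge_gcm m.+1 E) d p -> ext_fun m.+1 E (fun k => d 0 (inord k)) p.
Proof.
move=> sE [nd ad sd pE _]; have dE : d = row_of m.+1 (fun k => d 0 (inord k)).
  by apply/rowP => i; rewrite mxE inord_val.
have rE k : (k < m.+1)%N -> edge_row E (fun k => d 0 (inord k)) k =
    pairing (edge_gcm m.+1 E) (simple_root (inord k)) d.
  by move=> km; rewrite [in RHS]dE edge_rowE // inordK.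
split=> [k _|k km|k km||]; first exact: nd.
- by rewrite rE.
- have [|dk] := eqVneq (d 0 (inord k)) 0; first by left.
  by right; rewrite rE // sd.
- by [].
by rewrite rE // inord_val.
Qed.

(** Connectedness is tested on predicates that are constant along the listed edges, with base vertex
    [r]; an equality covers both orientations of an edge. *)
Lemma fun_ext_pair m E X (p : 'I_m) r : simple_edges m E -> ext_fun m E X p ->
  (forall P : pred nat,
    (forall i j, X i <> 0 -> X j <> 0 -> (i, j) \in E -> P i = P j) ->
    forall j, (j < m)%N -> X j <> 0 -> P j = P r) ->
  ext_pair (edge_gcm m E) (row_of m X) p.
Proof.
move=> sE [X0 Xle Xs pm Xp] cX; have gA := edge_gcm_sgcm m E.
split=> [i|i|i||P cP [i Xi Pi] j Xj].
- by rewrite mxE X0.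
- by rewrite edge_rowE // Xle.
- by rewrite edge_rowE // mxE; case: (Xs i (ltn_ord i)) => // ->; rewrite eqxx.
- by rewrite edge_rowE.
pose P' (k : nat) := [exists i : 'I_m, (val i == k) && P i].
have P'E (k : 'I_m) : P' k = P k.
  apply/existsP/idP => [[l /andP[/eqP/val_inj ->]]//|Pk].
  by exists k; rewrite eqxx.
have h k : (k < m)%N -> X k <> 0 -> P' k = P' r.
  apply: cX => a b Xa Xb ab.
  have /allP/(_ _ ab)/and3P[/= nab am bm] := sE.
  have Aab : edge_gcm m E (Ordinal am) (Ordinal bm) != 0.
    rewrite mxE -val_eqE /= (negPf nab) oppr_eq0 -lt0n -has_count.
    by apply/hasP; exists (a, b) => //; rewrite eqxx.
  have Xa' : row_of m X 0 (Ordinal am) != 0 by rewrite mxE; apply/eqP.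
  have Xb' : row_of m X 0 (Ordinal bm) != 0 by rewrite mxE; apply/eqP.
  have -> : P' a = P (Ordinal am) by rewrite -P'E.
  have -> : P' b = P (Ordinal bm) by rewrite -P'E.
  apply/idP/idP; apply: cP => //.
  by rewrite (sgcm_sym gA).
rewrite -P'E h //; last by move: Xj; rewrite mxE => /eqP.
by rewrite -(h i) ?P'E //; move: Xi; rewrite mxE => /eqP.
Qed.

Lemma sum_iota_pick (F : nat -> int) s l a j :
  \sum_(i <- iota s l) (i + a == j)%N%:R * F i =
  if (s + a <= j < s + l + a)%N then F (j - a)%N else 0.
Proof.
elim: l s => [|l IH] s /=.
  by rewrite big_nil; case: ifP => //; lia.
rewrite big_cons IH; case: eqP => [<-|ne].
  by rewrite mul1r addnK; case: ifP; case: ifP; try lia; rewrite addr0.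
by rewrite mul0r add0r; case: ifP; case: ifP => //; lia.
Qed.

(** [List.In] expresses membership because functions on [nat] have no decidable equality;
    distinctness is required of the rows they define. *)
Lemma pi_mult_edges (R : realType) m E (L : seq ((nat -> int) * nat)) :
  simple_edges m.+1 E ->
  uniq [seq (row_of m.+1 x.1, inord x.2 : 'I_m.+1) | x <- L] ->
  (forall x, List.In x L -> (x.2 < m.+1)%N /\
     ext_pair (edge_gcm m.+1 E) (row_of m.+1 x.1) (inord x.2)) ->
  (forall X p, ext_fun m.+1 E X p ->
     exists2 x, List.In x L & p = x.2 /\ forall k, (k <= m)%N -> X k = x.1 k) ->
  pi_mult_eq R (App 1) (edge_gcm m.+1 E) (2 * size L).
Proof.
move=> sE uL hL enum.
pose t (x : (nat -> int) * nat) := (row_of m.+1 x.1, inord x.2 : 'I_m.+1).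
have tL x : List.In x L -> t x \in [seq t x | x <- L].
  elim: (L) => //= y L' IH [->|/IH h]; rewrite inE ?eqxx // h orbT //.
have Lt y : y \in [seq t x | x <- L] -> exists2 x, List.In x L & y = t x.
  elim: (L) => //= x L' IH; rewrite inE => /orP[/eqP ->|/IH[z zL ->]].
    by exists x; first left.
  by exists z => //; right.
rewrite -(size_map t); apply: pi_mult_ext_pairs uL _.
  exact: edge_gcm_sgcm.
move=> d p; split=> [e|/Lt[x /hL[xm e] [-> ->]]] //.
have [x xL [px Xx]] := enum _ _ (ext_pair_fun sE e).
have -> : (d, p) = t x; last exact: tL.
congr (_, _); last by rewrite -px inord_val.
by apply/rowP => i; rewrite mxE -Xx ?inord_val // -ltnS.
Qed.

(** * The pairs in A_n^{++} *)

Lemma App_edges_simple n : (0 < n)%N -> simple_edges n.+2 (App_edges n).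
Proof.
move=> n0; apply/allP => e; rewrite inE => /orP[/eqP -> //|/mapP[i + ->]] /=.
rewrite mem_iota add0n => /andP[_ i_n].
have := ltn_pmod i.+1 (isT : 0 < n.+1)%N.
have [->|ine] := eqVneq i n; first by rewrite modnn; lia.
rewrite modn_small; lia.
Qed.

Lemma App_row n X j : (0 < n)%N -> edge_row (App_edges n) X j =
  2 * X j - ((j == 0%N)%:R * X 1%N + (j == 1%N)%:R * X 0%N)
  - ((j == n.+1)%:R * X 1%N + (j == 1%N)%:R * X n.+1)
  - (if (1 <= j < n.+1)%N then X j.+1 else 0)
  - (if (2 <= j < n.+2)%N then X j.-1 else 0).
Proof.
move=> n0; rewrite /edge_row big_cons big_map.
have -> : iota 0 n.+1 = iota 0 n ++ [:: n] by rewrite -{1}addn1 iotaD.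
rewrite big_cat big_seq1 /= modnn.
rewrite (eq_big_seq (fun i => (i + 1 == j)%N%:R * X i.+2 +
  (i + 2 == j)%N%:R * X i.+1)); last first.
  move=> i; rewrite mem_iota => /andP[_ i_n].
  by rewrite modn_small ?addn1 ?addn2 //; lia.
rewrite big_split /= !sum_iota_pick !(eq_sym _ j).
have -> : (if (0 + 1 <= j < 0 + n + 1)%N then X (j - 1).+2 else 0) =
          (if (1 <= j < n.+1)%N then X j.+1 else 0).
  by rewrite !add0n addn1; case: ifP => // h; congr X; lia.
have -> : (if (0 + 2 <= j < 0 + n + 2)%N then X (j - 2).+1 else 0) =
          (if (2 <= j < n.+2)%N then X j.-1 else 0).
  by rewrite !add0n addn2; case: ifP => // h; congr X; lia.
ring.
Qed.

(** Beyond i the terms stay positive, so the recurrence applies and preserves the slope: such a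
    sequence never returns to 0. *)
Lemma increasing_run (X : nat -> int) i j :
  (forall k, (i < k < j)%N -> X k = 0 \/ 2 * X k = X k.-1 + X k.+1) ->
  0 <= X i -> X i < X i.+1 ->
  forall k, (i <= k < j)%N -> 0 <= X k /\ X k < X k.+1.
Proof.
move=> h Xi Xii; elim=> [|k IH] /andP[ik kj].
  by have -> : 0%N = i by lia.
have [<-//|ne] := eqVneq i k.+1.
have [Xk lt] : 0 <= X k /\ X k < X k.+1 by apply: IH; lia.
by have := h k.+1; rewrite /= => /(_ ltac:(lia)); lia.
Qed.

Lemma affine_run (X : nat -> int) i j :
  (forall k, (i < k < j)%N -> 2 * X k = X k.-1 + X k.+1) ->
  forall k, (i <= k <= j)%N -> X k = X i + (k - i)%N%:Z * (X i.+1 - X i).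
Proof.
move=> h.
suff h2 k : (i <= k < j)%N -> X k = X i + (k - i)%N%:Z * (X i.+1 - X i) /\
    X k.+1 = X i + (k.+1 - i)%N%:Z * (X i.+1 - X i).
  move=> k /andP[ik kj]; have [->|ki] := eqVneq k i; first by rewrite subnn mul0r addr0.
  by case: k ik kj ki => [|k] ik kj ki; [lia|have [] := h2 k; first lia].
elim: k => [|k IH] /andP[ik kj].
  have -> : i = 0%N by lia.
  by rewrite subnn subn0 mul0r mul1r addr0 addrC subrK.
have [<-|ne] := eqVneq i k.+1.
  by rewrite subnn subSnn mul0r mul1r addr0 addrC subrK.
have [e1 e2] : X k = X i + (k - i)%N%:Z * (X i.+1 - X i) /\
    X k.+1 = X i + (k.+1 - i)%N%:Z * (X i.+1 - X i) by apply: IH; lia.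
split=> //; have := h k.+1; rewrite /= => /(_ ltac:(lia)).
have -> : (k.+2 - i)%N%:Z = (k - i)%N%:Z + 2 by lia.
have {}e2 : X k.+1 = X i + ((k - i)%N%:Z + 1) * (X i.+1 - X i).
  by rewrite e2; congr (_ + _ * _); lia.
rewrite e1 e2; set D := X i.+1 - X i; set u := (k - i)%N%:Z => e3.
have -> : X k.+2 = 2 * (X i + (u + 1) * D) - (X i + u * D) by rewrite e3; ring.
ring.
Qed.

Definition App_null (k : nat) : int := if k is 0 then 0 else 1.

(* The null root of a subdiagram of [App n] of type E7(1) or E8(1), consisting of
   the new vertex and of two arms of lengths [l] and [r] starting at vertex 0. *)
Definition arms_null (n c s l t r k : nat) : int :=
  if k is 0 then c%:Z else (s * (l.+1 - k) + t * (k + r - n.+2))%N%:Z.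

(** Both arms of E_7^{(1)} end in 1, so [p] may follow either; only the long arm of E_8^{(1)} ends
    in 1, the short one ending in 2. The bounds on n keep [p] from touching the other arm. *)
Definition App_list n : seq ((nat -> int) * nat) :=
  (App_null, 0%N) ::
  (if (8 <= n)%N then [:: (arms_null n 2 1 4 1 4, 5%N);
                          (arms_null n 2 1 4 1 4, n - 2)%N] else [::]) ++
  (if (9 <= n)%N then [:: (arms_null n 3 2 3 1 6, n - 4)%N;
                          (arms_null n 3 1 6 2 3, 7%N)] else [::]).

(* Two arms of lengths [L], [R] along which the coordinates decrease from [2 a] to
   [0] with slopes [s], [t]: the equations amount to [(L - 2) (R - 2) = 4]. *)
Lemma arms_solve (L R : nat) (s t a : int) : 0 < a ->
  L%:Z * s = 2 * a -> R%:Z * t = 2 * a -> s + t = a ->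
  [\/ [/\ L = 4%N, R = 4%N, t = s & a = 2 * s],
      [/\ L = 3%N, R = 6%N, s = 2 * t & a = 3 * t] |
      [/\ L = 6%N, R = 3%N, t = 2 * s & a = 3 * s]].
Proof.
move=> a0 Ls Rt st; have s0 : 0 < s by nia.
have t0 : 0 < t by nia.
have e1 : (L%:Z - 2) * s = 2 * t by lia.
have e2 : (R%:Z - 2) * t = 2 * s by lia.
have L2 : 3 <= L%:Z by nia.
have R2 : 3 <= R%:Z by nia.
have e3 : (L%:Z - 2) * (R%:Z - 2) = 4.
  apply: (@mulIf _ (s * t)); first by rewrite mulf_neq0 // gt_eqF.
  have -> : (L%:Z - 2) * (R%:Z - 2) * (s * t) =
    ((L%:Z - 2) * s) * ((R%:Z - 2) * t) by ring.
  rewrite e1 e2; ring.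
have L6 : L%:Z <= 6 by nia.
have [LE|[LE|[LE|LE]]] : L = 3%N \/ L = 4%N \/ L = 5%N \/ L = 6%N by lia.
- by apply: Or32; rewrite LE in e1 e3; split; lia.
- by apply: Or31; rewrite LE in e1 e3; split; lia.
- by rewrite LE in e3; lia.
by apply: Or33; rewrite LE in e1 e3; split; lia.
Qed.

Section AppEnum.
Variables (n : nat) (X : nat -> int) (n0 : (0 < n)%N).
Notation r := (edge_row (App_edges n) X).

Lemma App_row0 : r 0 = 2 * X 0%N - X 1%N.
Proof. rewrite App_row //=; lia. Qed.

Lemma App_row1 : r 1 = 2 * X 1%N - X 0%N - X 2%N - X n.+1.
Proof.
rewrite App_row //.
have -> : (1%N == n.+1) = false by lia.
have -> : (1 <= 1 < n.+1)%N by lia.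
rewrite /=; lia.
Qed.

Lemma App_rowk k : (2 <= k <= n)%N -> r k = 2 * X k - X k.-1 - X k.+1.
Proof.
move=> /andP[k2 kn]; rewrite App_row //.
have -> : (k == 0%N) = false by lia.
have -> : (k == 1%N) = false by lia.
have -> : (k == n.+1) = false by lia.
have -> : (1 <= k < n.+1)%N by lia.
have -> : (2 <= k < n.+2)%N by lia.
lia.
Qed.

Lemma App_rown : r n.+1 = 2 * X n.+1 - X n - X 1%N.
Proof.
rewrite App_row // eqxx.
have -> : (n.+1 == 0%N) = false by lia.
have -> : (n.+1 == 1%N) = false by lia.
have -> : (1 <= n.+1 < n.+1)%N = false by lia.
have -> : (2 <= n.+1 < n.+2)%N by lia.
rewrite /=; lia.
Qed.

Lemma App_enum p : ext_fun n.+2 (App_edges n) X p ->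
  exists2 x, List.In x (App_list n) & p = x.2 /\ forall k, (k <= n.+1)%N -> X k = x.1 k.
Proof.
case=> X_ge0 r_le0 X_supp p_lt r_p.
have r0 := App_row0; have r1 := App_row1; have rn := App_rown.
have a0 := X_ge0 0%N isT; have r0_le := r_le0 0%N isT; have r1_le := r_le0 1%N isT.
have rn_le := r_le0 n.+1 (leqnn _).
have rp_ne k : X k != 0 -> (k <= n.+1)%N -> p != k.
  move=> Xk kn; apply/eqP => pk; case: (X_supp k kn) => [/eqP|]; first exact/negP.
  by rewrite -pk r_p.
have [X00|X0n] := eqVneq (X 0%N) 0.
  (* The inequalities make X convex on the cycle 1, ..., n + 1, hence constant there. *)
  pose e := X 2%N - X 1%N.
  have slope k : (1 <= k <= n)%N -> e <= X k.+1 - X k.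
    elim: k => // k IH /andP[_ kn]; have [->//|k0] := eqVneq k 0%N.
    have := App_rowk (k := k.+1) ltac:(lia); have := r_le0 k.+1 ltac:(lia).
    by have := IH ltac:(lia); rewrite /=; lia.
  have slope2 k : (1 <= n - k)%N -> X (n - k).+1 - X (n - k)%N <= X n.+1 - X n.
    elim: k => [|k IH] nk; first by rewrite subn0.
    have nkE : ((n - k.+1).+1 = n - k)%N by lia.
    have := App_rowk (k := (n - k)%N) ltac:(lia).
    have := r_le0 (n - k)%N ltac:(lia).
    have prE : ((n - k).-1 = n - k.+1)%N by lia.
    by have := IH ltac:(lia); rewrite nkE prE; lia.
  have eE k : (1 <= k <= n)%N -> X k.+1 - X k = e.
    move=> kn; have h1 := slope k kn; have := slope2 (n - k)%N ltac:(lia).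
    by rewrite subKn; last lia; move: h1 r1_le rn_le; rewrite r1 rn X00 /e; lia.
  have Xk k : (k < n.+1)%N -> X k.+1 = X 1%N + k%:Z * e.
    elim: k => [|k IH] kn; first by rewrite mul0r addr0.
    have := eE k.+1 ltac:(lia); rewrite IH; last by lia.
    by rewrite intS mulrDl mul1r; lia.
  have e0 : e = 0.
    have := Xk n (leqnn _); have := eE n ltac:(lia).
    have := slope 1%N ltac:(lia); move: r1_le rn_le; rewrite r1 rn X00 => h1 h2 h3 h4 h5.
    have : X n.+1 - X 1%N = - e by rewrite /e in h3 h4 *; lia.
    rewrite h5 addrC addKr => h6; have /eqP : (n%:Z + 1) * e = 0 by lia.
    by rewrite mulf_eq0 => /orP[|/eqP] //; lia.
  have XE k : (k < n.+1)%N -> X k.+1 = X 1%N.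
    by move=> kn; rewrite Xk // e0 mulr0 addr0.
  have XE' k : (1 <= k <= n.+1)%N -> X k = X 1%N by case: k => // k kn; exact: XE.
  have p00 : p = 0%N.
    apply/eqP/negPn/negP => pn0; have [p1|p1] := eqVneq p 1%N.
      by move: r_p; rewrite p1 r1 X00 (XE' 2%N) ?(XE' n.+1); lia.
    have [pn|pn] := eqVneq p n.+1.
      by move: r_p; rewrite pn rn (XE' n) ?(XE' n.+1); lia.
    by move: r_p; rewrite App_rowk ?(XE' p) ?(XE' p.-1) ?(XE' p.+1); lia.
  have X1 : X 1%N = 1 by move: r_p; rewrite p00 r0 X00; lia.
  exists (App_null, 0%N); first by left.
  by split=> // -[|k] kn //=; rewrite XE.
have X1 : X 1%N = 2 * X 0%N by case: (X_supp 0%N isT); lia.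
have r10 : X 2%N + X n.+1 = 3 * X 0%N by case: (X_supp 1%N isT); lia.
have a_gt0 : 0 < X 0%N by lia.
have Xp0 : X p = 0 by case: (X_supp p p_lt) => //; rewrite r_p.
have p2 : (2 <= p)%N.
  by case: (p) Xp0 => [|[|q]] //; rewrite ?X1; lia.
have exL : exists k, (0 < k)%N && (X k == 0) by exists p; rewrite Xp0 eqxx; lia.
have exR : exists k, (k <= n.+1)%N && (X k == 0) by exists p; rewrite Xp0 eqxx; lia.
(* The first and last zeros [i0] and [i1] end the two arms that leave vertex 1. *)
have [i0 /andP[i0_gt /eqP Xi0] i0_min] := ex_minnP exL.
have [|i1 /andP[i1_le /eqP Xi1] i1_max] := ex_maxnP exR (m := n.+1).
  by move=> k /andP[].
have i0p : (i0 <= p)%N by apply: i0_min; rewrite Xp0 eqxx; lia.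
have pi1 : (p <= i1)%N by apply: i1_max; rewrite Xp0 eqxx; lia.
have i0_2 : (2 <= i0)%N by case: (i0) i0_gt Xi0 => [|[|k]] //; rewrite X1; lia.
pose s := X 1%N - X 2%N.
have Xleft k : (1 <= k <= i0)%N -> X k = X 1%N - (k - 1)%N%:Z * s.
  move=> ki0; rewrite (affine_run (i := 1%N) (j := i0)) ?ki0 // => [|l li0].
    by rewrite -mulrN opprB.
  have : X l <> 0.
    by move=> Xl; have := i0_min l; rewrite Xl eqxx; lia.
  have := App_rowk (k := l) ltac:(lia); case: (X_supp l) => [|//|->]; lia.
(* Index n + 2 stands for vertex 1 again, so that the second arm is a run from [i1] up to it. *)
pose X' k := if k == n.+2 then X 1%N else X k.
have X'E k : (k <= n.+1)%N -> X' k = X k by move=> kn; rewrite /X' ltn_eqF.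
pose t := X' i1.+1.
have Xright k : (i1 <= k <= n.+2)%N -> X' k = (k - i1)%N%:Z * t.
  move=> ki1; rewrite (affine_run (i := i1) (j := n.+2)) // => [|l li1].
    by rewrite !(X'E i1) // Xi1 add0r subr0.
  have Xl : X l <> 0.
    by move=> Xl; have := i1_max l; rewrite Xl eqxx; lia.
  have rl : r l = 0 by case: (X_supp l) => //; lia.
  rewrite X'E; last by lia.
  rewrite X'E; last by lia.
  have [ln|ln] := eqVneq l n.+1.
    by move: rl; rewrite ln /X' eqxx rn /=; lia.
  rewrite X'E; last by lia.
  by move: rl; rewrite App_rowk; lia.
have s_eq : (i0 - 1)%N%:Z * s = 2 * X 0%N.
  by have := Xleft i0 ltac:(lia); rewrite Xi0 X1; lia.
have t_eq : (n.+2 - i1)%N%:Z * t = 2 * X 0%N.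
  by have := Xright n.+2 ltac:(lia); rewrite {1}/X' eqxx X1.
have st : s + t = X 0%N.
  have := Xright n.+1 ltac:(lia); rewrite X'E // => Xn1.
  have e : (n.+1 - i1)%N%:Z = (n.+2 - i1)%N%:Z - 1 by lia.
  by move: Xn1; rewrite e mulrBl t_eq mul1r /s X1; lia.
(* Between the arms, a nonzero coordinate would start an increasing run that cannot come back to 0
   at [i1]. *)
have Xmid k : (i0 <= k <= i1)%N -> X k = 0.
  elim: k => [|k IH] /andP[i0k ki1]; first by move: i0k i0_2; lia.
  have [<-//|ne] := eqVneq i0 k.+1.
  have Xk : X k = 0 by apply: IH; lia.
  have [->//|ne1] := eqVneq k.+1 i1.
  have Xk1 := X_ge0 k.+1 ltac:(lia).
  have [//|Xk1n] := eqVneq (X k.+1) 0.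
  have : 0 <= X i1.-1 /\ X i1.-1 < X i1.-1.+1.
    apply: (increasing_run (i := k) (j := i1)); [|lia|lia|lia].
    move=> l lk; case: (X_supp l) => [|->|]; [lia|by left|].
    by rewrite App_rowk; [right; lia|lia].
  by rewrite prednK; [rewrite Xi1; lia|lia].
have r_i0 : (i0 < i1)%N -> r i0 = - s.
  move=> i01; rewrite App_rowk; last by lia.
  rewrite Xi0 (Xmid i0.+1); last by lia.
  rewrite Xleft; last by lia.
  have e : (i0.-1 - 1)%N%:Z = (i0 - 1)%N%:Z - 1 by lia.
  by rewrite e mulrBl s_eq mul1r X1; lia.
have r_i1 : (i0 < i1)%N -> r i1 = - t.
  move=> i01; have tE := Xright i1.+1 ltac:(lia).
  have [in1|in1] := eqVneq i1 n.+1.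
    by rewrite in1 rn -in1 Xi1 /t /X' in1 eqxx (Xmid n); lia.
  rewrite App_rowk; last by lia.
  by rewrite Xi1 (Xmid i1.-1) /t ?X'E; lia.
have r_mid : (i0 < p < i1)%N -> False.
  move=> pi; move: r_p; rewrite App_rowk; last by lia.
  by rewrite (Xmid p) ?(Xmid p.-1) ?(Xmid p.+1); lia.
have r_eq : i0 = i1 -> r p = - X 0%N.
  move=> i01; have pi : p = i0 by lia.
  have e : (i0.-1 - 1)%N%:Z = (i0 - 1)%N%:Z - 1 by lia.
  have Xl : X i0.-1 = s by rewrite Xleft ?e ?mulrBl ?s_eq ?X1; lia.
  have tE : X' i1.+1 = t by [].
  rewrite pi; have [in1|in1] := eqVneq i0 n.+1.
    by rewrite in1 rn -in1 Xi0 -[X n]/(X n.+1.-1) -in1 Xl; move: tE;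
      rewrite -i01 in1 /X' eqxx; lia.
  rewrite App_rowk; last by lia.
  by rewrite Xi0 Xl; move: tE; rewrite -i01 X'E; lia.
have XE k c sl ss tt : (i0 < i1)%N -> i0 = sl.+1 -> X 0%N = c%:Z -> s = ss%:Z -> t = tt%:Z ->
    (k <= n.+1)%N -> X k = arms_null n c ss sl tt (n.+2 - i1) k.
  move=> i01 i0E X0E sE tE; case: k => [|k] kn //=.
  have [ki0|ki0] := leqP k.+1 i0.
    have -> : (k.+1 + (n.+2 - i1) - n.+2 = 0)%N by lia.
    rewrite muln0 addn0 Xleft; last by lia.
    have := s_eq; rewrite i0E X1 sE PoszM.
    have -> : (sl.+1 - 1)%N%:Z = sl%:Z by lia.
    have -> : (sl.+1 - k.+1)%N%:Z = sl%:Z - k%:Z by lia.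
    have -> : (k.+1 - 1)%N%:Z = k%:Z by lia.
    by rewrite mulrBr; lia.
  have -> : (sl.+1 - k.+1 = 0)%N by lia.
  rewrite muln0 add0n; have [ki1|ki1] := leqP k.+1 i1.
    have -> : (k.+1 + (n.+2 - i1) - n.+2 = 0)%N by lia.
    by rewrite muln0 Xmid; lia.
  have -> : (k.+1 + (n.+2 - i1) - n.+2 = k.+1 - i1)%N by lia.
  rewrite -X'E // Xright; last by lia.
  by rewrite tE PoszM mulrC.
(* With a single zero the pairing there is -(s + t) = -X 0, so X 0 = 1, which no solution of
   [arms_solve] allows. *)
have [i01|i01] := eqVneq i0 i1.
  move: (r_eq i01); rewrite r_p => X01; move: s_eq t_eq st.
  have -> : X 0%N = 1 by lia.
  move=> h1 h2 h3.
  by case: (arms_solve (a := 1) isT h1 h2 h3) => -[_ _ _]; lia.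
have i0i1 : (i0 < i1)%N by lia.
(* The pairings at the two zeros are -s and -t, so [p] follows an arm of slope 1. *)
have pE : p = i0 \/ p = i1.
  have [->|h1] := eqVneq p i0; first by left.
  have [->|h2] := eqVneq p i1; first by right.
  by case: r_mid; lia.
case: (arms_solve a_gt0 s_eq t_eq st) => -[LE RE stE aE].
- have s1 : s = 1 by case: pE => pE; move: r_p; rewrite pE ?r_i0 ?r_i1 // ?stE; lia.
  have n8 : (8 <= n)%N by lia.
  exists (arms_null n 2 1 4 1 4, p).
    by rewrite /App_list n8 /=; case: pE => pE; [right; left|right; right; left];
      congr (_, _); lia.
  split=> // k kn; rewrite -RE; apply: XE => //; lia.
- have pi : p = i1 by case: pE => // pE; move: r_p; rewrite pE r_i0 // stE; lia.
  have t1 : t = 1 by move: r_p; rewrite pi r_i1 //; lia.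
  have n9 : (9 <= n)%N by lia.
  have n8 : (8 <= n)%N by lia.
  exists (arms_null n 3 2 3 1 6, p).
    by rewrite /App_list n8 n9 /=; right; right; right; left; congr (_, _); lia.
  split=> // k kn; rewrite -RE; apply: XE => //; lia.
have pi : p = i0 by case: pE => // pE; move: r_p; rewrite pE r_i1 // stE; lia.
have s1 : s = 1 by move: r_p; rewrite pi r_i0 //; lia.
have n9 : (9 <= n)%N by lia.
have n8 : (8 <= n)%N by lia.
exists (arms_null n 3 1 6 2 3, p).
  by rewrite /App_list n8 n9 /=; right; right; right; right; left; congr (_, _); lia.
split=> // k kn; rewrite -RE; apply: XE => //; lia.
Qed.

End AppEnum.

Definition row_ok (x r : int) := r <= 0 /\ (x = 0 \/ r = 0).

Lemma App_ext_fun n X p : (0 < n)%N -> (forall k, (k <= n.+1)%N -> 0 <= X k) ->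
  row_ok (X 0%N) (2 * X 0%N - X 1%N) ->
  row_ok (X 1%N) (2 * X 1%N - X 0%N - X 2%N - X n.+1) ->
  (forall k, (2 <= k <= n)%N -> row_ok (X k) (2 * X k - X k.-1 - X k.+1)) ->
  row_ok (X n.+1) (2 * X n.+1 - X n - X 1%N) ->
  (p <= n.+1)%N -> edge_row (App_edges n) X p = -1 ->
  ext_fun n.+2 (App_edges n) X p.
Proof.
move=> n0 X0 h0 h1 hk hn pn rp.
have ok k : (k < n.+2)%N -> row_ok (X k) (edge_row (App_edges n) X k).
  move=> kn; have [->|k0] := eqVneq k 0%N; first by rewrite (App_row0 _ n0).
  have [->|k1] := eqVneq k 1%N; first by rewrite (App_row1 _ n0).
  have [->|kn1] := eqVneq k n.+1; first by rewrite (App_rown _ n0).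
  by rewrite (App_rowk _ n0); [apply: hk|]; lia.
by split=> // k /ok[].
Qed.

Lemma App_edge_mem n k : (1 <= k <= n)%N -> (k, k.+1) \in App_edges n.
Proof.
move=> kn; rewrite inE; apply/orP; right; apply/mapP; exists k.-1.
  by rewrite mem_iota; lia.
by rewrite prednK ?modn_small //; lia.
Qed.

Lemma App_edge_last n : (n.+1, 1%N) \in App_edges n.
Proof.
rewrite inE; apply/orP; right; apply/mapP; exists n; last by rewrite modnn.
by rewrite mem_iota; lia.
Qed.

Lemma App_null_ext n : (0 < n)%N ->
  ext_pair (edge_gcm n.+2 (App_edges n)) (row_of n.+2 App_null) (inord 0).
Proof.
move=> n0; apply: (fun_ext_pair (r := 1%N)).
- exact: App_edges_simple.
- rewrite inordK //; apply: App_ext_fun => //; rewrite ?(App_row0 _ n0) //.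
  + by move=> [|k].
  + by split=> //; left.
  + by split=> //; right.
  + by move=> [|[|k]] // _; split=> //; right.
  by case: n n0 => // n _; split=> //; right.
move=> P h j; elim: j => // j IH jn _.
have [->//|j0] := eqVneq j 0%N.
rewrite -IH; [|lia|by case: j j0 {IH jn}].
by apply/esym/h; [case: j j0 {IH jn}| |apply: App_edge_mem; lia].
Qed.

Lemma arms_conn n c s l t r (P : pred nat) : (0 < n)%N -> (0 < l)%N ->
  (l + r <= n)%N -> (0 < s)%N -> (0 < t)%N -> (0 < c)%N ->
  (forall i j, arms_null n c s l t r i <> 0 -> arms_null n c s l t r j <> 0 ->
     (i, j) \in App_edges n -> P i = P j) ->
  forall j, (j < n.+2)%N -> arms_null n c s l t r j <> 0 -> P j = P 1%N.
Proof.
move=> n0 l0 lr s0 t0 c0 h.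
have left0 k : (1 <= k <= l)%N -> arms_null n c s l t r k <> 0.
  by case: k => // k kl; rewrite /arms_null; nia.
have right0 k : (n.+2 - r < k <= n.+1)%N -> arms_null n c s l t r k <> 0.
  by case: k => [|k] kl; rewrite /arms_null; [lia|nia].
have left k : (1 <= k <= l)%N -> P k = P 1%N.
  elim: k => // k IH kl; have [->//|k0] := eqVneq k 0%N.
  rewrite -IH; last by lia.
  by apply/esym/h; [apply: left0; lia|apply: left0; lia|apply: App_edge_mem; lia].
have right k : (k.+1 < r)%N -> P (n.+1 - k)%N = P 1%N.
  elim: k => [|k IH] kr.
    rewrite subn0; apply: h; [apply: right0; lia|apply: left0; lia|].
    exact: App_edge_last.
  rewrite -IH; last by lia.
  have -> : (n.+1 - k = (n.+1 - k.+1).+1)%N by lia.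
  by apply: h; [apply: right0; lia|apply: right0; lia|apply: App_edge_mem; lia].
move=> j jn j0; have [->|jn0] := eqVneq j 0%N.
  by apply: h; [rewrite /=; lia|apply: left0; lia|].
have [jl|jl] := leqP j l; first by apply: left; lia.
have -> : j = (n.+1 - (n.+1 - j))%N by lia.
apply: right; move: j0; case: j jn jn0 jl => // j jn _ jl; rewrite /arms_null.
have -> : (l.+1 - j.+1 = 0)%N by lia.
by rewrite muln0 add0n => /eqP; rewrite -lt0n muln_gt0; lia.
Qed.

Lemma App_list_ext n x : (0 < n)%N -> List.In x (App_list n) ->
  (x.2 < n.+2)%N /\
  ext_pair (edge_gcm n.+2 (App_edges n)) (row_of n.+2 x.1) (inord x.2).
Proof.
move=> n0; rewrite /App_list => -[<-|].
  by split=> //; exact: App_null_ext.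
have arms c s l t r p :
    [\/ [/\ c = 2, s = 1, l = 4, t = 1 & r = 4]%N /\ (8 <= n)%N /\ (p = 5 \/ p = n - 2)%N,
        [/\ c = 3, s = 2, l = 3, t = 1 & r = 6]%N /\ (9 <= n)%N /\ (p = n - 4)%N |
        [/\ c = 3, s = 1, l = 6, t = 2 & r = 3]%N /\ (9 <= n)%N /\ (p = 7)%N] ->
    (p < n.+2)%N /\ ext_pair (edge_gcm n.+2 (App_edges n))
      (row_of n.+2 (arms_null n c s l t r)) (inord p).
  move=> hyp; have pn : (p < n.+2)%N by move: hyp => [[_ h]|[_ h]|[_ h]]; lia.
  have big : (8 <= n)%N by move: hyp => [[_ h]|[_ h]|[_ h]]; lia.
  split=> //; apply: (fun_ext_pair (r := 1%N)).
  - exact: App_edges_simple.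
  - rewrite inordK //; apply: App_ext_fun => //.
    + by move=> [|k].
    + rewrite /row_ok /arms_null.
      by case: hyp => -[[cE sE lE tE rE] h]; subst c s l t r; split; lia.
    + rewrite /row_ok /arms_null.
      by case: hyp => -[[cE sE lE tE rE] h]; subst c s l t r; split; lia.
    + move=> [|[|k]] // kn; rewrite /row_ok /arms_null /=.
      by case: hyp => -[[cE sE lE tE rE] h]; subst c s l t r; split; lia.
    + rewrite /row_ok /arms_null; case: n n0 hyp pn big => // m _ hyp _ _.
      by case: hyp => -[[cE sE lE tE rE] h]; subst c s l t r; split; lia.
    rewrite (App_rowk _ n0); last by move: hyp => [[_ h]|[_ h]|[_ h]]; lia.
    rewrite /arms_null; case: p hyp pn => [|[|p]] hyp pn.
    + by move: hyp => [[_ h]|[_ h]|[_ h]]; lia.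
    + by move: hyp => [[_ h]|[_ h]|[_ h]]; lia.
    by case: hyp => -[[cE sE lE tE rE] h]; subst c s l t r => /=; lia.
  move=> P; apply: arms_conn => //; by case: hyp => -[[cE sE lE tE rE] h]; subst c s l t r; lia.
case: ifP => n8; case: ifP => n9 //=.
- move=> [<-|[<-|[<-|[<-|//]]]]; apply: arms.
  + by apply: Or31; split=> //; split=> //; left.
  + by apply: Or31; split=> //; split=> //; right.
  + by apply: Or32.
  by apply: Or33.
- move=> [<-|[<-|//]]; apply: arms.
  + by apply: Or31; split=> //; split=> //; left.
  by apply: Or31; split=> //; split=> //; right.
by exfalso; lia.
Qed.

Lemma row_of_neq m X Y k : (k <= m)%N -> X k != Y k ->
  row_of m.+1 X != row_of m.+1 Y.
Proof.
move=> km; apply: contraNneq => /rowP/(_ (inord k)).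
by rewrite !mxE inordK // => ->.
Qed.

Lemma App_list_uniq n : (0 < n)%N ->
  uniq [seq (row_of n.+2 x.1, inord x.2 : 'I_n.+2) | x <- App_list n].
Proof.
move=> n0.
have ne1 X Y k p q : (k <= n.+1)%N -> X k != Y k ->
    ((row_of n.+2 X, inord p : 'I_n.+2) == (row_of n.+2 Y, inord q)) = false.
  by move=> kn XY; rewrite xpair_eqE (negPf (row_of_neq kn XY)).
have ne2 X Y p q : (p <= n.+1)%N -> (q <= n.+1)%N -> p != q ->
    ((row_of n.+2 X, inord p : 'I_n.+2) == (row_of n.+2 Y, inord q)) = false.
  move=> pn qn pq; apply/negbTE; rewrite xpair_eqE negb_and; apply/orP; right.
  by rewrite -val_eqE /= !inordK.
rewrite /App_list; case: ifP => n8; case: ifP => n9 //=; last by exfalso; lia.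
  rewrite !inE !(ne1 App_null _ 0%N) //=.
  rewrite !(ne1 (arms_null n 2 _ _ _ _) (arms_null n 3 _ _ _ _) 0%N) //=.
  rewrite (ne1 (arms_null n 3 2 3 1 6) (arms_null n 3 1 6 2 3) 2%N) //; last first.
    by apply/eqP; rewrite /arms_null; lia.
  by rewrite ne2 //; lia.
by rewrite !inE !(ne1 App_null _ 0%N) //= ne2 //; lia.
Qed.

Theorem pi_mult_App (R : realType) n : (0 < n)%N ->
  pi_mult_eq R (App 1) (App n) (2 * size (App_list n)).
Proof.
move=> n0; rewrite (App_edgeE n).
apply: (pi_mult_edges R (m := n.+1) (E := App_edges n) (L := App_list n)).
- exact: App_edges_simple.
- exact: App_list_uniq.
- by move=> x; exact: App_list_ext.
by move=> X p; exact: App_enum.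
Qed.

(** * The pairs in D_n^{++} *)

Definition Dpp_edges n : seq (nat * nat) :=
  [:: (0, 1); (1, 3); (n.-1, n.+1)]%N ++ [seq (i.+1, i.+2) | i <- iota 1 n.-2].

Lemma Dpp_edgeE n : (2 <= n)%N -> Dpp n = edge_gcm n.+2 (Dpp_edges n).
Proof.
case: n => [|[|n]] // _; rewrite /Dpp /affD overext_edge /Dpp_edges /=.
by rewrite -map_comp.
Qed.

Lemma Dpp_edges_simple n : (4 <= n)%N -> simple_edges n.+2 (Dpp_edges n).
Proof.
move=> n4; rewrite /simple_edges all_cat; apply/andP; split.
  by rewrite /=; lia.
apply/allP => _ /mapP[i + ->] /=; rewrite mem_iota; lia.
Qed.

(* The null root of the subdiagram of type D_n(1). *)
Definition D_null n (k : nat) : int :=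
  if k is 0 then 0 else if ((k < 3) || (n <= k))%N then 1 else 2.

(* The null root of the subdiagram of type E8(1). *)
Definition D_E8_null (k : nat) : int :=
  match k with 0 => 2 | 1 => 4 | 2 => 3 | _ => (9 - k)%N%:Z end.

(** The tail of E_8^{(1)} ends at vertex 8 with coordinate 1. For n = 9 this is the fork, and both
    tips 9 and 10 can serve as [p]; for larger n its only further neighbour is 9. *)
Definition Dpp_list n : seq ((nat -> int) * nat) :=
  (D_null n, 0%N) ::
  (if (n == 9)%N then [:: (D_E8_null, 9); (D_E8_null, 10)]%N
   else if (10 <= n)%N then [:: (D_E8_null, 9%N)] else [::]).

Section DppRows.
Variables (n : nat) (X : nat -> int).
Notation r := (edge_row (Dpp_edges n) X).

Lemma Dpp_row j : (4 <= n)%N -> r j =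
  2 * X j - ((j == 0%N)%:R * X 1%N + (j == 1%N)%:R * X 0%N)
  - ((j == 1%N)%:R * X 3%N + (j == 3%N)%:R * X 1%N)
  - ((j == n.-1)%:R * X n.+1 + (j == n.+1)%:R * X n.-1)
  - (if (2 <= j < n)%N then X j.+1 else 0)
  - (if (3 <= j < n.+1)%N then X j.-1 else 0).
Proof.
move=> n4; rewrite /edge_row big_cat !big_cons big_nil big_map /=.
rewrite (eq_bigr (fun i => (i + 1 == j)%N%:R * X i.+2 +
  (i + 2 == j)%N%:R * X i.+1)); last by move=> i _; rewrite addn1 addn2.
rewrite big_split /= !sum_iota_pick !(eq_sym _ j).
have -> : (if (1 + 1 <= j < 1 + n.-2 + 1)%N then X (j - 1).+2 else 0) =
          (if (2 <= j < n)%N then X j.+1 else 0).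
  have -> : (1 + 1 <= j < 1 + n.-2 + 1)%N = (2 <= j < n)%N by lia.
  by case: ifP => // h; congr X; lia.
have -> : (if (1 + 2 <= j < 1 + n.-2 + 2)%N then X (j - 2).+1 else 0) =
          (if (3 <= j < n.+1)%N then X j.-1 else 0).
  have -> : (1 + 2 <= j < 1 + n.-2 + 2)%N = (3 <= j < n.+1)%N by lia.
  by case: ifP => // h; congr X; lia.
ring.
Qed.

(** For n = 4 the branch vertices 3 and n - 1 coincide; that diagram is treated with the exceptional
    ones. *)
Hypothesis n5 : (5 <= n)%N.

Let n4 : (4 <= n)%N. Proof. lia. Qed.

Lemma Dpp_row0 : r 0 = 2 * X 0%N - X 1%N.
Proof.
rewrite Dpp_row //; have -> : (0%N == n.-1) = false by lia.
rewrite /=; lia.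
Qed.

Lemma Dpp_row1 : r 1 = 2 * X 1%N - X 0%N - X 3%N.
Proof.
rewrite Dpp_row //; have -> : (1%N == n.-1) = false by lia.
have -> : (1%N == n.+1) = false by lia.
rewrite /=; lia.
Qed.

Lemma Dpp_row2 : r 2 = 2 * X 2%N - X 3%N.
Proof.
rewrite Dpp_row //; have -> : (2%N == n.-1) = false by lia.
have -> : (2%N == n.+1) = false by lia.
have -> : (2 <= 2 < n)%N by lia.
rewrite /=; lia.
Qed.

Lemma Dpp_row3 : r 3 = 2 * X 3%N - X 1%N - X 2%N - X 4%N.
Proof.
rewrite Dpp_row //; have -> : (3%N == n.-1) = false by lia.
have -> : (3%N == n.+1) = false by lia.
have -> : (2 <= 3 < n)%N by lia.
have -> : (3 <= 3 < n.+1)%N by lia.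
rewrite /=; lia.
Qed.

Lemma Dpp_rowk k : (4 <= k <= n - 2)%N -> r k = 2 * X k - X k.-1 - X k.+1.
Proof.
move=> kn; rewrite Dpp_row //; have -> : (k == n.-1) = false by lia.
have -> : (k == n.+1) = false by lia.
have -> : (k == 0)%N = false by lia.
have -> : (k == 1)%N = false by lia.
have -> : (k == 3)%N = false by lia.
have -> : (2 <= k < n)%N by lia.
have -> : (3 <= k < n.+1)%N by lia.
rewrite /=; lia.
Qed.

Lemma Dpp_row_branch : r n.-1 = 2 * X n.-1 - X n.-2 - X n - X n.+1.
Proof.
rewrite Dpp_row // eqxx; have -> : (n.-1 == n.+1) = false by lia.
have -> : (n.-1 == 0)%N = false by lia.
have -> : (n.-1 == 1)%N = false by lia.
have -> : (n.-1 == 3)%N = false by lia.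
have -> : (2 <= n.-1 < n)%N by lia.
have -> : (3 <= n.-1 < n.+1)%N by lia.
rewrite prednK; last by lia.
rewrite /=; lia.
Qed.

Lemma Dpp_rown : r n = 2 * X n - X n.-1.
Proof.
rewrite Dpp_row //; have -> : (n == n.-1) = false by lia.
have -> : (n == n.+1) = false by lia.
have -> : (n == 0)%N = false by lia.
have -> : (n == 1)%N = false by lia.
have -> : (n == 3)%N = false by lia.
have -> : (2 <= n < n)%N = false by lia.
have -> : (3 <= n < n.+1)%N by lia.
rewrite /=; lia.
Qed.

Lemma Dpp_rowSn : r n.+1 = 2 * X n.+1 - X n.-1.
Proof.
rewrite Dpp_row // eqxx; have -> : (n.+1 == n.-1) = false by lia.
have -> : (n.+1 == 0)%N = false by lia.
have -> : (n.+1 == 1)%N = false by lia.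
have -> : (n.+1 == 3)%N = false by lia.
have -> : (2 <= n.+1 < n)%N = false by lia.
have -> : (3 <= n.+1 < n.+1)%N = false by lia.
rewrite /=; lia.
Qed.

Definition Dpp_rows := (Dpp_row0, Dpp_row1, Dpp_row2, Dpp_row3, Dpp_row_branch,
  Dpp_rown, Dpp_rowSn).

End DppRows.

Lemma Dpp_row_cases n k : (5 <= n)%N -> (k <= n.+1)%N ->
  k = 0%N \/ k = 1%N \/ k = 2%N \/ k = 3%N \/ (4 <= k <= n - 2)%N \/ k = n.-1 \/
  k = n \/ k = n.+1.
Proof. lia. Qed.

Lemma Dpp_enum n X p : (5 <= n)%N -> ext_fun n.+2 (Dpp_edges n) X p ->
  exists2 x, List.In x (Dpp_list n) & p = x.2 /\ forall k, (k <= n.+1)%N -> X k = x.1 k.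
Proof.
move=> n5 [X_ge0 r_le0 X_supp p_lt r_p].
have rows := Dpp_rows X n5.
have rk := @Dpp_rowk n X n5.
have [h0 h1 h2 h3] : [/\ 0 <= X 0%N, 0 <= X 1%N, 0 <= X 2%N & 0 <= X 3%N].
  by split; apply: X_ge0; lia.
have [l0 l1 l2 l3] : [/\ 2 * X 0%N - X 1%N <= 0, 2 * X 1%N - X 0%N - X 3%N <= 0,
    2 * X 2%N - X 3%N <= 0 & 2 * X 3%N - X 1%N - X 2%N - X 4%N <= 0].
  by rewrite -!rows; split; apply: r_le0; lia.
have [lb ln ln1] : [/\ 2 * X n.-1 - X n.-2 - X n - X n.+1 <= 0,
    2 * X n - X n.-1 <= 0 & 2 * X n.+1 - X n.-1 <= 0].
  by rewrite -!rows; split; apply: r_le0; lia.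
have Xp : X p = 0 by case: (X_supp p p_lt) => //; rewrite r_p.
have [X00|X0n] := eqVneq (X 0%N) 0.
  (* Slopes are nondecreasing along the chain from 3 to n - 1; the rows at the two forks make the
     first one >= 0 and the last one <= 0, so the chain is flat. *)
  have slope k : (3 <= k <= n - 2)%N -> X 4%N - X 3%N <= X k.+1 - X k.
    elim: k => // k IH kn; have [<-//|k3] := eqVneq 3%N k.+1.
    have := rk k.+1 ltac:(lia); have := r_le0 k.+1 ltac:(lia).
    by have := IH ltac:(lia); rewrite /=; lia.
  have slope2 k : (k <= n - 5)%N -> X (n - 2 - k).+1 - X (n - 2 - k)%N <= X n.-1 - X n.-2.
    elim: k => [|k IH] nk.
      have -> : (n - 2 - 0 = n.-2)%N by lia.
      by have -> : (n.-2.+1 = n.-1)%N by lia.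
    have nkE : ((n - 2 - k.+1).+1 = n - 2 - k)%N by lia.
    have prE : ((n - 2 - k).-1 = n - 2 - k.+1)%N by lia.
    have := rk (n - 2 - k)%N ltac:(lia); have := r_le0 (n - 2 - k)%N ltac:(lia).
    by have := IH ltac:(lia); rewrite nkE prE; lia.
  have flat k : (3 <= k <= n - 2)%N -> X k.+1 = X k.
    move=> kn; have := slope k kn; have := slope2 (n - 2 - k)%N ltac:(lia).
    rewrite subKn; last by lia.
    by lia.
  have XE k : (3 <= k <= n.-1)%N -> X k = X 3%N.
    elim: k => // k IH kn; have [<-//|k3] := eqVneq 3%N k.+1.
    by rewrite flat; [apply: IH|]; lia.
  have X4 := XE 4%N ltac:(lia); have Xb := XE n.-1 ltac:(lia).
  have Xb2 := XE n.-2 ltac:(lia).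
  have X12 : X 2%N = X 1%N /\ X 3%N = 2 * X 1%N by lia.
  have Xn : X n = X 1%N /\ X n.+1 = X 1%N by rewrite Xb Xb2 in lb ln ln1; lia.
  have p0 : p = 0%N.
    move: r_p.
    have [->//|[->|[->|[->|[pk|[->|[->|->]]]]]]] := Dpp_row_cases n5 p_lt;
      try by rewrite rows ?Xb ?Xb2; lia.
    by rewrite rk // (XE p) ?(XE p.-1) ?(XE p.+1); lia.
  have X1 : X 1%N = 1 by move: r_p; rewrite p0 rows; lia.
  exists (D_null n, 0%N); first by left.
  split=> // k kn /=; rewrite /D_null.
  have [->|[->|[->|[->|[pk|[->|[->|->]]]]]]] := Dpp_row_cases n5 kn; rewrite //=; try lia.
  - by case: ifP; lia.
  - by case: (k) pk => [|k'] pk //; rewrite XE; [case: ifP; lia|lia].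
  - by rewrite Xb; case: (n) n5 => [|[|m]] // m5 /=; case: ifP; lia.
  - by case: (n) n5 Xn => [|m] // m5 Xn; rewrite leqnn orbT; lia.
  by rewrite leqnSn orbT; lia.
have supp_row k : (k <= n.+1)%N -> X k <> 0 -> edge_row (Dpp_edges n) X k = 0.
  by move=> kn; case: (X_supp k kn).
have X1 : 2 * X 0%N - X 1%N = 0 by rewrite -rows; apply: supp_row; lia.
have X3 : 2 * X 1%N - X 0%N - X 3%N = 0 by rewrite -rows; apply: supp_row; lia.
have X4 : 2 * X 3%N - X 1%N - X 2%N - X 4%N = 0.
  by rewrite -rows; apply: supp_row; lia.
have X2 : X 2%N = 0 \/ 2 * X 2%N - X 3%N = 0 by rewrite -rows; apply: X_supp; lia.
have Xb : X n.-1 <> 0 -> 2 * X n.-1 - X n.-2 - X n - X n.+1 = 0.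
  by rewrite -rows; apply: supp_row; lia.
have Xn : X n = 0 \/ 2 * X n - X n.-1 = 0 by rewrite -rows; apply: X_supp; lia.
have Xn1 : X n.+1 = 0 \/ 2 * X n.+1 - X n.-1 = 0 by rewrite -rows; apply: X_supp; lia.
have bsE : n.-2.+1 = n.-1 by lia.
have [bn cn cn1] : [/\ 0 <= X n.-1, 0 <= X n & 0 <= X n.+1].
  by split; apply: X_ge0; lia.
(* An increase would persist up to the fork, where X n and X n.+1 are each at most half of X n.-1
   and cannot balance it. *)
have steep k : (3 <= k <= n - 2)%N -> 0 <= X k -> X k < X k.+1 -> False.
  move=> kn Xk Xk1; have [||||p1 p2] := increasing_run (X := X) (i := k) (j := n.-1) _ _ _ (k := n.-2).
  - move=> l kl; case: (X_supp l) => [|->|]; [lia|by left|].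
    by rewrite rk; [right; lia|lia].
  - by [].
  - by [].
  - lia.
  by rewrite bsE in p2; have := Xb ltac:(lia); lia.
(* If X 2 = 0, the equations give X 3 = 3 X 0 and X 4 = 4 X 0, an increase. *)
have X2n : X 2%N <> 0.
  by move=> X20; apply: (steep 3%N); lia.
have {}X2 : 2 * X 2%N = X 3%N by lia.
pose b := X 2%N - X 0%N.
have [b0 E0 E1 E2] : [/\ 0 < b, X 0%N = 2 * b, X 1%N = 4 * b & X 2%N = 3 * b].
  by rewrite /b; split; lia.
(* From vertex 3 on the coordinates are 6 b, 5 b, 4 b, ..., until they reach 0 at vertex 9 or meet
   the fork. *)
have desc k : (3 <= k <= n - 2)%N -> (k <= 8)%N ->
    X k = (9 - k)%N%:Z * b /\ X k.+1 = (8 - k)%N%:Z * b.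
  elim: k => // k IH kn k8; have [<-|k3] := eqVneq 3%N k.+1; first by lia.
  have [e1 e2] := IH ltac:(lia) ltac:(lia).
  have Xk1 : X k.+1 <> 0.
    rewrite e2; have := mulr_ge0 (ltac:(lia) : 0 <= (8 - k)%N%:Z - 1) (ltW b0); lia.
  have := supp_row k.+1 ltac:(lia) Xk1; rewrite rk /=; last by lia.
  have -> : (9 - k.+1 = 8 - k)%N by lia.
  rewrite e1 e2 => h; split=> //.
  have c9 : (9 - k)%N%:Z = (8 - k.+1)%N%:Z + 2 by lia.
  have c8 : (8 - k)%N%:Z = (8 - k.+1)%N%:Z + 1 by lia.
  move: h; rewrite c9 c8; set u := (8 - k.+1)%N%:Z; set y := X k.+2.
  by rewrite !mulrDl; set v := u * b; lia.
have small k : (3 <= k <= 8)%N -> (k <= n.-1)%N -> X k = (9 - k)%N%:Z * b.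
  move=> k38 kn; have [kn'|kn'] := leqP k (n - 2); first by have [] := desc k; lia.
  have k1 : k = k.-1.+1 by lia.
  have [_] := desc k.-1 ltac:(lia) ltac:(lia).
  by rewrite -k1 => ->; congr (_%:Z * _); lia.
have [n9|n9] := ltnP n 10.
  have xb := small n.-1 ltac:(lia) (leqnn _).
  have xb2 := small n.-2; have {}Xb := Xb ltac:(nia).
  have [n8|n8] := ltnP n 9.
    have nE : n = 5%N \/ n = 6%N \/ n = 7%N \/ n = 8%N by lia.
    case: nE => [nE|[nE|[nE|nE]]]; subst n; rewrite /= in xb Xb Xn Xn1 ln ln1;
      have := small 3%N isT isT; have := small 4%N isT isT; rewrite /= in xb2 *;
      try (have := xb2 isT isT); try lia.
    move=> e7 e4 e3.
    (* Only n = 8 is left: here E_8^{(1)} does fit, using one tip of the fork, but the pairing at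
       the other tip is -2 b, never -1. *)
    have p89 : p = 8%N \/ p = 9%N.
      move: Xp; have := small 5%N isT isT; have := small 6%N isT isT.
      by case: (p) p_lt => [|[|[|[|[|[|[|[|[|[|q]]]]]]]]]] // _; lia.
    have := rows; rewrite /Dpp_rows /= => rows8.
    by case: p89 => pE; move: r_p; rewrite pE rows8 /=; lia.
  have n9' : n = 9%N by lia.
  subst n; rewrite /= in xb xb2 Xb Xn Xn1 *.
  have e8 := xb2 isT isT.
  have X9 : X 9%N = 0 by lia.
  have X10 : X 10%N = 0 by lia.
  have small3 := small 3%N isT isT; have small4 := small 4%N isT isT.
  have small5 := small 5%N isT isT; have small6 := small 6%N isT isT.
  have pE : p = 9%N \/ p = 10%N.
    by case: (p) Xp p_lt => [|[|[|[|[|[|[|[|[|[|[|q]]]]]]]]]]] //; lia.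
  have b1 : b = 1.
    by case: pE => pE; move: r_p; rewrite pE rows /=; lia.
  exists (D_E8_null, p).
    by rewrite /Dpp_list /=; case: pE => ->; [right; left|right; right; left].
  split=> // k; case: k => [|[|[|[|[|[|[|[|[|[|[|k]]]]]]]]]]] // _ /=; lia.
have X8 : X 8%N = b by rewrite small; lia.
have X9 : X 9%N = 0 by have [] := desc 8%N; lia.
have zero k : (9 <= k <= n.-1)%N -> X k = 0.
  elim: k => // k IH kn; have [<-//|k9] := eqVneq 9%N k.+1.
  have Xk : X k = 0 by apply: IH; lia.
  have [//|/eqP Xk1] := eqVneq (X k.+1) 0.
  by case: (steep k); rewrite ?Xk; have := X_ge0 k.+1 ltac:(lia); lia.
have zb := zero n.-1 ltac:(lia).
have zn : X n = 0 by lia.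
have zn1 : X n.+1 = 0 by lia.
have zero' k : (9 <= k <= n.+1)%N -> X k = 0.
  move=> kn; have [->//|kn1] := eqVneq k n.+1; have [->//|kn2] := eqVneq k n.
  by apply: zero; lia.
have p9 : (9 <= p)%N.
  rewrite leqNgt; apply/negP => p8; have := small p.
  by case: (p) Xp p8 => [|[|[|[|[|[|[|[|[|q]]]]]]]]] //; lia.
have [pE|pne] := eqVneq p 9%N; last first.
  move: r_p; have [pn1|pn1] := eqVneq p n.+1; first by rewrite pn1 rows; lia.
  have [pn|pn] := eqVneq p n; first by rewrite pn rows; lia.
  have [pb|pb] := eqVneq p n.-1.
    by rewrite pb rows (zero' n.-2); lia.
  by rewrite rk ?(zero' p.-1) ?(zero' p) ?(zero' p.+1); lia.
have b1 : b = 1.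
  move: r_p; rewrite pE; have [nb|nb] := eqVneq 9%N n.-1.
    have n8 : n.-2 = 8%N by lia.
    by rewrite {1}nb rows n8; lia.
  by rewrite rk /= ?(zero' 10%N); lia.
exists (D_E8_null, p).
  rewrite /Dpp_list; have -> : (n == 9)%N = false by lia.
  by rewrite n9 pE; right; left.
split=> // k kn; have [k9|k9] := leqP 9%N k.
  rewrite zero'; last by lia.
  by case: k k9 kn => [|[|[|k]]] // k9 kn /=; lia.
case: k k9 kn => [|[|[|k]]] k9 kn; [by rewrite /=; lia..|].
by rewrite small ?b1 ?mulr1 /=; lia.
Qed.

Lemma Dpp_ext_fun n X p : (5 <= n)%N -> (forall k, (k <= n.+1)%N -> 0 <= X k) ->
  row_ok (X 0%N) (2 * X 0%N - X 1%N) ->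
  row_ok (X 1%N) (2 * X 1%N - X 0%N - X 3%N) ->
  row_ok (X 2%N) (2 * X 2%N - X 3%N) ->
  row_ok (X 3%N) (2 * X 3%N - X 1%N - X 2%N - X 4%N) ->
  (forall k, (4 <= k <= n - 2)%N -> row_ok (X k) (2 * X k - X k.-1 - X k.+1)) ->
  row_ok (X n.-1) (2 * X n.-1 - X n.-2 - X n - X n.+1) ->
  row_ok (X n) (2 * X n - X n.-1) -> row_ok (X n.+1) (2 * X n.+1 - X n.-1) ->
  (p <= n.+1)%N -> edge_row (Dpp_edges n) X p = -1 ->
  ext_fun n.+2 (Dpp_edges n) X p.
Proof.
move=> n5 X0 h0 h1 h2 h3 hk hb hn hn1 pn rp.
have ok k : (k < n.+2)%N -> row_ok (X k) (edge_row (Dpp_edges n) X k).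
  move=> /(Dpp_row_cases n5)[->|[->|[->|[->|[kn|[->|[->|->]]]]]]];
    rewrite ?(Dpp_rows X n5) //.
  by rewrite (Dpp_rowk X n5 kn); exact: hk.
by split=> // k /ok[].
Qed.

Lemma Dpp_edge_mem n k : (2 <= k < n)%N -> (k, k.+1) \in Dpp_edges n.
Proof.
move=> kn; rewrite mem_cat; apply/orP; right; apply/mapP; exists k.-1.
  by rewrite mem_iota; lia.
by rewrite prednK //; lia.
Qed.

Lemma D_null_conn n (P : pred nat) : (4 <= n)%N ->
  (forall i j, D_null n i <> 0 -> D_null n j <> 0 -> (i, j) \in Dpp_edges n ->
     P i = P j) ->
  forall j, (j < n.+2)%N -> D_null n j <> 0 -> P j = P 3%N.
Proof.
move=> n4 h.
have nz k : (0 < k)%N -> D_null n k <> 0.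
  by case: k => // k _; rewrite /D_null; case: ifP.
have chain k : (3 <= k <= n)%N -> P k = P 3%N.
  elim: k => // k IH kn; have [<-//|k3] := eqVneq 3%N k.+1.
  rewrite -IH; last by lia.
  by apply/esym/h; [apply: nz; lia|apply: nz; lia|apply: Dpp_edge_mem; lia].
move=> j jn Xj; have [j0|j0] := eqVneq j 0%N; first by rewrite j0 in Xj.
have [->|j1] := eqVneq j 1%N.
  by apply: h; [apply: nz|apply: nz|rewrite mem_cat !inE].
have [->|j2] := eqVneq j 2%N.
  by apply: h; [apply: nz|apply: nz|apply: Dpp_edge_mem; lia].
have [->|jn1] := eqVneq j n.+1; last by apply: chain; lia.
rewrite -(chain n.-1); last by lia.
by apply/esym/h; [apply: nz; lia|apply: nz|rewrite mem_cat !inE eqxx !orbT].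
Qed.

Lemma D_E8_conn n (P : pred nat) : (9 <= n)%N ->
  (forall i j, D_E8_null i <> 0 -> D_E8_null j <> 0 -> (i, j) \in Dpp_edges n ->
     P i = P j) ->
  forall j, (j < n.+2)%N -> D_E8_null j <> 0 -> P j = P 3%N.
Proof.
move=> n9 h.
have chain k : (3 <= k <= 8)%N -> P k = P 3%N.
  elim: k => // k IH kn; have [<-//|k3] := eqVneq 3%N k.+1.
  rewrite -IH; last by lia.
  apply/esym/h; last by apply: Dpp_edge_mem; lia.
    by case: k kn k3 {IH} => [|[|[|k]]] //= kn _; lia.
  by case: k kn k3 {IH} => [|[|k]] //= kn _; lia.
have P1 : P 1%N = P 3%N by apply: h; [apply/eqP|apply/eqP|rewrite mem_cat !inE].
have P0 : P 0%N = P 1%N by apply: h; [apply/eqP|apply/eqP|rewrite mem_cat !inE].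
have P2 : P 2%N = P 3%N.
  by apply: h; [apply/eqP|apply/eqP|apply: Dpp_edge_mem; lia].
case=> [|[|[|j]]] jn; rewrite ?P0 // => Xj.
by apply: chain; move: Xj; rewrite /=; lia.
Qed.

Lemma Dpp_list_ext n x : (5 <= n)%N -> List.In x (Dpp_list n) ->
  (x.2 < n.+2)%N /\
  ext_pair (edge_gcm n.+2 (Dpp_edges n)) (row_of n.+2 x.1) (inord x.2).
Proof.
move=> n5; have n4 : (4 <= n)%N by lia.
have E8 p : (9 <= n)%N -> p = 9%N \/ n = 9%N /\ p = 10%N ->
    (p < n.+2)%N /\
    ext_pair (edge_gcm n.+2 (Dpp_edges n)) (row_of n.+2 D_E8_null) (inord p).
  move=> n9 hp; have pn : (p < n.+2)%N by lia.
  have E k : (3 <= k)%N -> D_E8_null k = (9 - k)%N%:Z by case: k => [|[|[|k]]].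
  split=> //; apply: (fun_ext_pair (r := 3%N)).
  - exact: Dpp_edges_simple.
  - rewrite inordK //; apply: Dpp_ext_fun => //.
    + by move=> [|[|[|k]]].
    + by split=> //; right.
    + by split=> //; right.
    + by split=> //; right.
    + by split=> //; right.
    + by move=> k kn; rewrite /row_ok !E; lia.
    + by rewrite /row_ok !E; lia.
    + by rewrite /row_ok !E; lia.
    + by rewrite /row_ok !E; lia.
    case: hp => [->|[-> ->]].
      have [n9'|n9'] := eqVneq n 9%N; first by rewrite -{1}n9' (Dpp_rown _ n5) n9'.
      have [n10|n10] := eqVneq n 10%N; first by rewrite n10 (Dpp_row_branch (n := 10) _ isT).
      by rewrite Dpp_rowk //; lia.
    by rewrite (Dpp_rowSn (n := 9) _ isT).
  by move=> P; apply: D_E8_conn.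
rewrite /Dpp_list => -[<-|].
  split=> //; change (ext_pair (edge_gcm n.+2 (Dpp_edges n))
    (row_of n.+2 (D_null n)) (inord 0)).
  apply: (fun_ext_pair (r := 3%N)).
  - exact: Dpp_edges_simple.
  - have N k : (0 < k)%N -> D_null n k = if ((k < 3) || (n <= k))%N then 1 else 2.
      by case: k.
    have N2 k : (3 <= k < n)%N -> D_null n k = 2.
      by move=> kn; rewrite N; [case: ifP; lia|lia].
    have N1 : [/\ D_null n 1%N = 1, D_null n 2%N = 1, D_null n n = 1 & D_null n n.+1 = 1].
      by split; rewrite N //; try (by lia); case: ifP; lia.
    case: N1 => [N1 N1' Nn Nn1]; have N0 : D_null n 0%N = 0 by [].
    have [N3 N4 Nb Nb2] : [/\ D_null n 3%N = 2, D_null n 4%N = 2, D_null n n.-1 = 2 &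
      D_null n n.-2 = 2] by split; apply: N2; lia.
    rewrite inordK //; apply: Dpp_ext_fun => //; rewrite ?N0 ?N1 ?N1' ?N3 ?N4 ?Nb ?Nb2 ?Nn ?Nn1;
      try (by split=> //; right).
    + by move=> [|k] // _; rewrite N //; case: ifP.
    + by split=> //; left.
    + by move=> k kn; rewrite !N2; [split=> //; right| | |]; lia.
    by rewrite (Dpp_row0 _ n5) N1.
  by move=> P; exact: D_null_conn.
case: ifP => [/eqP n9|n9] /=.
  by move=> [<-|[<-|//]]; [apply: (E8 9%N)|apply: (E8 10%N)]; rewrite ?n9 //; tauto.
by case: ifP => //= n10 [<-|//]; apply: (E8 9%N); [lia|left].
Qed.

Lemma Dpp_list_uniq n : (5 <= n)%N ->
  uniq [seq (row_of n.+2 x.1, inord x.2 : 'I_n.+2) | x <- Dpp_list n].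
Proof.
move=> n5.
have ne1 p q : ((row_of n.+2 (D_null n), inord p : 'I_n.+2) ==
    (row_of n.+2 D_E8_null, inord q)) = false.
  by rewrite xpair_eqE (negPf (row_of_neq (k := 0) _ _)).
rewrite /Dpp_list; case: ifP => [/eqP n9|_]; last first.
  by case: ifP => //= _; rewrite inE ne1.
rewrite /= !inE !ne1 /= andbT xpair_eqE negb_and; apply/orP; right.
by rewrite -val_eqE /= !inordK // n9.
Qed.

Theorem pi_mult_Dpp (R : realType) n : (5 <= n)%N ->
  pi_mult_eq R (App 1) (Dpp n) (2 * size (Dpp_list n)).
Proof.
move=> n5; rewrite Dpp_edgeE; last by lia.
apply: (pi_mult_edges R (m := n.+1) (E := Dpp_edges n) (L := Dpp_list n)).
- by apply: Dpp_edges_simple; lia.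
- exact: Dpp_list_uniq.
- by move=> x; exact: Dpp_list_ext.
by move=> X p; exact: Dpp_enum.
Qed.

(** * D_4^{++} and the exceptional diagrams *)

Lemma pi_mult_single (R : realType) m E (Y : nat -> int) :
  simple_edges m.+1 E -> ext_fun m.+1 E Y 0 ->
  (exists r, forall P : pred nat,
    (forall i j, Y i != 0 -> Y j != 0 -> (i, j) \in E -> P i = P j) ->
    forall j, (j < m.+1)%N -> Y j != 0 -> P j = P r) ->
  (forall X p, ext_fun m.+1 E X p -> p = 0%N /\ forall k, (k <= m)%N -> X k = Y k) ->
  pi_mult_eq R (App 1) (edge_gcm m.+1 E) 2.
Proof.
move=> sE eY [r cY] uY.
apply: (pi_mult_edges R (L := [:: (Y, 0%N)])) => //.
- move=> _ [<-|//]; split=> //; apply: (fun_ext_pair (r := r)) => //.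
    by rewrite inordK.
  move=> P h j jm /eqP Yj; apply: cY => // i k /eqP Yi /eqP Yk; exact: h.
by move=> X p /uY[-> XE]; exists (Y, 0%N); first by left.
Qed.

Definition list_null (s : seq nat) (k : nat) : int := (nth 0%N s k)%:Z.

Lemma pi_mult_single_list (R : realType) m E (s : seq nat) r :
  simple_edges m.+1 E ->
  all (fun k => (edge_row E (list_null s) k <= 0) &&
     ((list_null s k == 0) || (edge_row E (list_null s) k == 0))) (iota 0 m.+1) ->
  edge_row E (list_null s) 0 = -1 ->
  (forall P : pred nat,
    (forall i j, (i, j) \in [seq e <- E | (nth 0%N s e.1 != 0%N) && (nth 0%N s e.2 != 0%N)] ->
       P i = P j) ->
    forall j, (j < m.+1)%N -> nth 0%N s j != 0%N -> P j = P r) ->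
  (forall X p, ext_fun m.+1 E X p ->
     p = 0%N /\ forall k, (k <= m)%N -> X k = list_null s k) ->
  pi_mult_eq R (App 1) (edge_gcm m.+1 E) 2.
Proof.
move=> sE /allP aY Y0 cY; apply: pi_mult_single => //; last first.
  exists r => P h; apply: cY => i j; rewrite mem_filter => /andP[/andP[si sj]].
  exact: h.
have {}aY k : (k < m.+1)%N -> edge_row E (list_null s) k <= 0 /\
    (list_null s k = 0 \/ edge_row E (list_null s) k = 0).
  move=> km; have /andP[-> /orP[]/eqP h] := aY k (ltac:(by rewrite mem_iota)).
    by split=> //; left.
  by split=> //; right.
by split=> // k /aY[].
Qed.

Definition E6_edges := (0, 1)%N :: [seq (e.1.+1, e.2.+1) | e <-
  [:: (0, 2); (1, 3); (3, 4); (2, 4); (4, 5); (5, 6)]%N].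
Definition E7_edges := (0, 1)%N :: [seq (e.1.+1, e.2.+1) | e <-
  [:: (0, 1); (1, 3); (3, 4); (2, 4); (4, 5); (5, 6); (6, 7)]%N].
Definition E8_edges := (0, 1)%N :: [seq (e.1.+1, e.2.+1) | e <-
  [:: (0, 8); (1, 3); (3, 4); (2, 4); (4, 5); (5, 6); (6, 7); (7, 8)]%N].

Lemma E6pp_edgeE : E6pp = edge_gcm 8 E6_edges.
Proof. exact: overext_edge. Qed.
Lemma E7pp_edgeE : E7pp = edge_gcm 9 E7_edges.
Proof. exact: overext_edge. Qed.
Lemma E8pp_edgeE : E8pp = edge_gcm 10 E8_edges.
Proof. exact: overext_edge. Qed.

(** Unfolds the conditions at the vertices k, ..., m - 1 into linear facts for [lia]. *)
Ltac edge_facts h k m :=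
  lazymatch k with
  | m => idtac
  | _ => let g := fresh "g" in let l := fresh "l" in let s := fresh "s" in
    have g := ef_ge0 h (k := k) isT; have l := ef_le0 h (k := k) isT;
    have s := ef_supp h (k := k) isT;
    rewrite /edge_row !big_cons big_nil /= !(mul0r, mul1r, addr0, add0r) in l s;
    edge_facts h constr:(S k) m
  end.

Ltac last_vertex h := let pm := fresh "pm" in let rp := fresh "rp" in
  have pm := ef_p h; have rp := ef_m1 h;
  match type of pm with is_true (?p < _)%N => move: pm rp; clear h;
    do 10?[case: p => [|p] /=]; rewrite /edge_row !big_cons big_nil /=
      !(mul0r, mul1r, addr0, add0r) => pm rp end.

Definition E6_null : seq nat := [:: 0; 1; 1; 2; 2; 3; 2; 1]%N.
Definition E7_null : seq nat := [:: 0; 1; 2; 2; 3; 4; 3; 2; 1]%N.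
Definition E8_null : seq nat := [:: 0; 1; 2; 3; 4; 6; 5; 4; 3; 2]%N.
Definition D4_null : seq nat := [:: 0; 1; 1; 2; 1; 1]%N.

Lemma D4_enum X p : ext_fun 6 (Dpp_edges 4) X p ->
  p = 0%N /\ forall k, (k <= 5)%N -> X k = list_null D4_null k.
Proof.
move=> h; edge_facts h 0%N 6%N.
have X0 : X 0%N = 0 by lia.
have X2 : X 2%N = X 1%N by lia.
have X3 : X 3%N = 2 * X 1%N by lia.
have X4 : X 4%N = X 1%N by lia.
have X5 : X 5%N = X 1%N by lia.
clear - h X0 X2 X3 X4 X5.
have [p0 X1] : p = 0%N /\ X 1%N = 1 by last_vertex h; lia.
split=> // -[|[|[|[|[|[|k]]]]]] // _; rewrite /list_null /=; lia.
Qed.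

Lemma E6_enum X p : ext_fun 8 E6_edges X p ->
  p = 0%N /\ forall k, (k <= 7)%N -> X k = list_null E6_null k.
Proof.
move=> h; edge_facts h 0%N 8%N.
have X0 : X 0%N = 0 by lia.
have X2 : X 2%N = X 1%N by lia.
have X3 : X 3%N = 2 * X 1%N by lia.
have X4 : X 4%N = 2 * X 1%N by lia.
have X5 : X 5%N = 3 * X 1%N by lia.
have X6 : X 6%N = 2 * X 1%N by lia.
have X7 : X 7%N = X 1%N by lia.
clear - h X0 X2 X3 X4 X5 X6 X7.
have [p0 X1] : p = 0%N /\ X 1%N = 1 by last_vertex h; lia.
split=> // -[|[|[|[|[|[|[|[|k]]]]]]]] // _; rewrite /list_null /=; lia.
Qed.

Lemma E7_enum X p : ext_fun 9 E7_edges X p ->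
  p = 0%N /\ forall k, (k <= 8)%N -> X k = list_null E7_null k.
Proof.
move=> h; edge_facts h 0%N 9%N.
have X0 : X 0%N = 0 by lia.
have X2 : X 2%N = 2 * X 1%N by lia.
have X3 : X 3%N = 2 * X 1%N by lia.
have X4 : X 4%N = 3 * X 1%N by lia.
have X5 : X 5%N = 4 * X 1%N by lia.
have X6 : X 6%N = 3 * X 1%N by lia.
have X7 : X 7%N = 2 * X 1%N by lia.
have X8 : X 8%N = X 1%N by lia.
clear - h X0 X2 X3 X4 X5 X6 X7 X8.
have [p0 X1] : p = 0%N /\ X 1%N = 1 by last_vertex h; lia.
split=> // -[|[|[|[|[|[|[|[|[|k]]]]]]]]] // _; rewrite /list_null /=; lia.
Qed.

Lemma E8_enum X p : ext_fun 10 E8_edges X p ->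
  p = 0%N /\ forall k, (k <= 9)%N -> X k = list_null E8_null k.
Proof.
move=> h; edge_facts h 0%N 10%N.
have X0 : X 0%N = 0 by lia.
have X2 : X 2%N = 2 * X 1%N by lia.
have X3 : X 3%N = 3 * X 1%N by lia.
have X4 : X 4%N = 4 * X 1%N by lia.
have X5 : X 5%N = 6 * X 1%N by lia.
have X6 : X 6%N = 5 * X 1%N by lia.
have X7 : X 7%N = 4 * X 1%N by lia.
have X8 : X 8%N = 3 * X 1%N by lia.
have X9 : X 9%N = 2 * X 1%N by lia.
clear - h X0 X2 X3 X4 X5 X6 X7 X8 X9.
have [p0 X1] : p = 0%N /\ X 1%N = 1 by last_vertex h; lia.
split=> // -[|[|[|[|[|[|[|[|[|[|k]]]]]]]]]] // _; rewrite /list_null /=; lia.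
Qed.

Theorem pi_mult_D4pp (R : realType) : pi_mult_eq R (App 1) (Dpp 4) 2.
Proof.
rewrite Dpp_edgeE //; apply: (pi_mult_single_list R (s := D4_null) (r := 3)) => //.
- by rewrite /= /edge_row !big_cons !big_nil.
- by rewrite /= /edge_row !big_cons !big_nil.
- move=> P h.
  have h13 := h 1%N 3%N isT; have h35 := h 3%N 5%N isT.
  have h23 := h 2%N 3%N isT; have h34 := h 3%N 4%N isT.
  by move=> [|[|[|[|[|[|j]]]]]] // _ _; congruence.
exact: D4_enum.
Qed.

Theorem pi_mult_E6pp (R : realType) : pi_mult_eq R (App 1) E6pp 2.
Proof.
rewrite E6pp_edgeE; apply: (pi_mult_single_list R (s := E6_null) (r := 5)) => //.
- by rewrite /= /edge_row !big_cons !big_nil.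
- by rewrite /= /edge_row !big_cons !big_nil.
- move=> P h.
  have h1 := h 1%N 3%N isT; have h2 := h 2%N 4%N isT; have h3 := h 4%N 5%N isT.
  have h4 := h 3%N 5%N isT; have h5 := h 5%N 6%N isT; have h6 := h 6%N 7%N isT.
  by move=> [|[|[|[|[|[|[|[|j]]]]]]]] // _ _; congruence.
exact: E6_enum.
Qed.

Theorem pi_mult_E7pp (R : realType) : pi_mult_eq R (App 1) E7pp 2.
Proof.
rewrite E7pp_edgeE; apply: (pi_mult_single_list R (s := E7_null) (r := 5)) => //.
- by rewrite /= /edge_row !big_cons !big_nil.
- by rewrite /= /edge_row !big_cons !big_nil.
- move=> P h.
  have h1 := h 1%N 2%N isT; have h2 := h 2%N 4%N isT; have h3 := h 4%N 5%N isT.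
  have h4 := h 3%N 5%N isT; have h5 := h 5%N 6%N isT; have h6 := h 6%N 7%N isT.
  have h7 := h 7%N 8%N isT.
  by move=> [|[|[|[|[|[|[|[|[|j]]]]]]]]] // _ _; congruence.
exact: E7_enum.
Qed.

Theorem pi_mult_E8pp (R : realType) : pi_mult_eq R (App 1) E8pp 2.
Proof.
rewrite E8pp_edgeE; apply: (pi_mult_single_list R (s := E8_null) (r := 5)) => //.
- by rewrite /= /edge_row !big_cons !big_nil.
- by rewrite /= /edge_row !big_cons !big_nil.
- move=> P h.
  have h1 := h 1%N 9%N isT; have h2 := h 2%N 4%N isT; have h3 := h 4%N 5%N isT.
  have h4 := h 3%N 5%N isT; have h5 := h 5%N 6%N isT; have h6 := h 6%N 7%N isT.
  have h7 := h 7%N 8%N isT; have h8 := h 8%N 9%N isT.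
  by move=> [|[|[|[|[|[|[|[|[|[|j]]]]]]]]]] // _ _; congruence.
exact: E8_enum.
Qed.

Theorem corollary6p6 (R : realType) :
  [/\ (forall (n : nat) (X : 'M[int]_n), Ext R X -> Hyp R X ->
         pi_mult_eq R (App 1) X 2)
      /\ [/\ forall n : nat, (1 <= n <= 7)%N ->
               pi_mult_eq R (App 1) (App n) 2,
             forall n : nat, (4 <= n <= 8)%N ->
               pi_mult_eq R (App 1) (Dpp n) 2,
             pi_mult_eq R (App 1) E6pp 2,
             pi_mult_eq R (App 1) E7pp 2 &
             pi_mult_eq R (App 1) E8pp 2],
      pi_mult_eq R (App 1) (App 8) 6
      /\ (forall n : nat, (9 <= n)%N -> pi_mult_eq R (App 1) (App n) 10) &
      pi_mult_eq R (App 1) (Dpp 9) 6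
      /\ (forall n : nat, (10 <= n)%N -> pi_mult_eq R (App 1) (Dpp n) 4)].
Proof.
split.
- split; first by move=> n X; exact: pi_mult_ext_hyp.
  split.
  + move=> n n17; have := pi_mult_App R (n := n); rewrite /App_list.
    have -> : (8 <= n)%N = false by lia.
    have -> : (9 <= n)%N = false by lia.
    by apply; lia.
  + move=> n n48; have [->|n4] := eqVneq n 4%N; first exact: pi_mult_D4pp.
    have := pi_mult_Dpp R (n := n); rewrite /Dpp_list.
    have -> : (n == 9)%N = false by lia.
    have -> : (10 <= n)%N = false by lia.
    by apply; lia.
  + exact: pi_mult_E6pp.
  + exact: pi_mult_E7pp.
  exact: pi_mult_E8pp.
- split; first exact: (pi_mult_App R (n := 8)).
  move=> n n9; have := pi_mult_App R (n := n); rewrite /App_list n9.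
  have -> : (8 <= n)%N by lia.
  by apply; lia.
split; first exact: (pi_mult_Dpp R (n := 9)).
move=> n n10; have := pi_mult_Dpp R (n := n); rewrite /Dpp_list n10.
have -> : (n == 9)%N = false by lia.
by apply; lia.
Qed.
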